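(* For every sufficiently large $n \in \mathbb{N}$, there exist signs $\varepsilon_k\in\{-1,1\}$, $-2n\le k\le 2n$, such that the Laurent polynomial $P(z) = \sum_{k=-2n}^{2n} \varepsilon_k z^k$ satisfies \[ 2^{-160}\sqrt{n} \le |P(z)| \le 2^{12}\sqrt{n} \] for all $z \in \mathbb{C}$ with $|z| = 1$. *)

(* Defs.v *)
From HB Require Import structures.
From mathcomp Require Import all_boot all_order all_algebra.
From mathcomp Require Import reals.
From mathcomp.real_closed Require Import complex.
Set Implicit Arguments. Unset Strict Implicit. Unset Printing Implicit Defensive.
Import Order.TTheory GRing.Theory Num.Theory.
Local Open Scope ring_scope.

(* The Laurent polynomial P(z) = \sum_{k=-2n}^{2n} eps_k z^k, where the
   coefficient of z^k is stored as eps (k + 2n), i.e. index i in [0, 4n]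
   corresponds to exponent k = i - 2n (integer exponent, exprz). *)
Definition laurent_sign_poly (R : rcfType) (n : nat) (eps : nat -> int)
    (z : R[i]) : R[i] :=
  \sum_(0 <= i < 4 * n + 1) (eps i)%:~R * z ^ (i%:Z - (2 * n)%:Z).

(* Main.v *)
(** On z = cis x, take P = (eps_0 + 2 c) + 2 i s with c a cosine sum on few
    even frequencies and s a sine sum on the others, so that c and s are real.

    With u = 2 x, T = 2^t of order 2^-48 n and M = 128 T, let c be the real part
    of z^M p(z) + z^(2M) q(z) at z = cis u, for the Rudin-Shapiro pair p, q of
    degree T - 1.  As |p|^2 + |q|^2 = 2 T, c is bounded by a small multiple of
    sqrt n.  On the scale 1 / M it is nearly a combination of two waves of
    frequencies M and 2 M, so c, c', c'', c''' are never small together; by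
    Rolle, c cannot be tiny at four separated points of a short window.  Cut
    [0, pi / 2] into cells of length 1 / n: the bad cells, where c is tiny
    somewhere, therefore come in short clusters, and there are few of them.

    The sum s has to be large on the bad cells.  First place at every bad cell
    a spike of height of order sqrt n, a shifted Fejer-type kernel that decays
    quadratically, with one sign per cluster so that spikes in a cluster do not
    cancel.  The signs are chosen by discrepancy to make the coefficients of
    the sum of the spikes at most 1 in absolute value.  Those coefficients are
    then rounded to signs at a cost smaller than the spikes in the sup norm,
    which is controlled at O(n) sample points.

    Both choices of signs use one rounding lemma in the style of Spencer.
    A partial colouring is a minimizer over the cube of
    (sum_i slack_i^-16) exp(-8 |x|^2 / n): if too many coordinates were not at
    an end of [-1, 1], moving both ways along a direction orthogonal to the
    constraints with little slack, and of low energy on the others, would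
    decrease the potential. *)

Require Import Defs.
From HB Require Import structures.
From mathcomp Require Import all_boot all_order all_algebra.
From mathcomp Require Import reals.
From mathcomp.real_closed Require Import complex.
From mathcomp Require Import zify ring lra.
From mathcomp Require Import boolp classical_sets functions topology normedtype.
From mathcomp Require Import sequences derive realfun exp trigo.

Set Implicit Arguments. Unset Strict Implicit. Unset Printing Implicit Defensive.
Import Order.TTheory GRing.Theory Num.Theory numFieldNormedType.Exports.
Import Normc.
Local Open Scope ring_scope.

(** * Discrepancy: rounding in the cube *)

Lemma exists_kernel_vector (F : fieldType) (N k : nat) (A : 'M[F]_(N, k)) :
  (k < N)%N -> exists2 y : 'rV[F]_N, y != 0 & y *m A = 0.
Proof.
move=> kN; exists (nz_row (kermx A)); last first.
  by apply/sub_kermxP; exact: nz_row_sub.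
rewrite nz_row_eq0 -mxrank_eq0 mxrank_ker -lt0n subn_gt0.
exact: leq_ltn_trans (rank_leq_col A) kN.
Qed.

Definition dotr {R : pzSemiRingType} {N : nat} (u v : 'rV[R]_N) : R :=
  \sum_j u 0 j * v 0 j.

Lemma dotrE (R : pzRingType) N (u v : 'rV[R]_N) : dotr u v = (u *m v^T) 0 0.
Proof. by rewrite mxE; apply: eq_bigr => j _; rewrite mxE. Qed.

Lemma dotrC (R : comPzRingType) N (u v : 'rV[R]_N) : dotr u v = dotr v u.
Proof. by apply: eq_bigr => j _; rewrite mulrC. Qed.

Lemma dotrDr (R : pzRingType) N (u v w : 'rV[R]_N) :
  dotr u (v + w) = dotr u v + dotr u w.
Proof. by rewrite !dotrE linearD mulmxDr mxE. Qed.

Lemma dotrZr (R : comPzRingType) N (u v : 'rV[R]_N) a :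
  dotr u (a *: v) = a * dotr u v.
Proof. by rewrite !dotrE linearZ -scalemxAr mxE. Qed.

Lemma dotrNr (R : comPzRingType) N (u v : 'rV[R]_N) : dotr u (- v) = - dotr u v.
Proof. by rewrite -scaleN1r dotrZr mulN1r. Qed.

Lemma dotr_ge0 (R : realDomainType) N (u : 'rV[R]_N) : 0 <= dotr u u.
Proof. by apply: sumr_ge0 => j _; rewrite -expr2 sqr_ge0. Qed.

Lemma dotr_gt0 (R : realDomainType) N (u : 'rV[R]_N) : u != 0 -> 0 < dotr u u.
Proof.
move=> u0; rewrite lt_neqAle dotr_ge0 andbT eq_sym; apply: contra u0.
rewrite psumr_eq0 => [/allP u0|j _]; last by rewrite -expr2 sqr_ge0.
apply/eqP/rowP => j; rewrite mxE.
by have := u0 j (mem_index_enum _); rewrite /= mulf_eq0 orbb => /eqP.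
Qed.

Definition deflate {R : fieldType} {N : nat} (y v : 'rV[R]_N) : 'rV[R]_N :=
  v - (dotr y v / dotr y y) *: y.

Lemma dotr_deflate (R : fieldType) N (y v z : 'rV[R]_N) :
  dotr z y = 0 -> dotr z (deflate y v) = dotr z v.
Proof. by move=> zy; rewrite dotrDr dotrNr dotrZr zy mulr0 oppr0 addr0. Qed.

Lemma dotr_deflate_self (R : fieldType) N (y v : 'rV[R]_N) : dotr y y != 0 ->
  dotr (deflate y v) (deflate y v) = dotr v v - dotr y v ^+ 2 / dotr y y.
Proof.
move=> y0; rewrite {2}/deflate !(dotrDr, dotrNr, dotrZr).
rewrite ![dotr (deflate _ _) _]dotrC /deflate !(dotrDr, dotrNr, dotrZr).
by rewrite [dotr v y]dotrC; field.
Qed.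

(* A quadratic form takes a value at most its average on some unit vector:
   if y does not work, restrict the form to the orthogonal of y, which
   lowers the trace by more than its average. *)
Lemma low_energy_vector (R : realFieldType) (N m d : nat) (c : 'I_m -> R) :
  (forall i, 0 <= c i) ->
  forall (k : nat) (A : 'M[R]_(N, k)) (v : 'I_m -> 'rV[R]_N),
  (d.+1 + k <= N)%N ->
  exists y : 'rV[R]_N, [/\ y != 0, y *m A = 0 &
    d.+1%:R * (\sum_i c i * dotr y (v i) ^+ 2)
      <= (\sum_i c i * dotr (v i) (v i)) * dotr y y].
Proof.
move=> c0; elim: d => [|d IH] k A v dk;
  (have [|y y0 yA] := @exists_kernel_vector R N k A; first lia);
  have ygt0 := @dotr_gt0 _ _ _ y0;
  have trE : \sum_i c i * dotr (deflate y (v i)) (deflate y (v i)) =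
    \sum_i c i * dotr (v i) (v i)
    - (\sum_i c i * dotr y (v i) ^+ 2) / dotr y y by
  [rewrite mulr_suml -sumrB; apply: eq_bigr => i _;
   rewrite dotr_deflate_self ?gt_eqF //; ring].
  exists y; split => //; rewrite mul1r.
  rewrite -ler_pdivrMr // -subr_ge0 -trE.
  by apply: sumr_ge0 => i _; rewrite mulr_ge0 // dotr_ge0.
set tr := \sum_i c i * dotr (v i) (v i) in trE *.
set Q := \sum_i c i * dotr y (v i) ^+ 2 in trE.
have [|Qbig] := leP (d.+2%:R * Q) (tr * dotr y y); first by exists y.
(* Appending [y^T] to the constraints makes [z] orthogonal to [y], so the deflated vectors and the
   original ones have the same products with [z]. *)
have [|z [z0 zA zQ]] :=
  IH (k + 1)%N (row_mx A y^T) (fun i => deflate y (v i)); first lia.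
move: zA; rewrite mul_mx_row -[0]row_mx0 => /eq_row_mx[zA zy].
have zy0 : dotr z y = 0 by rewrite dotrE zy mxE.
exists z; split => //.
move: zQ; under eq_bigr do rewrite dotr_deflate //.
rewrite trE; set Qz := \sum_i _ => zQ.
have z00 := dotr_ge0 z.
have h1 : tr - Q / dotr y y <= tr * (d.+1%:R / d.+2%:R).
  have : tr / d.+2%:R < Q / dotr y y.
    rewrite ltr_pdivrMr ?ltr0n // mulrAC ltr_pdivlMr //; lra.
  have -> : d.+1%:R / d.+2%:R = 1 - d.+2%:R^-1 :> R.
    have -> : d.+1%:R = d.+2%:R - 1 :> R by rewrite -[d.+2%:R]natr1 addrK.
    by rewrite mulrBl mul1r divff // pnatr_eq0.
  by move=> /ltW; rewrite mulrBr mulr1 lerD2l lerN2.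
have := ler_wpM2r z00 h1; move/(le_trans zQ).
rewrite (_ : tr * _ * _ = d.+1%:R * (tr * dotr z z / d.+2%:R)); last by ring.
by rewrite ler_pM2l ?ltr0n // ler_pdivlMr ?ltr0n // mulrC.
Qed.

Lemma continuous_bigsum (T : topologicalType) (R : realType) (I : Type)
    (r : seq I) (P : pred I) (F : I -> T -> R) :
  (forall i, continuous (F i)) ->
  continuous (fun x => \sum_(i <- r | P i) F i x).
Proof.
move=> cF; elim: r => [|i r IH] x.
  rewrite (_ : (fun _ => _) = cst 0); first exact: cst_continuous.
  by apply/funext => y; rewrite big_nil.
case: (boolP (P i)) => Pi.
  rewrite (_ : (fun _ => _) = (F i + (fun x => \sum_(i <- r | P i) F i x))%R).
    by apply: continuousD; [exact: cF|exact: IH].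
  by apply/funext => y; rewrite big_cons Pi.
rewrite (_ : (fun _ => _) = (fun x => \sum_(i <- r | P i) F i x)).
  exact: IH.
by apply/funext => y; rewrite big_cons (negbTE Pi).
Qed.

Definition face {R : realType} {N : nat} (S : {set 'I_N}) (x0 : 'rV[R]_N) :
    set 'rV[R]_N :=
  [set x | forall j, `|x 0 j| <= 1 /\ (j \notin S -> x 0 j = x0 0 j)]%classic.

Lemma compact_face (R : realType) N (S : {set 'I_N}) (x0 : 'rV[R]_N) :
  (forall j, `|x0 0 j| <= 1) -> compact (face S x0).
Proof.
move=> x01.
pose A (j : 'I_N) : set R :=
  if j \in S then `[-1, 1]%classic else [set x0 0 j]%classic.
rewrite (_ : face S x0 = [set v : 'rV[R]_N | forall j, A j (v ord0 j)]%classic).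
  apply: (@rV_compact R N A) => j; rewrite /A; case: ifP => _; last exact: compact_set1.
  exact: segment_compact.
apply/seteqP; split => x /= h j; have := h j; rewrite /A; case: ifPn => jS /=.
- by rewrite in_itv /= -ler_norml; case.
- by case=> _ ->.
- by rewrite in_itv /= -ler_norml.
- by move=> ->; split.
Qed.

Lemma continuous_dotr (R : realType) N (v x0 : 'rV[R]_N) :
  continuous (fun x : 'rV[R]_N => dotr v (x - x0)).
Proof.
apply: continuous_bigsum => j x.
apply: continuousM; first exact: cst_continuous.
rewrite (_ : (fun _ => _) = ((fun x : 'rV[R]_N => x 0 j) - cst (x0 0 j))).
  by apply: continuousB; [exact: coord_continuous|exact: cst_continuous].
by apply/funext => y; rewrite !mxE.
Qed.

Section Potential.
Variables (R : realType) (N m : nat) (S : {set 'I_N}).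
Variables (v : 'I_m -> 'rV[R]_N) (x0 : 'rV[R]_N) (b eta : R).

Definition slack (x : 'rV[R]_N) i := b - dotr (v i) (x - x0).

(** The floor [eta] makes each term defined and continuous on the whole face; at the minimizer every
    slack exceeds [eta] and the floor is inactive. *)
Definition potential (x : 'rV[R]_N) : R :=
  \sum_i (Num.max (slack x i) eta) ^- 16.

Definition energy (x : 'rV[R]_N) : R := \sum_(j in S) x 0 j ^+ 2.

Lemma exists_min_potential (l : R) : 0 < eta -> (forall j, `|x0 0 j| <= 1) ->
  exists2 x, face S x0 x & forall y, face S x0 y ->
    potential x * expR (- l * energy x) <= potential y * expR (- l * energy y).
Proof.
move=> eta0 x01.
have [||x] := @EVT_min_rV R N
  (fun x => potential x * expR (- l * energy x)) (face S x0) _ (compact_face x01).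
- by exists x0 => j; split.
- apply: continuous_subspaceT => x; apply: continuousM.
    apply: continuous_bigsum => i {}x.
    apply: (@continuous_comp _ _ _ (fun x => Num.max (slack x i) eta)
      (fun s => s ^- 16)).
      apply: continuous_max; last exact: cst_continuous.
      apply: continuousB; first exact: cst_continuous.
      exact: continuous_dotr.
    apply: continuousV; last exact: exprn_continuous.
    by rewrite expf_neq0 // gt_eqF // lt_max eta0 orbT.
  apply: (@continuous_comp _ _ _ (fun x => - l * energy x) expR);
    last exact: continuous_expR.
  apply: continuousM; first exact: cst_continuous.
  apply: continuous_bigsum => j {}x.
  apply: (@continuous_comp _ _ _ (fun x : 'rV[R]_N => x 0 j) (fun s => s ^+ 2)).
    exact: coord_continuous.
  exact: exprn_continuous.
- by rewrite inE => fx xmin; exists x => // y fy; apply: xmin; rewrite inE.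
Qed.
End Potential.

(** The Taylor coefficient of [t ^+ 2] is 136, and 150 leaves room for the higher terms. A quadratic
    slightly below the Taylor polynomial of [(1 - t) ^+ 4] is squared twice, each time giving up a
    little of the second-order coefficient. *)
Lemma expN16_le_quadratic (R : realFieldType) (t : R) : `|t| <= 1000^-1 ->
  (1 - t) ^- 16 <= 1 + 16 * t + 150 * t ^+ 2.
Proof.
rewrite ler_norml => /andP[t1 t2].
have sq (X Y Z : R) : 0 <= Y -> Y <= X -> Z <= Y ^+ 2 -> Z <= X ^+ 2.
  move=> Y0 YX ZY; apply: le_trans ZY _.
  by rewrite lerXn2r // nnegrE; apply: le_trans YX.
have h4 : 1 - 4 * t + 59 / 10 * t ^+ 2 <= (1 - t) ^+ 4.
  rewrite -subr_ge0 (_ : _ - _ = t ^+ 2 * (1 / 10 - 4 * t + t ^+ 2)); last by field.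
  apply: mulr_ge0; nra.
have h8 : 1 - 8 * t + 277 / 10 * t ^+ 2 <= ((1 - t) ^+ 4) ^+ 2.
  apply: sq h4 _; first nra.
  rewrite -subr_ge0 (_ : _ - _ =
    t ^+ 2 * (1 / 10 - 236 / 5 * t + (59 / 10) ^+ 2 * t ^+ 2)); last by field.
  apply: mulr_ge0; nra.
have h16 : 1 - 16 * t + 1189 / 10 * t ^+ 2 <= (((1 - t) ^+ 4) ^+ 2) ^+ 2.
  apply: sq h8 _; first nra.
  rewrite -subr_ge0 (_ : _ - _ =
    t ^+ 2 * (1 / 2 - 2216 / 5 * t + (277 / 10) ^+ 2 * t ^+ 2)); last by field.
  apply: mulr_ge0; nra.
rewrite -!exprM /= in h16.
rewrite -[leLHS]mul1r ler_pdivrMr; last by apply: exprn_gt0; lra.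
have q0 : 0 <= 1 + 16 * t + 150 * t ^+ 2 by nra.
apply: le_trans (ler_wpM2l q0 h16).
rewrite -subr_ge0 (_ : _ - _ = t ^+ 2 * (129 / 10 - 2488 / 5 * t
  + 150 * 1189 / 10 * t ^+ 2)); last by field.
apply: mulr_ge0; nra.
Qed.

(** After scaling by [s], the linear terms of the two sides cancel, and [300 = 2 * 150]. *)
Lemma expN16_second_difference (R : realFieldType) (s d : R) :
  0 < s -> `|d| <= s / 1000 ->
  (s - d) ^- 16 + (s + d) ^- 16 <= 2 * s ^- 16 + 300 * (d ^+ 2 * s ^- 18).
Proof.
move=> s0 ds.
have key (t : R) : `|t| <= s / 1000 ->
    (s - t) ^- 16 <= s ^- 16 * (1 + 16 * (t / s) + 150 * (t / s) ^+ 2).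
  move=> ts; have -> : s - t = s * (1 - t / s) by field; rewrite gt_eqF.
  rewrite exprMn invfM ler_pM2l ?invr_gt0 ?exprn_gt0 //.
  apply: expN16_le_quadratic.
  by rewrite normrM normfV (gtr0_norm s0) ler_pdivrMr // mulrC.
have := lerD (key d ds) (key (- d) _).
rewrite opprK normrN => /(_ ds) /le_trans; apply.
by rewrite le_eqVlt; apply/orP; left; apply/eqP; field; rewrite gt_eqF.
Qed.

(** Provides one step length that respects finitely many positive margins at once. *)
Lemma exists_small_scale (R : realFieldType) (I : finType) (a b : I -> R) :
  (forall i, 0 < a i) -> (forall i, 0 <= b i) ->
  exists2 e : R, 0 < e & forall i, e * b i <= a i.
Proof.
move=> a0 b0; have ba0 i : 0 <= b i / a i by rewrite divr_ge0 // ltW.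
have s0 : 0 <= \sum_i b i / a i by apply: sumr_ge0.
exists (1 + \sum_i b i / a i)^-1; first by rewrite invr_gt0; lra.
move=> i; rewrite mulrC ler_pdivrMr; last lra.
rewrite mulrC -ler_pdivrMr // (bigD1 i) //= addrCA lerDl.
by rewrite addr_ge0 // sumr_ge0.
Qed.

Lemma card_markov (R : realFieldType) (I : finType) (w : I -> R) (t : R) :
  (forall i, 0 <= w i) -> 0 <= t ->
  #|[set i | t < w i]|%:R * t <= \sum_i w i.
Proof.
move=> w0 t0; rewrite (bigID (mem [set i | t < w i])) /=.
rewrite -[leLHS]addr0 lerD ?sumr_ge0 //.
rewrite mulr_natl -sumr_const.
by apply: ler_sum => i; rewrite inE => /ltW.
Qed.

(** Vanishing off [F] and orthogonality to the constraints in [H] cost [#|~: F| + #|H|] dimensions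
    out of [N], leaving [#|F| - #|H|] for the averaging in [low_energy_vector]. Restricted to [F],
    each [v i] has squared norm at most [#|F|], which bounds the trace. *)
Lemma low_energy_in_face (R : realFieldType) (N m : nat) (F : {set 'I_N})
    (H : {set 'I_m}) (v : 'I_m -> 'rV[R]_N) (c : 'I_m -> R) :
  (#|H| < #|F|)%N -> (forall i, 0 <= c i) ->
  (forall i j, `|v i 0 j| <= 1) ->
  exists y : 'rV[R]_N, [/\ y != 0, forall j, j \notin F -> y 0 j = 0,
    forall i, i \in H -> dotr (v i) y = 0 &
    (#|F| - #|H|)%:R * (\sum_i c i * dotr (v i) y ^+ 2)
      <= (\sum_i c i) * #|F|%:R * dotr y y].
Proof.
move=> HF c0 v1.
pose A : 'M[R]_(N, #|~: F| + #|H|) :=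
  row_mx (\matrix_(j, k) (j == enum_val k)%:R) (\matrix_(j, k) v (enum_val k) 0 j).
pose w i : 'rV[R]_N := \row_j (if j \in F then v i 0 j else 0).
have [|y [y0 yA yE]] := @low_energy_vector R N m (#|F| - #|H|).-1 c c0 _ A w.
  have := cardsC F; rewrite card_ord; lia.
move: yA; rewrite mul_mx_row -row_mx0 => /eq_row_mx[yF yH].
have {}yF j : j \notin F -> y 0 j = 0.
  rewrite -finset.in_setC => jF; have /rowP/(_ (enum_rank_in jF j)) := yF.
  rewrite !mxE (bigD1 j) //= big1 => [|k kj].
    by rewrite mxE enum_rankK_in // eqxx mulr1 addr0.
  by rewrite mxE enum_rankK_in // (negbTE kj) mulr0.
exists y; split => //.
  move=> i iH; have /rowP/(_ (enum_rank_in iH i)) := yH.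
  rewrite !mxE dotrC => h; rewrite -[RHS]h.
  by apply: eq_bigr => j _; rewrite mxE enum_rankK_in.
move: yE; rewrite prednK; last lia.
have yw i : dotr y (w i) = dotr (v i) y.
  rewrite dotrC; apply: eq_bigr => j _; rewrite mxE.
  by case: ifPn => // /yF ->; rewrite !mulr0.
under eq_bigr do rewrite yw.
move=> /le_trans; apply.
rewrite ler_wpM2r ?dotr_ge0 // mulr_suml; apply: ler_sum => i _.
rewrite ler_wpM2l //; rewrite /dotr (bigID (mem F)) /= [X in _ + X]big1 => [|j].
  rewrite addr0 -[leRHS]mulr1 mulr_natl -sumr_const; apply: ler_sum => j jF.
  by rewrite mxE jF -expr2 -real_normK ?num_real // expr_le1.
by rewrite mxE => /negbTE ->; rewrite mulr0.
Qed.

Section PartialColouring.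
Variables (R : realType) (N m : nat) (S : {set 'I_N}).
Variables (v : 'I_m -> 'rV[R]_N) (x0 : 'rV[R]_N) (b : R).
Hypothesis v1 : forall i j, `|v i 0 j| <= 1.
Hypothesis x01 : forall j, `|x0 0 j| <= 1.
Hypothesis b0 : 0 < b.
Hypothesis m0 : (0 < m)%N.
Hypothesis S0 : (0 < #|S|)%N.
Hypothesis bS : 14 ^+ 16 * #|S|%:R ^+ 7 * m%:R <= b ^+ 16.

Let n : R := #|S|%:R.
Let eta : R := b / (6 * m%:R).
Let Phi := potential v x0 b eta.
Let E := @energy R N S.

Let n0 : 0 < n. Proof. by rewrite ltr0n. Qed.
Let mR0 : 0 < m%:R :> R. Proof. by rewrite ltr0n. Qed.
Let eta0 : 0 < eta. Proof. by rewrite divr_gt0 // mulr_gt0. Qed.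

(** From [1 - 1 / 8 <= expR (- (1 / 8))], together with [(8 / 7) ^+ 8 <= 3]. *)
Lemma expR8_le : expR 8 <= 3 ^+ 8 :> R.
Proof.
have -> : 8 = 64%:R * (1 / 8) :> R by field.
rewrite expRM_natl.
have h : expR (1 / 8) <= 8 / 7 :> R.
  have := @expR_ge1Dx R (- (1 / 8)); rewrite expRN => h.
  by rewrite -[expR _]invrK -[8 / 7]invrK lef_pV2 ?posrE ?invr_gt0 ?expR_gt0 //; lra.
apply: le_trans (_ : (8 / 7) ^+ 64 <= _).
  by rewrite lerXn2r // nnegrE ?expR_ge0 //; lra.
have -> : 64%N = (8 * 8)%N by [].
by rewrite exprM lerXn2r // ?nnegrE; lra.
Qed.

Lemma slack_x0 i : slack v x0 b x0 i = b.
Proof. by rewrite /slack subrr /dotr big1 ?subr0 // => j _; rewrite mxE mulr0. Qed.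

Lemma energy_ge0 x : 0 <= E x.
Proof. by apply: sumr_ge0 => j _; apply: sqr_ge0. Qed.

Lemma energy_le x : face S x0 x -> E x <= n.
Proof.
move=> fx; have -> : n = \sum_(j in S) 1 by rewrite sumr_const.
apply: ler_sum => j _.
by rewrite -real_normK ?num_real // expr_le1 //; case: (fx j).
Qed.

(** At [x0] every slack is [b], and the exponential weights at two points of the face differ by a
    factor of at most [expR 8], as the energy lies between 0 and [n]. *)
Lemma potential_min_le x : face S x0 x ->
  Phi x * expR (- (8 / n) * E x) <= Phi x0 * expR (- (8 / n) * E x0) ->
  Phi x <= m%:R * b ^- 16 * 3 ^+ 8.
Proof.
move=> fx; have -> : Phi x0 = m%:R * b ^- 16.
  rewrite /Phi /potential (eq_bigr (fun=> b ^- 16)) => [|i _].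
    by rewrite sumr_const card_ord mulr_natl.
  rewrite slack_x0; congr (_ ^- _); apply/max_idPl.
  rewrite ler_pdivrMr ?mulr_gt0 // -[leLHS]mulr1 ler_pM2l //.
  by have : 1 <= m%:R :> R; [rewrite ler1n|lra].
have P0 : 0 <= m%:R * b ^- 16 :> R by rewrite mulr_ge0 // invr_ge0 exprn_ge0 // ltW.
rewrite -ler_pdivlMr ?expR_gt0 // -(mulrA (_ * _)) -expRB => /le_trans; apply.
apply: ler_wpM2l => //; apply: le_trans expR8_le; rewrite ler_expR.
have h : 8 / n * E x <= 8.
  by rewrite mulrAC ler_pdivrMr // ler_pM2l //; exact: energy_le.
have : 0 <= 8 / n * E x0 by rewrite mulr_ge0 ?energy_ge0 // divr_ge0 // ltW.
lra.
Qed.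

Lemma slackD x y i a : slack v x0 b (x + a *: y) i =
  slack v x0 b x i - a * dotr (v i) y.
Proof.
by rewrite /slack [x + _]addrC -addrA dotrDr dotrZr opprD addrA addrAC.
Qed.

Lemma potential_gt0 x : 0 < Phi x.
Proof.
rewrite /Phi /potential (bigD1 (Ordinal m0)) //= ltr_wpDr //.
  by apply: sumr_ge0 => i _; rewrite invr_ge0 exprn_ge0 // le_max (ltW eta0) orbT.
by rewrite invr_gt0 exprn_gt0 // lt_max eta0 orbT.
Qed.

(** A single slack not above [eta] would already contribute [(6 * m) ^ 16 / b ^ 16], more than the
    bound on the whole potential. *)
Lemma eta_lt_slack x i : Phi x <= m%:R * b ^- 16 * 3 ^+ 8 ->
  eta < slack v x0 b x i.
Proof.
move=> Px; rewrite ltNge; apply/negP => /max_idPr si.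
have : eta ^- 16 <= Phi x.
  rewrite /Phi /potential (bigD1 i) //= si lerDl.
  by apply: sumr_ge0 => k _; rewrite invr_ge0 exprn_ge0 // le_max (ltW eta0) orbT.
move/le_trans/(_ Px); apply/negP; rewrite -ltNge /eta expr_div_n invf_div.
rewrite mulrAC [ltRHS]mulrC [ltLHS]mulrC ltr_pM2l ?invr_gt0 ?exprn_gt0 //.
have m1 : 1 <= m%:R :> R by rewrite ler1n.
rewrite exprMn (@lt_le_trans _ _ (6 ^+ 16 * m%:R)) //.
  rewrite mulrC ltr_pM2r // -[16%N]/(8 * 2)%N exprM exprAC.
  by rewrite ltrXn2r // ?nnegrE; lra.
rewrite ler_pM2l ?exprn_gt0 // exprS -[leLHS]mulr1 ler_pM2l //.
exact: exprn_ege1.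
Qed.

(** Here [f] stands for the number of free coordinates and [w] for the slack of a constraint that is
    not heavy. The constant 14 of [bS] comes from here: [8 * 256 * 75 ^ 8 <= 14 ^ 16]. *)
Lemma light_le (P f w : R) : n <= 256 * f -> 0 < f ->
  P <= m%:R * b ^- 16 * 3 ^+ 8 -> w ^- 16 <= 8 * P / f ->
  w ^- 2 <= (25 * n)^-1.
Proof.
move=> nf f0 Pm wP.
have w0 : 0 <= w ^- 2 by rewrite invr_ge0 sqr_ge0.
have b160 : 0 < b ^+ 16 by rewrite exprn_gt0.
rewrite -(@ler_pXn2r _ 8) ?nnegrE //; last by rewrite invr_ge0 mulr_ge0 // ltW.
rewrite !exprVn -exprM; apply: le_trans wP _.
rewrite ler_pdivrMr // [leRHS]mulrC ler_pdivlMr; last by rewrite exprn_gt0 // mulr_gt0.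
apply: le_trans (_ : n / 256 <= _); last by rewrite ler_pdivrMr // mulrC.
have Pb : P * b ^+ 16 <= m%:R * 3 ^+ 8.
  by rewrite -ler_pdivlMr //; apply: le_trans Pm _; rewrite mulrAC.
rewrite -(@ler_pM2r _ (b ^+ 16)) //.
apply: le_trans (_ : 8 * (m%:R * 3 ^+ 8) * (25 * n) ^+ 8 <= _).
  rewrite [leLHS](_ : _ = 8 * (25 * n) ^+ 8 * (P * b ^+ 16)); last by ring.
  rewrite [leRHS](_ : _ = 8 * (25 * n) ^+ 8 * (m%:R * 3 ^+ 8)); last by ring.
  by rewrite ler_wpM2l // mulr_ge0 // exprn_ge0 // mulr_ge0 // ltW.
apply: le_trans (_ : n / 256 * (14 ^+ 16 * n ^+ 7 * m%:R) <= _); last first.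
  by rewrite ler_pM2l // divr_gt0.
rewrite [leLHS](_ : _ = 8 * 3 ^+ 8 * 25 ^+ 8 * (n ^+ 8 * m%:R)); last by ring.
rewrite [leRHS](_ : _ = 14 ^+ 16 / 256 * (n ^+ 8 * m%:R)); last by field.
by rewrite ler_pM2r; [lra|rewrite mulr_gt0 // exprn_gt0].
Qed.

(** Were at least [n / 256] coordinates free, the moves [e] and [- e] along a low-energy direction
    [y] would contradict minimality. Summed over the two moves, the potential gains at most [96 / 7]
    times [P * e ^ 2 * |y| ^ 2 / n], whereas the exponential factor would require a gain of at least
    16 times that. *)
Lemma min_potential_few_free x : face S x0 x ->
  (forall y, face S x0 y -> Phi x * expR (- (8 / n) * E x)
     <= Phi y * expR (- (8 / n) * E y)) ->
  (256 * #|[set j in S | (`|x 0 j| < 1)%R]| < #|S|)%N.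
Proof.
move=> fx xmin; rewrite ltnNge; apply/negP; set F := [set j in S | _] => nfN.
have nf : n <= 256 * #|F|%:R by rewrite -natrM ler_nat.
have F0 : (0 < #|F|)%N by lia.
have f0 : 0 < #|F|%:R :> R by rewrite ltr0n.
have fx0 : face S x0 x0 by move=> j; split.
have Pm := potential_min_le fx (xmin _ fx0).
have sEta i := eta_lt_slack i Pm.
have P0 := potential_gt0 x.
set s := slack v x0 b x in sEta.
have s0 i : 0 < s i := lt_trans eta0 (sEta i).
have PE : Phi x = \sum_i s i ^- 16.
  by apply: eq_bigr => i _; congr (_ ^- _); apply/max_idPl/ltW/sEta.
set P := Phi x in Pm P0 PE.
have P8f : 0 < 8 * P / #|F|%:R by rewrite divr_gt0 // mulr_gt0.
(* The heavy constraints: by Markov's inequality they are at most an eighth as many as the free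
   coordinates. *)
pose H := [set i | 8 * P / #|F|%:R < s i ^- 16].
have s16 k i : 0 <= s i ^- k by rewrite invr_ge0 exprn_ge0 // ltW.
have H8 : 8 * #|H|%:R <= #|F|%:R :> R.
  have := card_markov (s16 16) (ltW P8f); rewrite -PE -/H.
  by rewrite mulrA ler_pdivrMr // mulrA mulrC ler_pM2l // mulrC.
have HF : (#|H| < #|F|)%N.
  by rewrite -(ltr_nat R); lra.
(* Heavy constraints get weight 0, since [y] will be orthogonal to them; [s i ^- 18] is, up to a
   constant, the second derivative of [s i ^- 16]. *)
pose c i := if i \in H then 0 else s i ^- 18.
have c0 i : 0 <= c i by rewrite /c; case: ifP.
have [y [y0 yF yH yQ]] := low_energy_in_face HF c0 v1.
have cP : \sum_i c i <= P * (25 * n)^-1.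
  rewrite PE mulr_suml; apply: ler_sum => i _; rewrite /c inE.
  case: ltP => [_|li]; first by rewrite mulr_ge0 // invr_ge0 mulr_ge0 // ltW.
  by rewrite -[18%N]/(16 + 2)%N exprD invfM ler_wpM2l // (light_le nf f0 Pm).
have yy0 := dotr_gt0 y0.
have Qle : \sum_i c i * dotr (v i) y ^+ 2 <= 8 / 7 * (P * (25 * n)^-1) * dotr y y.
  set Q := \sum_i _ in yQ *.
  have h7 : 7 * #|F|%:R <= 8 * (#|F| - #|H|)%:R :> R.
    by rewrite natrB ?(ltnW HF) //; lra.
  have Q0 : 0 <= Q by apply: sumr_ge0 => i _; rewrite mulr_ge0 // sqr_ge0.
  have h1 : 7 * #|F|%:R * Q <= 8 * ((#|F| - #|H|)%:R * Q).
    by rewrite [leRHS]mulrA ler_wpM2r.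
  have h2 := ler_wpM2r (ltW yy0) (ler_wpM2r (ltW f0) cP).
  rewrite -(@ler_pM2l _ (7 * #|F|%:R)) ?mulr_gt0 //; apply: le_trans h1 _.
  apply: le_trans (_ : 8 * (P * (25 * n)^-1 * #|F|%:R * dotr y y) <= _).
    by rewrite ler_pM2l //; apply: le_trans yQ h2.
  by rewrite le_eqVlt; apply/orP; left; apply/eqP; field; rewrite gt_eqF.
(* Margins for the step length: [s i / 1000] for the second-difference estimate, [s i - eta] to keep
   the floor inactive, the distance to the boundary to stay in the cube. Where [y] vanishes any
   positive margin will do, hence the default 1. *)
pose a (z : 'I_m + 'I_N) : R := match z with
  | inl i => Num.min (s i / 1000) (s i - eta)
  | inr j => if `|x 0 j| < 1 then 1 - `|x 0 j| else 1 end.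
pose d (z : 'I_m + 'I_N) : R := match z with
  | inl i => `|dotr (v i) y| | inr j => `|y 0 j| end.
have [||e e0 ed] := @exists_small_scale R _ a d.
- case=> [i|j] /=; first by rewrite lt_min divr_gt0 //= subr_gt0.
  by case: ifP => // h; rewrite subr_gt0.
- by case=> [i|j] /=.
have es i : e * `|dotr (v i) y| <= s i / 1000.
  by apply: le_trans (ed (inl i)) _; rewrite ge_min lexx.
have eeta i : e * `|dotr (v i) y| <= s i - eta.
  by apply: le_trans (ed (inl i)) _; rewrite ge_min lexx orbT.
have facee t : `|t| = e -> face S x0 (x + t *: y).
  move=> te j; rewrite !mxE; have [xj1 xjS] := fx j.
  have [jF|jF] := boolP (j \in F); last by rewrite yF // mulr0 addr0.
  move: jF (ed (inr j)); rewrite inE => /andP[-> xj] /=; rewrite xj => h.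
  split => //; apply: le_trans (ler_normD _ _) _.
  by rewrite normrM te; lra.
have Phie t : `|t| = e -> Phi (x + t *: y) = \sum_i (s i - t * dotr (v i) y) ^- 16.
  move=> te; apply: eq_bigr => i _; rewrite slackD -/s.
  congr (_ ^- _); apply/max_idPl; rewrite lerBrDr addrC -lerBrDr.
  by apply: le_trans (ler_norm _) _; rewrite normrM te.
have Ee t : E (x + t *: y) = E x + t * (2 * \sum_(j in S) x 0 j * y 0 j)
    + t ^+ 2 * dotr y y.
  have -> : dotr y y = \sum_(j in S) y 0 j ^+ 2.
    rewrite /dotr (bigID (mem S)) /= [X in _ + X]big1 => [|j jS].
      by rewrite addr0; apply: eq_bigr => j _; rewrite expr2.
    by rewrite yF ?mulr0 // inE (negbTE jS).
  rewrite /E /energy !mulr_sumr -!big_split /=; apply: eq_bigr => j _.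
  by rewrite !mxE; ring.
have Ple t : `|t| = e ->
    P * (1 + 8 / n * (E (x + t *: y) - E x)) <= Phi (x + t *: y).
  move=> te; have := xmin _ (facee t te); rewrite -/P.
  rewrite -ler_pdivlMr ?expR_gt0 // -(mulrA (Phi _)) -expRB => h.
  have h' := expR_ge1Dx (8 / n * (E (x + t *: y) - E x)).
  have := le_trans (ler_wpM2l (ltW P0) h') _; apply.
  rewrite -(@ler_pM2r _ (expR (- (8 / n * (E (x + t *: y) - E x))))) ?expR_gt0 //.
  rewrite -mulrA -expRD subrr expR0 mulr1; apply: le_trans h _.
  by rewrite le_eqVlt; apply/orP; left; apply/eqP; congr (_ * expR _); ring.
have te1 : `|e| = e by rewrite gtr0_norm.
have te2 : `|- e| = e by rewrite normrN.
(* Adding the two minimality inequalities cancels the part of the energy that is linear in the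
   step. *)
have := lerD (Ple _ te1) (Ple _ te2); rewrite !Ee !Phie // sqrrN -big_split /=.
have : \sum_i ((s i - e * dotr (v i) y) ^- 16 + (s i - - e * dotr (v i) y) ^- 16)
   <= 2 * P + 300 * (e ^+ 2 * \sum_i c i * dotr (v i) y ^+ 2).
  rewrite PE !mulr_sumr -big_split /=; apply: ler_sum => i _.
  rewrite mulNr opprK.
  apply: le_trans (expN16_second_difference (s0 i) _) _; first by rewrite normrM te1.
  rewrite /c; case: ifP => iH; first by rewrite yH // mulr0 expr0n /= !mul0r !mulr0.
  by rewrite exprMn [s i ^- 18 * _]mulrC !mulrA.
move=> h1 h2; have {h1 h2} := le_trans h2 h1.
set Sg := \sum_(j in S) _; move=> h.
have h3 : 300 * (e ^+ 2 * \sum_i c i * dotr (v i) y ^+ 2) <=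
   300 * (e ^+ 2 * (8 / 7 * (P * (25 * n)^-1) * dotr y y)).
  by rewrite ler_pM2l // ler_pM2l // exprn_gt0.
have h4 : 0 < P * n^-1 * e ^+ 2 * dotr y y.
  by rewrite !mulr_gt0 ?invr_gt0 ?exprn_gt0.
have h5 : 300 * (e ^+ 2 * (8 / 7 * (P * (25 * n)^-1) * dotr y y)) =
  96 / 7 * (P * n^-1 * e ^+ 2 * dotr y y) by field; rewrite gt_eqF.
have h6 : P * (1 + 8 / n * (E x + e * (2 * Sg) + e ^+ 2 * dotr y y - E x)) +
    P * (1 + 8 / n * (E x + - e * (2 * Sg) + e ^+ 2 * dotr y y - E x)) =
  2 * P + 16 * (P * n^-1 * e ^+ 2 * dotr y y) by field; rewrite gt_eqF.
move: h h3; rewrite h5 h6; lra.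
Qed.

End PartialColouring.

Lemma partial_rounding (R : realType) (N m : nat) (S : {set 'I_N})
    (v : 'I_m -> 'rV[R]_N) (x0 : 'rV[R]_N) (b : R) :
  (forall i j, `|v i 0 j| <= 1) -> (forall j, `|x0 0 j| <= 1) ->
  0 < b -> (0 < m)%N -> (0 < #|S|)%N ->
  14 ^+ 16 * #|S|%:R ^+ 7 * m%:R <= b ^+ 16 ->
  exists x : 'rV[R]_N, [/\ face S x0 x, forall i, dotr (v i) (x - x0) <= b &
    (256 * #|[set j in S | (`|x 0 j| < 1)%R]| < #|S|)%N].
Proof.
move=> v1 x01 b0 m0 S0 bS.
have eta0 : 0 < b / (6 * m%:R) by rewrite divr_gt0 // mulr_gt0 // ltr0n.
have [x fx xmin] := exists_min_potential S v b (8 / #|S|%:R) eta0 x01.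
exists x; split => //; last exact: (min_potential_few_free v1 x01 b0 m0 S0 bS fx xmin).
move=> i; rewrite -subr_ge0; apply: ltW; apply: lt_trans eta0 _.
apply: (eta_lt_slack b0 m0); apply: (potential_min_le b0 m0 S0 fx).
by apply: xmin => j; split.
Qed.

(** Partial colouring is iterated: each round spends [7 / 8] of [B] and leaves less than one
    coordinate in 256 free, with [B / 8] for the rest. The round fits exactly,
    [(7 / 8) ^ 16 * 2 ^ 64 = 14 ^ 16], and the rest is affordable because [8 ^ 16 <= 256 ^ 7]. *)
Lemma rounding (R : realType) (N m : nat) (v : 'I_m -> 'rV[R]_N) :
  (forall i j, `|v i 0 j| <= 1) -> (0 < m)%N ->
  forall (S : {set 'I_N}) (x0 : 'rV[R]_N) (B : R),
  (forall j, `|x0 0 j| <= 1) -> 0 < B ->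
  2 ^+ 64 * #|S|%:R ^+ 7 * m%:R <= B ^+ 16 ->
  exists x : 'rV[R]_N, [/\ forall j, j \in S -> x 0 j = 1 \/ x 0 j = -1,
    forall j, j \notin S -> x 0 j = x0 0 j &
    forall i, dotr (v i) (x - x0) <= B].
Proof.
move=> v1 m0 S; have [k] := ubnP #|S|.
elim: k S => // k IH S Sk x0 B x01 B0 BS.
have [/cards0_eq S0|S0] := posnP #|S|.
  exists x0; split => [j||i] //; first by rewrite S0 inE.
  by rewrite subrr /dotr big1 ?(ltW B0) // => j _; rewrite mxE mulr0.
have b0 : 0 < 7 / 8 * B by lra.
have [|x [fx xb xF]] := @partial_rounding R N m S v x0 (7 / 8 * B) v1 x01 b0 m0 S0.
  rewrite exprMn; apply: le_trans (ler_wpM2l _ BS); last by rewrite exprn_ge0 //; lra.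
  by rewrite !mulrA ler_wpM2r // ler_wpM2r ?exprn_ge0 //; lra.
set F := [set j in S | _] in xF.
have x1 j : `|x 0 j| <= 1 by case: (fx j).
have [|||z [z1 z2 z3]] := IH F _ x (B / 8) x1.
- by rewrite ltnS in Sk; lia.
- by rewrite divr_gt0.
- rewrite expr_div_n ler_pdivlMr ?exprn_gt0 //; apply: le_trans BS.
  rewrite mulrAC ler_wpM2r // -mulrA ler_pM2l ?exprn_gt0 //.
  have h : 256 * #|F|%:R <= #|S|%:R :> R by rewrite -natrM ler_nat ltnW.
  apply: le_trans (_ : (256 * #|F|%:R) ^+ 7 <= _).
    by rewrite exprMn mulrC ler_wpM2r ?exprn_ge0 //; lra.
  by rewrite lerXn2r ?nnegrE // mulr_ge0.
exists z; split.
- move=> j jS; have [|jF] := boolP (j \in F); first exact: z1.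
  rewrite z2 //; move: jF; rewrite inE jS /= -leNgt => xj.
  have /eqP : `|x 0 j| = 1 by apply/le_anti; rewrite x1 xj.
  by rewrite eqr_norml ler01 andbT => /orP[] /eqP; [left|right].
- move=> j jS; rewrite z2; first by case: (fx j) => _ ->.
  by rewrite inE (negbTE jS).
- move=> i; have -> : z - x0 = (z - x) + (x - x0) by rewrite addrA subrK.
  by rewrite dotrDr; have := z3 i; have := xb i; lra.
Qed.

(** * Sampling of trigonometric polynomials *)

Section Sampling.
Variables (C : numClosedFieldType) (N : nat) (w : C).
Hypothesis wprim : N.-primitive_root w.

Let N0 : (0 < N)%N. Proof. exact: prim_order_gt0 wprim. Qed.
Let w0 : w != 0. Proof. by rewrite (prim_root_eq0 wprim) -lt0n. Qed.

Lemma sum_prim_root (a b : nat) : (a < N)%N -> (b < N)%N ->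
  \sum_(j < N) (w ^+ j) ^+ a / (w ^+ j) ^+ b = N%:R *+ (a == b).
Proof.
move=> aN bN; pose q := w ^+ a / w ^+ b.
have qE (j : nat) : (w ^+ j) ^+ a / (w ^+ j) ^+ b = q ^+ j.
  by rewrite /q exprMn exprVn -!exprM ![(j * _)%N]mulnC.
under eq_bigr do rewrite qE.
have [ab|ab] := eqVneq a b.
  rewrite (eq_bigr (fun=> 1)) ?sumr_const ?card_ord // => j _.
  by rewrite /q ab divff ?expf_neq0 // expr1n.
have q1 : q != 1.
  rewrite -subr_eq0 -(mulfV (expf_neq0 b w0)) -mulrBl mulf_eq0 negb_or.
  rewrite invr_eq0 expf_neq0 // andbT subr_eq0 (eq_prim_root_expr wprim).
  by rewrite !modn_small.
apply: (mulfI (x := q - 1)); first by rewrite subr_eq0.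
rewrite mulr0 -subrX1 /q exprMn exprVn -!exprM ![(_ * N)%N]mulnC !exprM.
by rewrite (prim_expr_order wprim) !expr1n divr1 subrr.
Qed.

Variable z : C.
Hypothesis z1 : `|z| = 1.
Let z0 : z != 0. Proof. by rewrite -normr_eq0 z1 oner_eq0. Qed.

Let u (j : 'I_N) : C := w ^+ j / z.

Lemma norm_sample (j : 'I_N) : `|u j| = 1.
Proof.
rewrite /u normrM normfV z1 divr1; apply/eqP.
rewrite -(@pexpr_eq1 _ _ N) // -normrX -exprM mulnC exprM.
by rewrite (prim_expr_order wprim) expr1n normr1.
Qed.

Lemma sum_sample (a b : nat) : (a < N)%N -> (b < N)%N ->
  \sum_(j < N) u j ^+ a * (u j ^+ b)^* = N%:R *+ (a == b).
Proof.
move=> aN bN; rewrite (eq_bigr (fun j : 'I_N => z ^+ b / z ^+ a *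
    ((w ^+ j) ^+ a / (w ^+ j) ^+ b))) => [|j _].
  rewrite -mulr_sumr sum_prim_root //; case: eqP => [->|_]; last by rewrite mulr0.
  by rewrite divff ?expf_neq0 // mul1r.
have -> : (u j ^+ b)^* = (u j ^+ b)^-1.
  by rewrite invC_norm normrX norm_sample expr1n expr1n invr1 mul1r.
by rewrite /u !exprMn !exprVn; field; rewrite !expf_neq0.
Qed.

Definition dirichlet (n : nat) (x : C) : C := \sum_(l < n) x ^+ l.

Lemma sum_norm_dirichlet (n : nat) : (n <= N)%N ->
  \sum_(j < N) `|dirichlet n (u j)| ^+ 2 = (N * n)%:R.
Proof.
move=> nN; under eq_bigr do rewrite normCK /dirichlet rmorph_sum mulr_suml.
rewrite exchange_big /= (eq_bigr (fun=> N%:R)) => [|l _].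
  by rewrite sumr_const card_ord mulrnA.
under eq_bigr do rewrite mulr_sumr.
rewrite exchange_big (bigD1 l) //= [X in _ + X]big1 => [|k kl]; last first.
  rewrite /= sum_sample; [|exact: leq_trans (ltn_ord _) nN..].
  by rewrite eq_sym (inj_eq val_inj) (negbTE kl).
by rewrite /= sum_sample ?eqxx ?addr0 //; exact: leq_trans (ltn_ord _) nN.
Qed.

(** A kernel of de la Vallee Poussin type: each frequency [i + l] stays below [N], so it meets
    exactly one frequency of [dirichlet N], and the [n] choices of [l] give the factor [n]. *)
Lemma sample_reproducing (p : {poly C}) (n : nat) : (size p + n <= N.+1)%N ->
  \sum_(j < N) p.[w ^+ j] * (dirichlet n (u j) * (dirichlet N (u j))^*)
    = (N * n)%:R * p.[z].
Proof.
move=> pn.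
have pE (j : 'I_N) : p.[w ^+ j] = \sum_(i < size p) p`_i * z ^+ i * u j ^+ i.
  rewrite horner_coef; apply: eq_bigr => i _.
  by rewrite -mulrA -exprMn [z * _]mulrC divfK.
under eq_bigr do rewrite pE mulr_suml.
rewrite exchange_big horner_coef mulr_sumr; apply: eq_bigr => i _ /=.
rewrite (eq_bigr (fun j => \sum_(l < n) \sum_(k < N)
   p`_i * z ^+ i * (u j ^+ (i + l) * (u j ^+ k)^*))) => [|j _]; last first.
  rewrite /dirichlet rmorph_sum mulr_suml mulr_sumr; apply: eq_bigr => l _.
  rewrite !mulr_sumr; apply: eq_bigr => k _.
  by rewrite exprD /= !mulrA.
rewrite exchange_big (eq_bigr (fun=> p`_i * z ^+ i * N%:R)) => [|l _].
  by rewrite sumr_const card_ord natrM -mulr_natr; ring.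
have il : (i + l < N)%N by have := ltn_ord i; have := ltn_ord l; lia.
rewrite exchange_big (bigD1 (Ordinal il)) //= [X in _ + X]big1 => [|k kl].
  by rewrite -mulr_sumr sum_sample // eqxx addr0.
rewrite -mulr_sumr sum_sample // (_ : (_ == _) = false) ?mulr0 //.
by apply/negbTE; move: kl; rewrite -(inj_eq val_inj) eq_sym.
Qed.

(** By [2 a b <= a ^ 2 + b ^ 2], the total mass of the kernel is controlled by the two square sums
    [N * n] and [N * N]. *)
Lemma sampling (p : {poly C}) (n : nat) (B : C) : (size p + n <= N.+1)%N ->
  (forall j : 'I_N, `|p.[w ^+ j]| <= B) ->
  2 * n%:R * `|p.[z]| <= (n + N)%:R * B.
Proof.
move=> pn pB; have NR : 0 < N%:R :> C by rewrite ltr0n.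
have [p0|p0] := eqVneq p 0.
  rewrite p0 horner0 normr0 mulr0 mulr_ge0 //.
  by apply: le_trans (pB (Ordinal N0)).
have nN : (n <= N)%N by move: p0; rewrite -size_poly_gt0; lia.
have B0 : 0 <= B by apply: le_trans (pB (Ordinal N0)).
rewrite -(ler_pM2l NR).
have -> : N%:R * (2 * n%:R * `|p.[z]|) = 2 * `|(N * n)%:R * p.[z]|.
  by rewrite normrM natrM normrM !normr_nat; ring.
rewrite -sample_reproducing //.
apply: le_trans (_ : 2 * \sum_(j < N) B *
   (`|dirichlet n (u j)| * `|dirichlet N (u j)|) <= _).
  rewrite ler_pM2l //; apply: le_trans (ler_norm_sum _ _ _) _.
  apply: ler_sum => j _; rewrite !normrM norm_conjC ler_wpM2r ?pB //.
  by rewrite mulr_ge0.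
rewrite -mulr_sumr mulrCA [leRHS]mulrA [leRHS]mulrC ler_wpM2l //.
have -> : N%:R * (n + N)%:R = \sum_(j < N) `|dirichlet n (u j)| ^+ 2
    + \sum_(j < N) `|dirichlet N (u j)| ^+ 2.
  by rewrite !sum_norm_dirichlet // -natrD -mulnDr natrM.
rewrite -big_split mulr_sumr; apply: ler_sum => j _ /=.
rewrite -subr_ge0 (_ : _ - _ =
   (`|dirichlet n (u j)| - `|dirichlet N (u j)|) ^+ 2); last by ring.
by rewrite real_exprn_even_ge0 // rpredB ?normr_real.
Qed.

End Sampling.

(** * The unit circle and sampling of sine sums *)

Definition cis {R : realType} (x : R) : R[i] := (cos x +i* sin x)%C.

Section Cis.
Variable R : realType.
Implicit Types x y : R.

Lemma cis0 : cis 0 = 1 :> R[i].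
Proof. by rewrite /cis cos0 sin0. Qed.

Lemma cisD x y : cis (x + y) = cis x * cis y.
Proof.
rewrite /cis cosD sinD; apply/eqP; rewrite eq_complex /= eqxx /=.
by rewrite addrC mulrC [sin x * _]mulrC.
Qed.

Lemma cisX x k : cis (x *+ k) = cis x ^+ k.
Proof. by elim: k => [|k IH]; rewrite ?mulr0n ?cis0 // mulrS cisD IH exprS. Qed.

Lemma norm_cis x : `|cis x| = 1.
Proof. by rewrite normc_def /= cos2Dsin2 sqrtr1. Qed.

Lemma cisN x : cis (- x) = (cis x)^-1.
Proof.
apply: (mulrI (x := cis x)); first by rewrite unitfE -normr_eq0 norm_cis oner_eq0.
by rewrite -cisD subrr cis0 mulfV // -normr_eq0 norm_cis oner_eq0.
Qed.

Lemma norm_real_complex x : `|x%:C%C| = (`|x|)%:C%C.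
Proof. by rewrite normc_def /= expr0n addr0 sqrtr_sqr. Qed.

Lemma unit_circle_cis (z : R[i]) : `|z| = 1 -> exists2 x, `|x| <= pi & z = cis x.
Proof.
case: z => a b; rewrite normc_def => -[/= h].
have {h} ab : a ^+ 2 + b ^+ 2 = 1.
  rewrite -[LHS]sqr_sqrtr; first by rewrite h expr1n.
  by rewrite addr_ge0 ?sqr_ge0.
have a1 : -1 <= a <= 1.
  by rewrite -ler_norml -(@expr_le1 _ 2) // real_normK ?num_real //; nra.
have ca : cos (acos a) = a by rewrite acosK // in_itv.
have sa : sin (acos a) = `|b|.
  by rewrite sin_acos // -sqrtr_sqr; congr Num.sqrt; lra.
have api : `|acos a| <= pi by rewrite ger0_norm ?acos_ge0 ?acos_lepi.
have [b0|b0] := leP 0 b.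
  by exists (acos a); rewrite // /cis ca sa ger0_norm.
exists (- acos a); rewrite ?normrN // /cis cosN sinN ca sa ltr0_norm // opprK //.
Qed.

(** The order [m] of this point divides [N]. If it were smaller, [cos] would be 1 at twice
    [pi * m / N], so [sin] would vanish strictly between 0 and [pi]. *)
Lemma cis_prim_root (N : nat) : (0 < N)%N -> N.-primitive_root (cis (2 * pi / N%:R : R)).
Proof.
move=> N0; have NR : 0 < N%:R :> R by rewrite ltr0n.
have [|m mprim mN] := @prim_order_exists _ _ (cis (2 * pi / N%:R : R)) N0.
  rewrite -cisX -[_ *+ N]mulr_natr divfK ?gt_eqF // mulr_natl /cis cos2pi sin2pi.
  by [].
have [Nm|mnN] := eqVneq N m; first by rewrite [X in X.-primitive_root _]Nm.
have m0 := prim_order_gt0 mprim.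
have mltN : (m < N)%N by rewrite ltn_neqAle eq_sym mnN dvdn_leq.
have := prim_expr_order mprim; rewrite -cisX => -[].
set x := _ *+ m => cx _.
have x2 : x = (pi * (m%:R / N%:R)) *+ 2.
  by rewrite /x -[_ *+ m]mulr_natr -[RHS]mulr_natr; ring.
have : sin (pi * (m%:R / N%:R)) = 0 :> R.
  by move: cx; rewrite x2 cos_mulr2n cos2sin2 => h; apply/eqP; rewrite -sqrf_eq0; apply/eqP; lra.
have := @sin_gt0_pi R (pi * (m%:R / N%:R)); rewrite mulr_gt0 ?pi_gt0 ?divr_gt0 ?ltr0n //=.
rewrite -[X in _ < X]mulr1 ltr_pM2l ?pi_gt0 // ltr_pdivrMr // mul1r ltr_nat mltN.
by move=> /(_ isT) + h; rewrite h ltxx.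
Qed.

End Cis.

Definition sine_sum {R : realType} (d : nat) (e : nat -> R) (x : R) : R :=
  \sum_(k < d.+1) e k * sin (x *+ k).

Lemma sine_sumN (R : realType) d e (x : R) : sine_sum d e (- x) = - sine_sum d e x.
Proof.
by rewrite -sumrN; apply: eq_bigr => k _; rewrite mulNrn sinN mulrN.
Qed.

(** Multiplication by [cis (x *+ d)] moves the frequencies from [[-d, d]] to [[0, 2 d]] without
    changing the modulus. *)
Lemma sine_sum_poly (R : realType) d (e : nat -> R) : exists2 p : {poly R[i]},
  (size p <= d.*2.+1)%N & forall x, `|p.[cis x]| = (`|sine_sum d e x|)%:C%C.
Proof.
pose c : R[i] := (0 +i* (- (1 / 2)))%C.
pose p : {poly R[i]} := \sum_(k < d.+1) ((e k)%:C%C * c) *: ('X^(d + k) - 'X^(d - k)).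
exists p.
  apply: leq_trans (size_sum _ _ _) _; apply/bigmax_leqP => k _.
  apply: leq_trans (size_scale_leq _ _) _.
  apply: leq_trans (size_polyD _ _) _.
  by rewrite size_polyN !size_polyXn geq_max; have := ltn_ord k; lia.
move=> x; have -> : p.[cis x] = cis (x *+ d) * (sine_sum d e x)%:C%C.
  rewrite horner_sum rmorph_sum mulr_sumr; apply: eq_bigr => k _.
  rewrite hornerZ hornerD hornerN !hornerXn rmorphM /=.
  have kd : (k <= d)%N by rewrite -ltnS.
  have -> : cis x ^+ (d - k) = cis (x *+ d) * cis (- (x *+ k)).
    by rewrite -cisX -cisD mulrnBr.
  rewrite exprD -!cisX -mulrBr mulrCA -mulrA; congr (_ * (_ * _)).
  rewrite /c; apply/eqP; rewrite eq_complex /= cosN sinN.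
  by apply/andP; split; apply/eqP; field.
by rewrite normrM norm_cis mul1r norm_real_complex.
Qed.

(* The sample points are closed under x -> - x modulo the period, so for odd
   sums the upper bounds alone suffice. *)
Lemma sine_sampling (R : realType) (d n : nat) (e : nat -> R) (B : R) :
  (0 < d)%N ->
  (forall j, (j < d.*2 + n)%N ->
    sine_sum d e ((2 * pi / (d.*2 + n)%:R) *+ j) <= B) ->
  forall x, 2 * n%:R * `|sine_sum d e x| <= (n + (d.*2 + n))%:R * B.
Proof.
move=> d0; set N := (d.*2 + n)%N => eB x.
have N0 : (0 < N)%N by rewrite /N; lia.
set t := 2 * pi / N%:R in eB.
have eB' j : (j < N)%N -> `|sine_sum d e (t *+ j)| <= B.
  move=> jN; rewrite ler_norml eB // andbT lerNl -sine_sumN.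
  case: j jN => [_|j jN].
    by rewrite mulr0n oppr0 -[0](mulr0n t) eB.
  rewrite (_ : sine_sum d e _ = sine_sum d e (t *+ (N - j.+1))).
    by apply: eB; lia.
  apply: eq_bigr => k _; congr (_ * _).
  have -> : t *+ (N - j.+1) = - (t *+ j.+1) + pi *+ 2.
    rewrite mulrnBr ?(ltnW jN) // [LHS]addrC; congr (_ + _).
    by rewrite /t -[_ *+ N]mulr_natr divfK ?mulr_natl // pnatr_eq0 -lt0n.
  by rewrite mulrnDl (periodicn (@sinD2pi R)).
have [p psize pE] := sine_sum_poly d e.
have h1 : (size p + n <= N.+1)%N by rewrite /N; lia.
have h2 (j : 'I_N) : `|p.[cis t ^+ j]| <= B%:C%C.
  by rewrite -cisX pE lecR; apply: eB'.
have := sampling (cis_prim_root R N0) (norm_cis x) h1 h2.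
rewrite pE (_ : 2 * n%:R * _ = (2 * n%:R * `|sine_sum d e x|)%:C%C); last first.
  by rewrite !rmorphM !rmorph_nat.
by rewrite (_ : _ * B%:C%C = ((n + N)%:R * B)%:C%C) ?lecR // rmorphM rmorph_nat.
Qed.

(** * Rudin-Shapiro waves *)

Section Modulus.
Variable R : realType.
Implicit Types z w : R[i].

Lemma normc_cis (x : R) : normc (cis x) = 1.
Proof. by rewrite /= cos2Dsin2 sqrtr1. Qed.

Lemma normc_ge0 z : 0 <= normc z.
Proof. by case: z => a b; exact: sqrtr_ge0. Qed.

Lemma sqr_normc z : normc z ^+ 2 = complex.Re z ^+ 2 + complex.Im z ^+ 2.
Proof. by case: z => a b /=; rewrite sqr_sqrtr // addr_ge0 ?sqr_ge0. Qed.

Lemma Re_le_normc z : `|complex.Re z| <= normc z.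
Proof.
rewrite -(@ler_pXn2r _ 2) ?nnegrE ?normc_ge0 // sqr_normc real_normK ?num_real //.
by rewrite lerDl sqr_ge0.
Qed.

Lemma Im_le_normc z : `|complex.Im z| <= normc z.
Proof.
rewrite -(@ler_pXn2r _ 2) ?nnegrE ?normc_ge0 // sqr_normc real_normK ?num_real //.
by rewrite lerDr sqr_ge0.
Qed.

Lemma normc_natz (n : nat) z : normc (n%:R * z) = n%:R * normc z.
Proof. by rewrite mulr_natl normcMn mulr_natl. Qed.

Lemma parallelogram z w :
  normc (z + w) ^+ 2 + normc (z - w) ^+ 2 = 2 * (normc z ^+ 2 + normc w ^+ 2).
Proof. by case: z w => [a b] [c d]; rewrite !sqr_normc /=; ring. Qed.

End Modulus.

(* rs t true and rs t false are the coefficients of the two Rudin-Shapiro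
   polynomials of degree 2 ^ t - 1. *)
Fixpoint rs (t : nat) (b : bool) (j : nat) : int :=
  if t is t'.+1 then
    if (j < 2 ^ t')%N then rs t' true j
    else (if b then 1 else -1) * rs t' false (j - 2 ^ t')
  else 1.

Lemma rs_sign t b j : rs t b j = 1 \/ rs t b j = -1.
Proof.
elim: t b j => [|t IH] b j /=; first by left.
case: ifP => _; first exact: IH.
by case: b; case: (IH false (j - 2 ^ t)%N) => ->; rewrite ?mulN1r ?mul1r ?opprK; auto.
Qed.

Section Moments.
Variable R : realType.

Definition rs_moment (b : bool) (k t : nat) (x : R) : R[i] :=
  \sum_(0 <= j < 2 ^ t) (rs t b j)%:~R * j%:R ^+ k * cis (x *+ j).

Lemma rs_moment0 b k x : rs_moment b k 0 x = 0 ^+ k.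
Proof. by rewrite /rs_moment expn0 big_nat1 mulr0n cis0 mulr1 mul1r. Qed.

Lemma rs_momentS b k t x : rs_moment b k t.+1 x = rs_moment true k t x +
  (if b then 1 else -1) * cis (x *+ 2 ^ t) *
  \sum_(0 <= j < 2 ^ t) (rs t false j)%:~R * (j%:R + (2 ^ t)%:R) ^+ k * cis (x *+ j).
Proof.
rewrite /rs_moment expnS mul2n -addnn (@big_cat_nat _ _ _ (2 ^ t)) ?leq_addr //=.
congr (_ + _).
  by rewrite !big_mkord; apply: eq_bigr => j _; rewrite ltn_ord.
rewrite -{1}[(2 ^ t)%N]add0n big_addn addnK mulr_sumr !big_mkord.
apply: eq_bigr => j _; rewrite ltnNge leq_addl /= addnK natrD mulrnDr cisD.
by case: b => /=; rewrite !rmorphM ?rmorphN1 ?rmorph1; ring.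
Qed.

Lemma rs_moment0S b t x : rs_moment b 0 t.+1 x =
  rs_moment true 0 t x + (if b then 1 else -1) * cis (x *+ 2 ^ t) * rs_moment false 0 t x.
Proof. by rewrite rs_momentS; congr (_ + _ * _); apply: eq_bigr => j _; rewrite !expr0. Qed.

Lemma rs_parallelogram t x :
  normc (rs_moment true 0 t x) ^+ 2 + normc (rs_moment false 0 t x) ^+ 2 = 2 ^+ t.+1.
Proof.
elim: t => [|t IH]; first by rewrite !rs_moment0 expr0 normc1 !expr1n.
rewrite !rs_moment0S mul1r mulN1r mulNr parallelogram normcM normc_cis mul1r IH.
by rewrite [RHS]exprS.
Qed.

Definition rho (t : nat) : R := Num.sqrt (2 ^+ t.+1).

Lemma rho_gt0 t : 0 < rho t.
Proof. by rewrite sqrtr_gt0 exprn_gt0. Qed.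

Lemma sqr_rho t : rho t ^+ 2 = 2 ^+ t.+1.
Proof. by rewrite sqr_sqrtr // exprn_ge0. Qed.

Lemma rhoS t : 14 / 10 * rho t <= rho t.+1.
Proof.
have r0 := rho_gt0 t; have r1 := rho_gt0 t.+1.
rewrite -(@ler_pXn2r _ 2) ?nnegrE ?(ltW r1) //; last lra.
rewrite exprMn !sqr_rho [2 ^+ t.+2]exprS ler_wpM2r ?exprn_ge0 //; lra.
Qed.

Lemma normc_rs_moment0 b t x : normc (rs_moment b 0 t x) <= rho t.
Proof.
rewrite -(@ler_pXn2r _ 2) ?nnegrE ?normc_ge0 ?(ltW (rho_gt0 t)) // sqr_rho.
by rewrite -(rs_parallelogram t x); case: b; rewrite ?lerDl ?lerDr sqr_ge0.
Qed.

Let normc_sign (b : bool) z : normc ((if b then 1 else -1) * z) = normc z :> R.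
Proof. by case: b; rewrite ?mul1r // mulN1r normcN. Qed.

(** Induction on [t], expanding [(j + T) ^ k] on the second half of the coefficients. The constant
    [5 / 4] is the fixed point for [k = 1]: doubling [T] and the factor of [rhoS] give [2 * (5 / 4)
    + 1 = (5 / 4) * 2 * (14 / 10)]. The orders 2 and 3 have room to spare. *)
Lemma normc_rs_moment b t x :
  [/\ normc (rs_moment b 1 t x) <= 5 / 4 * 2 ^+ t * rho t,
      normc (rs_moment b 2 t x) <= 5 / 4 * (2 ^+ t) ^+ 2 * rho t &
      normc (rs_moment b 3 t x) <= 5 / 4 * (2 ^+ t) ^+ 3 * rho t].
Proof.
elim: t b => [|t IH] b.
  rewrite !rs_moment0 !expr0n -[(_ == _)%:R]/(0 : R[i]) normc0.
  by have := rho_gt0 0 => ?; split; rewrite ?expr0 ?expr1n; lra.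
have [p1 p2 p3] := IH true; have [q1 q2 q3] := IH false.
have q0 := normc_rs_moment0 false t x.
have rS := rhoS t; have r0 := rho_gt0 t.
have T0 : 0 < (2 ^ t)%:R :> R by rewrite ltr0n expn_gt0.
rewrite !rs_momentS; set T := (2 ^ t)%N in T0 *.
have TE : 2 ^+ t = T%:R :> R by rewrite natrX.
have -> : 2 ^+ t.+1 = 2 * T%:R :> R by rewrite exprS TE.
rewrite TE in p1 p2 p3 q1 q2 q3.
have e1 : \sum_(0 <= j < T) (rs t false j)%:~R * (j%:R + T%:R) ^+ 1 * cis (x *+ j)
    = rs_moment false 1 t x + T%:R * rs_moment false 0 t x.
  by rewrite /rs_moment !mulr_sumr -!big_split /=; apply: eq_bigr => j _; ring.
have e2 : \sum_(0 <= j < T) (rs t false j)%:~R * (j%:R + T%:R) ^+ 2 * cis (x *+ j)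
    = rs_moment false 2 t x + T%:R * (2%:R * rs_moment false 1 t x)
      + T%:R * (T%:R * rs_moment false 0 t x).
  by rewrite /rs_moment !mulr_sumr -!big_split /=; apply: eq_bigr => j _; ring.
have e3 : \sum_(0 <= j < T) (rs t false j)%:~R * (j%:R + T%:R) ^+ 3 * cis (x *+ j)
    = rs_moment false 3 t x + T%:R * (3%:R * rs_moment false 2 t x)
      + T%:R * (T%:R * (3%:R * rs_moment false 1 t x))
      + T%:R * (T%:R * (T%:R * rs_moment false 0 t x)).
  by rewrite /rs_moment !mulr_sumr -!big_split /=; apply: eq_bigr => j _; ring.
rewrite e1 e2 e3 {e1 e2 e3}; split; apply: le_trans (le_normcD _ _) _;
  rewrite -mulrA normc_sign normcM normc_cis mul1r.
- apply: le_trans (lerD p1 (le_normcD _ _)) _; rewrite !normc_natz.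
  have h0 := ler_wpM2l (ltW T0) q0; have h1 := ler_wpM2l (ltW T0) rS.
  lra.
- apply: le_trans (lerD p2 (le_trans (le_normcD _ _) (lerD (le_normcD _ _) (lexx _)))) _.
  rewrite !normc_natz.
  have h0 := ler_wpM2l (ltW T0) (ler_wpM2l (ltW T0) q0).
  have h1 := ler_wpM2l (ltW T0) q1.
  have hS := ler_wpM2l (ltW T0) (ler_wpM2l (ltW T0) rS).
  have := mulr_gt0 T0 (mulr_gt0 T0 r0).
  lra.
- apply: le_trans (lerD p3 (le_trans (le_normcD _ _) (lerD
    (le_trans (le_normcD _ _) (lerD (le_normcD _ _) (lexx _))) (lexx _)))) _.
  rewrite !normc_natz.
  have h0 := ler_wpM2l (ltW T0) (ler_wpM2l (ltW T0) (ler_wpM2l (ltW T0) q0)).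
  have h1 := ler_wpM2l (ltW T0) (ler_wpM2l (ltW T0) q1).
  have h2 := ler_wpM2l (ltW T0) q2.
  have hS := ler_wpM2l (ltW T0) (ler_wpM2l (ltW T0) (ler_wpM2l (ltW T0) rS)).
  have := mulr_gt0 T0 (mulr_gt0 T0 (mulr_gt0 T0 r0)).
  lra.
Qed.

End Moments.

Section TrigSums.
Variable R : realType.

Lemma is_derive_mulrn (k : nat) (x : R) :
  is_derive x (1 : R) (fun y : R => y *+ k) (k%:R : R).
Proof.
have -> : (fun y : R => y *+ k) = (k%:R \*: id).
  by apply/funext => y; rewrite -[LHS]mulr_natl.
by apply: is_derive_eq; exact: mulr1.
Qed.

Lemma is_derive_cos_mulrn (a : R) (k : nat) (x : R) :
  is_derive x (1 : R) (fun y => a * cos (y *+ k)) (- (a * k%:R * sin (x *+ k))).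
Proof.
have h := is_derive1_comp (is_derive_cos _) (is_derive_mulrn k x).
apply: (@is_derive_eq _ _ _ _ _ _ _ _ (is_deriveZ a h)).
by rewrite /GRing.scale /=; ring.
Qed.

Lemma is_derive_sin_mulrn (a : R) (k : nat) (x : R) :
  is_derive x (1 : R) (fun y => a * sin (y *+ k)) (a * k%:R * cos (x *+ k)).
Proof.
have h := is_derive1_comp (is_derive_sin _) (is_derive_mulrn k x).
apply: (@is_derive_eq _ _ _ _ _ _ _ _ (is_deriveZ a h)).
by rewrite /GRing.scale /=; ring.
Qed.

Lemma is_derive_nat_sum n (F dF : nat -> R -> R) (x : R) :
  (forall j, is_derive x (1 : R) (F j) (dF j x)) ->
  is_derive x (1 : R) (fun y => \sum_(0 <= j < n) F j y) (\sum_(0 <= j < n) dF j x).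
Proof.
move=> h; elim: n => [|n IH].
  rewrite big_geq // (_ : (fun _ => _) = cst 0); first exact: is_derive_cst.
  by apply/funext => y; rewrite big_geq.
rewrite big_nat_recr //= (_ : (fun _ => _) = (fun y => \sum_(0 <= j < n) F j y) + F n).
  exact: is_deriveD.
by apply/funext => y; rewrite big_nat_recr.
Qed.

Lemma Re_sum (n : nat) (F : nat -> R[i]) :
  complex.Re (\sum_(0 <= j < n) F j) = \sum_(0 <= j < n) complex.Re (F j).
Proof. by apply: (big_morph (@complex.Re R)) => // -[a b] [c d]. Qed.

Lemma Im_sum (n : nat) (F : nat -> R[i]) :
  complex.Im (\sum_(0 <= j < n) F j) = \sum_(0 <= j < n) complex.Im (F j).
Proof. by apply: (big_morph (@complex.Im R)) => // -[a b] [c d]. Qed.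

End TrigSums.

Section Waves.
Variables (R : realType) (t : nat).

(* The r-th derivative of z ^ c * (Rudin-Shapiro polynomial) along z = cis u,
   up to a power of 'i. *)
Definition wave (b : bool) (c r : nat) (u : R) : R[i] :=
  \sum_(0 <= j < 2 ^ t) (rs t b j)%:~R * (c + j)%:R ^+ r * cis (u *+ (c + j)).

Lemma ReIm_wave b c r u :
  complex.Re (wave b c r u) =
    \sum_(0 <= j < 2 ^ t) (rs t b j)%:~R * (c + j)%:R ^+ r * cos (u *+ (c + j)) /\
  complex.Im (wave b c r u) =
    \sum_(0 <= j < 2 ^ t) (rs t b j)%:~R * (c + j)%:R ^+ r * sin (u *+ (c + j)).
Proof.
rewrite Re_sum Im_sum; split; apply: eq_bigr => j _;
  rewrite (_ : _%:~R * _ ^+ r = ((rs t b j)%:~R * (c + j)%:R ^+ r)%:C%C);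
  by [rewrite rmorphM rmorphXn rmorph_int rmorph_nat | rewrite /= mul0r ?subr0 ?addr0].
Qed.

Lemma is_derive_Re_wave b c r u :
  is_derive u (1 : R) (fun x => complex.Re (wave b c r x)) (- complex.Im (wave b c r.+1 u)).
Proof.
rewrite (ReIm_wave b c r.+1 u).2 -sumrN.
rewrite (_ : (fun _ => _) = fun x => \sum_(0 <= j < 2 ^ t)
  (rs t b j)%:~R * (c + j)%:R ^+ r * cos (x *+ (c + j))).
  apply: (@is_derive_nat_sum R (2 ^ t) (fun j x =>
    (rs t b j)%:~R * (c + j)%:R ^+ r * cos (x *+ (c + j)))
    (fun j x => - ((rs t b j)%:~R * (c + j)%:R ^+ r.+1 * sin (x *+ (c + j)))) u) => j.
  by rewrite exprSr mulrA; exact: is_derive_cos_mulrn.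
by apply/funext => x; rewrite (ReIm_wave _ _ _ _).1.
Qed.

Lemma is_derive_Im_wave b c r u :
  is_derive u (1 : R) (fun x => complex.Im (wave b c r x)) (complex.Re (wave b c r.+1 u)).
Proof.
rewrite (ReIm_wave b c r.+1 u).1.
rewrite (_ : (fun _ => _) = fun x => \sum_(0 <= j < 2 ^ t)
  (rs t b j)%:~R * (c + j)%:R ^+ r * sin (x *+ (c + j))).
  apply: (@is_derive_nat_sum R (2 ^ t) (fun j x =>
    (rs t b j)%:~R * (c + j)%:R ^+ r * sin (x *+ (c + j)))
    (fun j x => ((rs t b j)%:~R * (c + j)%:R ^+ r.+1 * cos (x *+ (c + j)))) u) => j.
  by rewrite exprSr mulrA; exact: is_derive_sin_mulrn.
by apply/funext => x; rewrite (ReIm_wave _ _ _ _).2.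
Qed.

Lemma wave0E b c u : wave b c 0 u = cis (u *+ c) * rs_moment b 0 t u.
Proof.
rewrite mulr_sumr; apply: eq_bigr => j _.
by rewrite !expr0 mulrnDr cisD; ring.
Qed.

Lemma normc_wave0_sum c c' u :
  normc (wave true c 0 u) ^+ 2 + normc (wave false c' 0 u) ^+ 2 = rho R t ^+ 2.
Proof. by rewrite !wave0E !normcM !normc_cis !mul1r rs_parallelogram sqr_rho. Qed.

Lemma wave_moments b c u :
  [/\ wave b c 1 u - c%:R * wave b c 0 u = cis (u *+ c) * rs_moment b 1 t u,
  wave b c 2 u - c%:R ^+ 2 * wave b c 0 u = cis (u *+ c) *
    ((2 * c)%:R * rs_moment b 1 t u + rs_moment b 2 t u) &
  wave b c 3 u - c%:R ^+ 3 * wave b c 0 u = cis (u *+ c) *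
    ((3 * c ^ 2)%:R * rs_moment b 1 t u + (3 * c)%:R * rs_moment b 2 t u
      + rs_moment b 3 t u)].
Proof.
by split; rewrite !mulr_sumr -?big_split ?mulr_sumr -sumrB; apply: eq_bigr => j _ /=;
  rewrite !natrD ?natrM ?natrX mulrnDr cisD; ring.
Qed.

(** The frequencies lie in [[c, c + 2 ^ t)] with [2 ^ t <= c / 128], so a derivative acts nearly as
    multiplication by [c]; each order costs about [(5 / 4) / 128], which is below [1 / 100]. *)
Lemma wave_approx b c u : (2 ^ t * 128 <= c)%N ->
  [/\ normc (wave b c 1 u - c%:R * wave b c 0 u) <= c%:R / 100 * rho R t,
  normc (wave b c 2 u - c%:R ^+ 2 * wave b c 0 u) <= c%:R ^+ 2 / 50 * rho R t &
  normc (wave b c 3 u - c%:R ^+ 3 * wave b c 0 u) <= c%:R ^+ 3 * (3 / 100) * rho R t].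
Proof.
move=> cT; have [e1 e2 e3] := wave_moments b c u.
have [m1 m2 m3] := normc_rs_moment b t u.
have r0 := rho_gt0 R t.
have T0 : 0 < 2 ^+ t :> R by rewrite exprn_gt0.
have cT' : 2 ^+ t * 128 <= c%:R :> R by rewrite -natrX -natrM ler_nat.
rewrite e1 e2 e3 !normcM normc_cis !mul1r.
set T : R := 2 ^+ t in T0 cT' m1 m2 m3; set C : R := c%:R in cT'.
set r := rho R t in r0 m1 m2 m3 *.
have C0 : 0 < C by lra.
have TC : T * r <= C * r / 128 by have := ler_wpM2r (ltW r0) cT'; lra.
have TTC : T * (T * r) <= C * (C * r) / 128 / 128.
  have h := ler_wpM2l (ltW T0) TC.
  have h' := ler_wpM2l (ltW C0) TC; lra.
have TTTC : T * (T * (T * r)) <= C * (C * (C * r)) / 128 / 128 / 128.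
  have h := ler_wpM2l (ltW T0) TTC.
  have h' := ler_wpM2l (ltW C0) (ler_wpM2l (ltW C0) TC); lra.
have CC0 : 0 < C * (C * r) by rewrite !mulr_gt0.
have CCC0 : 0 < C * (C * (C * r)) by rewrite !mulr_gt0.
have Cr0 : 0 < C * r by rewrite mulr_gt0.
split.
- lra.
- apply: le_trans (le_normcD _ _) _; rewrite normc_natz natrM -/C.
  have h1 := ler_wpM2l (ltW C0) m1.
  have h2 := ler_wpM2l (ltW C0) TC.
  lra.
- apply: le_trans (le_normcD _ _) _.
  apply: le_trans (lerD (le_normcD _ _) (lexx _)) _.
  rewrite !normc_natz !natrM -/C.
  have h1 := ler_wpM2l (ltW C0) (ler_wpM2l (ltW C0) m1).
  have h1' := ler_wpM2l (ltW C0) (ler_wpM2l (ltW C0) TC).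
  have h2 := ler_wpM2l (ltW C0) m2.
  have h2' := ler_wpM2l (ltW C0) TTC.
  lra.
Qed.

End Waves.

(** * Newton interpolation, Rolle's theorem and small jets *)

Lemma divided_difference_le (R : realFieldType) (a b s K L : R) :
  `|a| <= K -> `|b| <= K -> 0 < L -> L <= s -> `|(b - a) / s| <= 2 * K / L.
Proof.
move=> aK bK L0 Ls; have s0 : 0 < s by lra.
rewrite normrM normfV (gtr0_norm s0) ler_pdivrMr //.
have K0 : 0 <= K by apply: le_trans aK.
have h : `|b - a| <= 2 * K by apply: le_trans (ler_normB _ _) _; lra.
apply: le_trans h _; rewrite mulrAC ler_pdivlMr // ler_wpM2l //; lra.
Qed.

(** Divided differences: the successive denominators are at least [h], [2 * h] and [3 * h], which
    gives the three bounds on the Newton coefficients. *)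
Lemma newton_cubic (R : realFieldType) (y1 y2 y3 y4 u1 u2 u3 u4 h k : R) :
  0 < h -> u1 + h <= u2 -> u2 + h <= u3 -> u3 + h <= u4 ->
  `|y1| <= k * h ^+ 3 -> `|y2| <= k * h ^+ 3 ->
  `|y3| <= k * h ^+ 3 -> `|y4| <= k * h ^+ 3 ->
  exists d1 d2 d3, [/\ `|d1| <= 2 * k * h ^+ 2, `|d2| <= 2 * k * h, `|d3| <= 4 / 3 * k &
  [/\ y2 = y1 + d1 * (u2 - u1), y3 = y1 + d1 * (u3 - u1) + d2 * (u3 - u1) * (u3 - u2) &
    y4 = y1 + d1 * (u4 - u1) + d2 * (u4 - u1) * (u4 - u2)
         + d3 * (u4 - u1) * (u4 - u2) * (u4 - u3)]].
Proof.
move=> h0 h12 h23 h34 b1 b2 b3 b4.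
have hn0 : h != 0 by rewrite gt_eqF.
have e1 : `|(y2 - y1) / (u2 - u1)| <= 2 * k * h ^+ 2.
  have := divided_difference_le b1 b2 h0 (_ : h <= u2 - u1) => /(_ ltac:(lra)).
  by move/le_trans; apply; rewrite le_eqVlt; apply/orP; left; apply/eqP; field.
have e2 : `|(y3 - y2) / (u3 - u2)| <= 2 * k * h ^+ 2.
  have := divided_difference_le b2 b3 h0 (_ : h <= u3 - u2) => /(_ ltac:(lra)).
  by move/le_trans; apply; rewrite le_eqVlt; apply/orP; left; apply/eqP; field.
have e3 : `|(y4 - y3) / (u4 - u3)| <= 2 * k * h ^+ 2.
  have := divided_difference_le b3 b4 h0 (_ : h <= u4 - u3) => /(_ ltac:(lra)).
  by move/le_trans; apply; rewrite le_eqVlt; apply/orP; left; apply/eqP; field.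
set d1 := (y2 - y1) / _ in e1; set d2 := (y3 - y2) / _ in e2.
set d3 := (y4 - y3) / _ in e3.
have h2 : 0 < 2 * h by lra.
have e4 : `|(d2 - d1) / (u3 - u1)| <= 2 * k * h.
  have := divided_difference_le e1 e2 h2 (_ : 2 * h <= u3 - u1) => /(_ ltac:(lra)).
  by move/le_trans; apply; rewrite le_eqVlt; apply/orP; left; apply/eqP; field.
have e5 : `|(d3 - d2) / (u4 - u2)| <= 2 * k * h.
  have := divided_difference_le e2 e3 h2 (_ : 2 * h <= u4 - u2) => /(_ ltac:(lra)).
  by move/le_trans; apply; rewrite le_eqVlt; apply/orP; left; apply/eqP; field.
set d4 := (d2 - d1) / _ in e4; set d5 := (d3 - d2) / _ in e5.
have h3 : 0 < 3 * h by lra.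
have e6 : `|(d5 - d4) / (u4 - u1)| <= 4 / 3 * k.
  have := divided_difference_le e4 e5 h3 (_ : 3 * h <= u4 - u1) => /(_ ltac:(lra)).
  by move/le_trans; apply; rewrite le_eqVlt; apply/orP; left; apply/eqP; field.
exists d1, d4, ((d5 - d4) / (u4 - u1)); split => //.
have [? [? ?]] : u2 - u1 != 0 /\ u3 - u2 != 0 /\ u4 - u3 != 0.
  by rewrite !gt_eqF //; clear -h0 h12 h23 h34; lra.
have [? [? ?]] : u3 - u1 != 0 /\ u4 - u2 != 0 /\ u4 - u1 != 0.
  by rewrite !gt_eqF //; clear -h0 h12 h23 h34; lra.
split; rewrite /d5 /d4 /d3 /d2 /d1; field => //.
- by apply/and3P.
- by do ?[apply/andP; split].
Qed.

Lemma rolle_zero (R : realType) (f df : R -> R) (a b : R) :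
  (forall x, is_derive x (1 : R) f (df x)) -> a < b -> f a = 0 -> f b = 0 ->
  exists2 c, a < c < b & df c = 0.
Proof.
move=> fdf ab fa fb.
have [|c] := @MVT R f df a b ab (fun x _ => fdf x).
  apply: continuous_subspaceT => x; apply: differentiable_continuous.
  by apply/derivable1_diffP; case: (fdf x).
rewrite fa fb subrr => cab /esym/eqP; rewrite mulf_eq0 subr_eq0 (gt_eqF ab) orbF.
by move=> /eqP ?; exists c => //; move: cab; rewrite in_itv.
Qed.

Lemma newton_derivative_le (R : realFieldType) (a1 a2 a3 d1 d2 d3 h k w : R) :
  0 <= k -> 0 <= h <= w -> `|a1| <= w -> `|a2| <= w -> `|a3| <= w ->
  `|d1| <= 2 * k * h ^+ 2 -> `|d2| <= 2 * k * h -> `|d3| <= 4 / 3 * k ->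
  `|d1 + d2 * (a1 + a2) + d3 * (a1 * a2 + a1 * a3 + a2 * a3)| <= 10 * k * w ^+ 2.
Proof.
move=> k0 /andP[h0 hw] s1 s2 s3 e1 e2 e3.
apply: le_trans (ler_normD _ _) _.
apply: le_trans (lerD (ler_normD _ _) (lexx _)) _; rewrite !normrM.
have t1 : `|a1 + a2| <= 2 * w by apply: le_trans (ler_normD _ _) _; lra.
have t2 : `|a1 * a2 + a1 * a3 + a2 * a3| <= 3 * w ^+ 2.
  apply: le_trans (ler_normD _ _) _.
  apply: le_trans (lerD (ler_normD _ _) (lexx _)) _; rewrite !normrM.
  have b1 := ler_pM (normr_ge0 _) (normr_ge0 _) s1 s2.
  have b2 := ler_pM (normr_ge0 _) (normr_ge0 _) s1 s3.
  have b3 := ler_pM (normr_ge0 _) (normr_ge0 _) s2 s3.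
  lra.
have b2 := ler_pM (normr_ge0 _) (normr_ge0 _) e2 t1.
have b3 := ler_pM (normr_ge0 _) (normr_ge0 _) e3 t2.
have b5 : k * h ^+ 2 <= k * w ^+ 2 by rewrite ler_wpM2l // lerXn2r ?nnegrE //; lra.
have b6 : k * (h * w) <= k * w ^+ 2.
  by rewrite ler_wpM2l // expr2 ler_wpM2r //; lra.
lra.
Qed.

Lemma newton_second_derivative_le (R : realFieldType) (a1 a2 a3 d2 d3 h k w : R) :
  0 <= k -> h <= w -> `|a1| <= w -> `|a2| <= w -> `|a3| <= w ->
  `|d2| <= 2 * k * h -> `|d3| <= 4 / 3 * k ->
  `|2 * d2 + 2 * d3 * (a1 + a2 + a3)| <= 12 * k * w.
Proof.
move=> k0 hw s1 s2 s3 e2 e3.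
apply: le_trans (ler_normD _ _) _; rewrite !normrM (gtr0_norm (_ : 0 < 2)) //.
have t1 : `|a1 + a2 + a3| <= 3 * w.
  apply: le_trans (ler_normD _ _) _.
  apply: le_trans (lerD (ler_normD _ _) (lexx _)) _; lra.
have b3 := ler_pM (normr_ge0 _) (normr_ge0 _) e3 t1.
have b6 : k * h <= k * w by rewrite ler_wpM2l.
lra.
Qed.

(** The difference of [f0] and its interpolating cubic vanishes at four points, so by Rolle each of
    its first three derivatives vanishes somewhere between them. There the derivatives of [f0] are
    those of the cubic, which the Newton coefficients bound. *)
Lemma cubic_rolle (R : realType) (f0 f1 f2 f3 : R -> R) (u1 u2 u3 u4 h k w : R) :
  (forall x, is_derive x (1 : R) f0 (f1 x)) ->
  (forall x, is_derive x (1 : R) f1 (f2 x)) ->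
  (forall x, is_derive x (1 : R) f2 (f3 x)) ->
  0 < h -> u1 + h <= u2 -> u2 + h <= u3 -> u3 + h <= u4 -> u4 - u1 <= w ->
  `|f0 u1| <= k * h ^+ 3 -> `|f0 u2| <= k * h ^+ 3 ->
  `|f0 u3| <= k * h ^+ 3 -> `|f0 u4| <= k * h ^+ 3 ->
  exists x1 x2 x3, [/\ u1 <= x1 <= u4, u1 <= x2 <= u4, u1 <= x3 <= u4 &
   [/\ `|f1 x1| <= 10 * k * w ^+ 2, `|f2 x2| <= 12 * k * w & `|f3 x3| <= 8 * k]].
Proof.
move=> df0 df1 df2 h0 h12 h23 h34 uw b1 b2 b3 b4.
have [d1 [d2 [d3 [e1 e2 e3 [q2 q3 q4]]]]] := newton_cubic h0 h12 h23 h34 b1 b2 b3 b4.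
pose p : {poly R} := (f0 u1)%:P + d1 *: ('X - u1%:P) + d2 *: (('X - u1%:P) * ('X - u2%:P))
  + d3 *: (('X - u1%:P) * ('X - u2%:P) * ('X - u3%:P)).
have h1 x : (1 : {poly R}).[x] = 1 by rewrite -polyC1 hornerC.
have hE := (@hornerD R, @hornerN R, @hornerZ R, @hornerM R, hornerX, hornerC, h1).
have pE x : p.[x] = f0 u1 + d1 * (x - u1) + d2 * ((x - u1) * (x - u2))
    + d3 * ((x - u1) * (x - u2) * (x - u3)).
  by rewrite /p !hE; ring.
have p1E x : p^`().[x] = d1 + d2 * ((x - u1) + (x - u2))
    + d3 * ((x - u1) * (x - u2) + (x - u1) * (x - u3) + (x - u2) * (x - u3)).
  by rewrite /p !poly.derivE !hE; ring.
have p2E x : p^`()^`().[x] = 2 * d2 + 2 * d3 * ((x - u1) + (x - u2) + (x - u3)).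
  by rewrite /p !poly.derivE !hE; ring.
have p3E x : p^`()^`()^`().[x] = 6 * d3.
  by rewrite /p !poly.derivE !hE; ring.
have dg0 x : is_derive x (1 : R) (f0 - horner p) (f1 x - p^`().[x]).
  exact: is_deriveB.
have dg1 x : is_derive x (1 : R) (f1 - horner p^`()) (f2 x - p^`()^`().[x]).
  exact: is_deriveB.
have dg2 x : is_derive x (1 : R) (f2 - horner p^`()^`()) (f3 x - p^`()^`()^`().[x]).
  exact: is_deriveB.
have g1 : (f0 - horner p) u1 = 0 by rewrite /= !fctE pE; ring.
have g2 : (f0 - horner p) u2 = 0 by rewrite /= !fctE pE q2; ring.
have g3 : (f0 - horner p) u3 = 0 by rewrite /= !fctE pE q3; ring.
have g4 : (f0 - horner p) u4 = 0 by rewrite /= !fctE pE q4; ring.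
have [u12 u23 u34] : [/\ u1 < u2, u2 < u3 & u3 < u4].
  by clear -h0 h12 h23 h34; split; lra.
have [v1 /andP[v11 v12] v1z] := rolle_zero dg0 u12 g1 g2.
have [v2 /andP[v21 v22] v2z] := rolle_zero dg0 u23 g2 g3.
have [v3 /andP[v31 v32] v3z] := rolle_zero dg0 u34 g3 g4.
have [y1 /andP[y11 y12] y1z] := rolle_zero dg1 (lt_trans v12 v21) v1z v2z.
have [y2 /andP[y21 y22] y2z] := rolle_zero dg1 (lt_trans v22 v31) v2z v3z.
have [x3 /andP[x31 x32] x3z] := rolle_zero dg2 (lt_trans y12 y21) y1z y2z.
have k0 : 0 <= k.
  have := le_trans (normr_ge0 _) b1; rewrite pmulr_lge0 // exprn_gt0 //.
have hw : h <= w.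
  by clear -h0 h12 u12 u23 u34 uw; lra.
have dist x y : u1 <= x <= u4 -> u1 <= y <= u4 -> `|x - y| <= w.
  by clear -uw => hx hy; rewrite ler_norml; lra.
have [u2i u3i] : u1 <= u2 <= u4 /\ u1 <= u3 <= u4.
  by clear -u12 u23 u34; split; lra.
have u1i : u1 <= u1 <= u4 by clear -u2i; lra.
have v1i : u1 <= v1 <= u4 by clear -v11 v12 u2i; lra.
have y1i : u1 <= y1 <= u4 by clear -v11 y11 y12 v22 u3i; lra.
have x3i : u1 <= x3 <= u4 by clear -x31 x32 y1i y22 v32; lra.
exists v1, y1, x3; split=> //; split.
- rewrite (subr0_eq v1z) p1E; apply: newton_derivative_le e1 e2 e3 => //;
    by [rewrite (ltW h0)|exact: dist].
- rewrite (subr0_eq y1z) p2E.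
  by apply: newton_second_derivative_le e2 e3 => //; exact: dist.
- rewrite (subr0_eq x3z) p3E normrM gtr0_norm //.
  by clear -e3; lra.
Qed.

Lemma lipschitz_of_derive_le (R : realType) (f df : R -> R) (K w a b : R) :
  (forall x, is_derive x (1 : R) f (df x)) -> (forall x, `|df x| <= K) ->
  `|a - b| <= w -> `|f a| <= `|f b| + K * w.
Proof.
move=> fdf dfK abw.
have cf (S : set R) : {within S, continuous f}%classic.
  apply: continuous_subspaceT => x; apply: differentiable_continuous.
  by apply/derivable1_diffP; case: (fdf x).
have key x y : x <= y -> `|f y - f x| <= K * `|y - x|.
  move=> xy; have [c _ ->] := MVT_segment xy (fun x _ => fdf x) (cf _).
  by rewrite normrM ler_wpM2r.
have h : `|f a - f b| <= K * w.
  have K0 : 0 <= K := le_trans (normr_ge0 _) (dfK a).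
  have {abw} abw := ler_wpM2l K0 abw; apply: le_trans abw.
  have [ab|/ltW ab] := leP a b; last exact: key.
  by rewrite distrC [X in _ * X]distrC; exact: key.
by have := ler_normD (f a - f b) (f b); rewrite subrK; lra.
Qed.

Lemma norm_scale_le (R : realDomainType) (a x r : R) :
  0 < a -> `|x| <= r -> `|a * x| <= a * r.
Proof. by move=> a0 xr; rewrite normrM (gtr0_norm a0) ler_pM2l. Qed.

(** [X], [Y] are the real and [X'], [Y'] the imaginary parts of two waves with frequency ratio 2;
    the bounds are on the normalized derivatives of orders 0 to 3 of their sum. Orders 0 and 2
    determine [X] and [Y], orders 1 and 3 determine [X'] and [Y'], and the four squares then add up
    to less than [r ^+ 2]. *)
Lemma no_small_jet (R : realFieldType) (X X' Y Y' r : R) : 0 < r ->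
  X ^+ 2 + X' ^+ 2 + (Y ^+ 2 + Y' ^+ 2) = r ^+ 2 ->
  `|X + Y| <= 19 / 100 * r -> `|X' + 2 * Y'| <= 35 / 100 * r ->
  `|X + 4 * Y| <= 68 / 100 * r -> `|X' + 8 * Y'| <= 271 / 1000 * r -> False.
Proof.
move=> r0 S p0 p1 p2 p3.
have sq z K : 0 <= K -> `|z| <= K * r -> z ^+ 2 <= K ^+ 2 * r ^+ 2.
  move=> K0 zK; rewrite -[leLHS]real_normK ?num_real // -exprMn.
  by rewrite lerXn2r ?nnegrE // mulr_ge0 // ltW.
have qY : Y ^+ 2 <= (29 / 100) ^+ 2 * r ^+ 2.
  apply: sq; first lra.
  by clear S p1 p3; move: p0 p2; rewrite !ler_norml; lra.
have qX : X ^+ 2 <= (48 / 100) ^+ 2 * r ^+ 2.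
  apply: sq; first lra.
  by clear S p1 p3 qY; move: p0 p2; rewrite !ler_norml; lra.
have qY' : Y' ^+ 2 <= (11 / 100) ^+ 2 * r ^+ 2.
  apply: sq; first lra.
  by clear S p0 p2 qX qY; move: p1 p3; rewrite !ler_norml; lra.
have qX' : X' ^+ 2 <= (56 / 100) ^+ 2 * r ^+ 2.
  apply: sq; first lra.
  by clear S p0 p2 qX qY qY'; move: p1 p3; rewrite !ler_norml; lra.
have r2 : 0 < r ^+ 2 by rewrite exprn_gt0.
clear p0 p1 p2 p3; lra.
Qed.

Lemma scaled_window_bounds (R : realFieldType) (m r h w k : R) :
  0 < m -> 0 < r -> 0 < h -> h <= w -> w * m <= 1 / 16 -> k = m ^+ 3 * r / 2 ^+ 13 ->
  [/\ m * r * w <= r / 16, m ^+ 2 * r * w <= m * r / 16,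
      m ^+ 3 * r * w <= m ^+ 2 * r / 16 &
  [/\ k * w <= m ^+ 2 * r / 2 ^+ 17, k * w ^+ 2 <= m * r / 2 ^+ 17
    & k * h ^+ 3 <= r / 2 ^+ 17]].
Proof.
move=> m0 r0 h0 hw wm kE; have w0 : 0 < w := lt_le_trans h0 hw.
have m3r : 0 < m ^+ 3 * r by rewrite mulr_gt0 ?exprn_gt0.
have k0 : 0 < k by rewrite kE divr_gt0 // exprn_gt0.
have mw1 : (m * r) * w <= r / 16.
  by have := ler_wpM2l (ltW r0) wm; clear -R; lra.
have mw2 : (m ^+ 2 * r) * w <= (m * r) / 16.
  by have := ler_wpM2l (ltW m0) mw1; clear -R; lra.
have mw3 : (m ^+ 3 * r) * w <= (m ^+ 2 * r) / 16.
  by have := ler_wpM2l (ltW m0) mw2; clear -R; lra.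
have kw1 : k * w <= (m ^+ 2 * r) / 2 ^+ 17.
  by rewrite kE; move: mw3; clear -R; lra.
have kw2 : k * w ^+ 2 <= (m * r) / 2 ^+ 17 / 16.
  by have := ler_wpM2r (ltW w0) kw1; move: mw2; clear -R; lra.
have kw3 : k * h ^+ 3 <= r / 2 ^+ 17 / 16 / 16.
  have : k * h ^+ 3 <= k * w ^+ 3.
    by rewrite ler_pM2l // lerXn2r ?nnegrE // ltW.
  by have := ler_wpM2r (ltW w0) kw2; move: mw1; clear -R; lra.
have mr0 : 0 < m * r by rewrite mulr_gt0.
split => //; split=> //.
  by move: kw2 mr0; clear -R; lra.
by move: kw3 r0; clear -R; lra.
Qed.

(** [F] is a value at the target point, [G] one at a point within [w] of it, and [a * X] a Lipschitz
    constant. *)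
Lemma transport_le (R : realFieldType) (F G H s X w a e b : R) :
  0 <= a -> e + a / 16 <= b -> 0 < s ->
  F <= G + a * X * w -> G <= H -> H <= e * s -> X * w <= s / 16 -> F <= b * s.
Proof.
move=> a0 eb s0 h1 h2 h3 h4; have := ler_wpM2l a0 h4.
have := ler_wpM2r (ltW s0) eb; lra.
Qed.

(** The budget: the first three add a sixteenth of a Lipschitz constant to the value at the starting
    point, the last three add the error of the pure-wave approximation. The outcome is the constants
    of [no_small_jet]. *)
Lemma transport_numerics (R : realFieldType) :
  [/\ 2 ^- 17 + 303 / 100 / 16 <= 19 / 100 :> R,
      10 / 2 ^+ 17 + 51 / 10 / 16 <= 32 / 100 :> R,
      12 / 2 ^+ 17 + 927 / 100 / 16 <= 58 / 100 :> R,
      8 / 2 ^+ 13 <= 1 / 1000 :> R &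
  [/\ 32 / 100 + 3 / 100 <= 35 / 100 :> R, 58 / 100 + 1 / 10 <= 68 / 100 :> R &
      1 / 1000 + 27 / 100 <= 271 / 1000 :> R]].
Proof. by split; [lra|lra|lra|lra|split; lra]. Qed.

Lemma approx_jet (R : realFieldType) (a r f x e1 e2 e : R) : 0 < a -> 0 < r ->
  e1 + e2 <= e -> `|f| <= e1 * (a * r) ->
  `|f + a * x| <= e2 * (a * r) \/ `|f - a * x| <= e2 * (a * r) -> `|x| <= e * r.
Proof.
move=> a0 r0 ee fe h; rewrite -(ler_pM2l a0) -{1}(gtr0_norm a0) -normrM.
have h3 := ler_wpM2r (ltW (mulr_gt0 a0 r0)) ee.
have : `|a * x| <= e1 * (a * r) + e2 * (a * r).
  case: h => h.
    rewrite -[a * x](addKr f) addrC.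
    by apply: le_trans (ler_normB _ _) _; rewrite addrC lerD.
  rewrite -[a * x](subKr f).
  by apply: le_trans (ler_normB _ _) _; rewrite lerD.
by move=> /le_trans; apply; move: h3; lra.
Qed.

(** Two steps of the recursion at the point 1 double the value, which is 1 for [s = 0] and 2 for
    [s = 1]. *)
Lemma rs_at_one (R : realType) (s : nat) :
  Num.sqrt (2 ^+ s) <= complex.Re (rs_moment true 0 s (0 : R)).
Proof.
have ReD (z z' : R[i]) : complex.Re (z + z') = complex.Re z + complex.Re z'.
  by case: z z' => [? ?] [? ?].
have ReN (z : R[i]) : complex.Re (- z) = - complex.Re z by case: z.
pose a b s := complex.Re (rs_moment b 0 s (0 : R)).
have aS s' : a true s'.+1 = a true s' + a false s'.
  by rewrite /a rs_moment0S mul0rn cis0 mulr1 mul1r ReD.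
have bS s' : a false s'.+1 = a true s' - a false s'.
  by rewrite /a rs_moment0S mul0rn cis0 mulr1 mulN1r ReD ReN.
have a0 b : a b 0 = 1 by rewrite /a rs_moment0.
have [k] := ubnP s; elim: k s => // k IH [|[|s]] sk.
- by rewrite -/(a true 0) a0 expr0 sqrtr1.
- rewrite -/(a true 1) aS !a0 expr1.
  apply: le_trans (_ : Num.sqrt (2 ^+ 2) <= _); first by rewrite ler_sqrt; lra.
  by rewrite sqrtr_sqr ger0_norm.
- rewrite -/(a true s.+2) aS aS bS -[s.+2]addn2 exprD mulrC sqrtrM ?sqr_ge0 //.
  rewrite sqrtr_sqr ger0_norm //.
  have : (s < k)%N by lia.
  by move=> /IH; rewrite -/(a true s); lra.
Qed.

Section TwoWaves.
Variables (R : realType) (t c : nat).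
Hypothesis ct : (2 ^ t * 128 <= c)%N.
Let m : R := c%:R.
Let r : R := rho R t.
Let A k u := wave t true c k u : R[i].
Let B k u := wave t false (2 * c) k u : R[i].

Let m0 : 0 < m.
Proof. by rewrite ltr0n; have := expn_gt0 2 t; nia. Qed.
Let r0 : 0 < r. Proof. exact: rho_gt0. Qed.

Definition two_waves (u : R) : R := complex.Re (A 0 u) + complex.Re (B 0 u).
Let f1 u := - complex.Im (A 1 u) - complex.Im (B 1 u).
Let f2 u := - complex.Re (A 2 u) - complex.Re (B 2 u).
Let f3 u := complex.Im (A 3 u) + complex.Im (B 3 u).

Let df0 u : is_derive u (1 : R) two_waves (f1 u).
Proof. by apply: is_deriveD; exact: is_derive_Re_wave. Qed.
Let df1 u : is_derive u (1 : R) f1 (f2 u).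
Proof. by apply: is_deriveB; [apply: is_deriveN|]; exact: is_derive_Im_wave. Qed.
Let df2 u : is_derive u (1 : R) f2 (f3 u).
Proof.
apply: (@is_derive_eq _ _ _ _ _ _ _ _ (is_deriveB (is_deriveN (is_derive_Re_wave _ _ _ _ _))
  (is_derive_Re_wave _ _ _ _ _))).
by rewrite !opprK.
Qed.

Let Aapprox (u : R) := wave_approx true u ct.
Let Bapprox u := @wave_approx R t false (2 * c) u (leq_trans ct (leq_pmull c (isT : 0 < 2)%N)).

Let A0 u : normc (A 0 u) <= r.
Proof. by rewrite /A wave0E normcM normc_cis mul1r; exact: normc_rs_moment0. Qed.
Let B0 u : normc (B 0 u) <= r.
Proof. by rewrite /B wave0E normcM normc_cis mul1r; exact: normc_rs_moment0. Qed.

Let ReB (z z' : R[i]) : complex.Re (z - z') = complex.Re z - complex.Re z'.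
Proof. by case: z z' => [? ?] [? ?]. Qed.
Let ImB (z z' : R[i]) : complex.Im (z - z') = complex.Im z - complex.Im z'.
Proof. by case: z z' => [? ?] [? ?]. Qed.
Let ReM (x : R) (z : R[i]) : complex.Re (x%:C%C * z) = x * complex.Re z.
Proof. by case: z => ? ? /=; rewrite mul0r subr0. Qed.
Let ImM (x : R) (z : R[i]) : complex.Im (x%:C%C * z) = x * complex.Im z.
Proof. by case: z => ? ? /=; rewrite mul0r addr0. Qed.

Let cX k : c%:R ^+ k = (m ^+ k)%:C%C :> R[i].
Proof. by rewrite rmorphXn rmorph_nat. Qed.
Let ccX k : (2 * c)%:R ^+ k = ((2 * m) ^+ k)%:C%C :> R[i].
Proof. by rewrite rmorphXn /m -natrM rmorph_nat. Qed.

(* The derivatives are, up to small multiples of r, those of two pure waves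
   of frequencies m and 2 m. *)
Let f1_approx u : `|f1 u + (m * complex.Im (A 0 u) + 2 * m * complex.Im (B 0 u))|
  <= 3 / 100 * (m * r).
Proof.
have [h _ _] := Aapprox u; have [h' _ _] := Bapprox u.
have := le_trans (Im_le_normc _) h; have := le_trans (Im_le_normc _) h'.
rewrite -[c%:R]expr1 -[(2 * c)%:R]expr1 cX ccX !ImB !ImM !expr1 natrM -/m -/r.
rewrite !ler_norml /f1 /A /B; lra.
Qed.

Let f2_approx u : `|f2 u + (m ^+ 2 * complex.Re (A 0 u) + 4 * m ^+ 2 * complex.Re (B 0 u))|
  <= 1 / 10 * (m ^+ 2 * r).
Proof.
have [_ h _] := Aapprox u; have [_ h' _] := Bapprox u.
have := le_trans (Re_le_normc _) h; have := le_trans (Re_le_normc _) h'.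
rewrite cX ccX !ReB !ReM natrM -/m -/r.
rewrite !ler_norml /f2 /A /B; lra.
Qed.

Let f3_approx u : `|f3 u - (m ^+ 3 * complex.Im (A 0 u) + 8 * m ^+ 3 * complex.Im (B 0 u))|
  <= 27 / 100 * (m ^+ 3 * r).
Proof.
have [_ _ h] := Aapprox u; have [_ _ h'] := Bapprox u.
have := le_trans (Im_le_normc _) h; have := le_trans (Im_le_normc _) h'.
rewrite cX ccX !ImB !ImM natrM -/m -/r.
rewrite !ler_norml /f3 /A /B; lra.
Qed.

Let bounds0 u : [/\ `|complex.Re (A 0 u)| <= r, `|complex.Im (A 0 u)| <= r,
  `|complex.Re (B 0 u)| <= r & `|complex.Im (B 0 u)| <= r].
Proof.
by split; [apply: le_trans (Re_le_normc _) (A0 u)|apply: le_trans (Im_le_normc _) (A0 u)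
  |apply: le_trans (Re_le_normc _) (B0 u)|apply: le_trans (Im_le_normc _) (B0 u)].
Qed.

Let f1_le u : `|f1 u| <= 303 / 100 * (m * r).
Proof.
have [_ h1 _ h2] := bounds0 u; have := f1_approx u.
have {h1} := norm_scale_le m0 h1; have {h2} := norm_scale_le m0 h2.
rewrite !ler_norml; lra.
Qed.

Let f2_le u : `|f2 u| <= 51 / 10 * (m ^+ 2 * r).
Proof.
have [h1 _ h2 _] := bounds0 u; have := f2_approx u.
have m20 : 0 < m ^+ 2 by rewrite exprn_gt0.
have {h1} := norm_scale_le m20 h1; have {h2} := norm_scale_le m20 h2.
rewrite !ler_norml; lra.
Qed.

Let f3_le u : `|f3 u| <= 927 / 100 * (m ^+ 3 * r).
Proof.
have [_ h1 _ h2] := bounds0 u; have := f3_approx u.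
have m30 : 0 < m ^+ 3 by rewrite exprn_gt0.
have {h1} := norm_scale_le m30 h1; have {h2} := norm_scale_le m30 h2.
rewrite !ler_norml; lra.
Qed.

Lemma two_waves_cos u : two_waves u =
  \sum_(0 <= j < 2 ^ t) (rs t true j)%:~R * cos (u *+ (c + j)) +
  \sum_(0 <= j < 2 ^ t) (rs t false j)%:~R * cos (u *+ (2 * c + j)).
Proof.
rewrite /two_waves (ReIm_wave _ _ _ _ _).1 (ReIm_wave _ _ _ _ _).1.
by congr (_ + _); apply: eq_bigr => j _; rewrite expr0 mulr1.
Qed.

Lemma two_waves_le u : `|two_waves u| <= 2 * r.
Proof.
have [h1 _ h2 _] := bounds0 u; apply: le_trans (ler_normD _ _) _.
by rewrite mulr_natl mulr2n lerD.
Qed.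

(** At 0 the two waves add up to the Rudin-Shapiro polynomial of the next order at 1, which is at
    least [r]; the Lipschitz constant [303 / 100 * (m * r)] costs little on this range. *)
Lemma two_waves_near0 u : `|u| * m <= 1 / 100 -> r / 2 <= `|two_waves u|.
Proof.
move=> um.
have h0 : r <= two_waves 0.
  rewrite /r /rho /two_waves /A /B !wave0E !mul0rn cis0 !mul1r.
  apply: le_trans (rs_at_one R t.+1) _; rewrite rs_moment0S mul0rn cis0 mulr1 mul1r.
  by case: (rs_moment true _ _ _) => ? ?; case: (rs_moment false _ _ _) => ? ?.
have := lipschitz_of_derive_le (a := 0) (b := u) df0 f1_le.
rewrite sub0r normrN => /(_ _ (lexx _)).
have := ler_wpM2l (ltW r0) um; have := ler_norm (two_waves 0).
move: h0 r0; lra.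
Qed.

Lemma no_four_small_values (u1 u2 u3 u4 h w : R) :
  0 < h -> u1 + h <= u2 -> u2 + h <= u3 -> u3 + h <= u4 -> u4 - u1 <= w ->
  w * c%:R <= 1 / 16 ->
  `|two_waves u1| <= (c%:R * h) ^+ 3 * rho R t / 2 ^+ 13 ->
  `|two_waves u2| <= (c%:R * h) ^+ 3 * rho R t / 2 ^+ 13 ->
  `|two_waves u3| <= (c%:R * h) ^+ 3 * rho R t / 2 ^+ 13 ->
  `|two_waves u4| <= (c%:R * h) ^+ 3 * rho R t / 2 ^+ 13 -> False.
Proof.
move=> h0 h12 h23 h34 uw wm; rewrite -/m -/r in wm *.
pose k := m ^+ 3 * r / 2 ^+ 13.
have -> : (m * h) ^+ 3 * r / 2 ^+ 13 = k * h ^+ 3 by rewrite /k; ring.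
move=> b1 b2 b3 b4.
have [x1 [x2 [x3 [i1 i2 i3 [g1 g2 g3]]]]] :=
  cubic_rolle df0 df1 df2 h0 h12 h23 h34 uw b1 b2 b3 b4.
have close a b : u1 <= a <= u4 -> u1 <= b <= u4 -> `|a - b| <= w.
  by move=> ia ib; rewrite ler_norml; lra.
have w0 : 0 < w by lra.
have hw : h <= w by lra.
have kE : k = m ^+ 3 * r / 2 ^+ 13 by [].
have [mw1 mw2 mw3 [kw1 kw2 kw3]] := scaled_window_bounds m0 r0 h0 hw wm kE.
have m2 : 0 < m ^+ 2 by rewrite exprn_gt0.
have m3 : 0 < m ^+ 3 by rewrite exprn_gt0.
have m1r : 0 < m * r by rewrite mulr_gt0.
have m2r : 0 < m ^+ 2 * r by rewrite mulr_gt0.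
have m3r : 0 < m ^+ 3 * r by rewrite mulr_gt0.
have [n0 n1 n2 n3 [n4 n5 n6]] := transport_numerics R.
have dge0 (p q : nat) : 0 <= p%:R / q%:R :> R by rewrite divr_ge0.
(* All four orders are compared at the single point [x3], where the third derivative is small; the
   bounds on the lower orders are carried there across the window. *)
have l0 : `|two_waves x3| <= 19 / 100 * r.
  have iu : u1 <= u1 <= u4 by rewrite lexx; case/andP: i1 => /le_trans; apply.
  have kw : k * h ^+ 3 <= 2 ^- 17 * r by rewrite [leRHS]mulrC.
  have h' := lipschitz_of_derive_le df0 f1_le (close _ _ i3 iu).
  exact: transport_le (dge0 303 100)%N n0 r0 h' b1 kw mw1.
have l1 : `|f1 x3| <= 32 / 100 * (m * r).
  have kw : 10 * k * w ^+ 2 <= 10 / 2 ^+ 17 * (m * r).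
    by rewrite -mulrA -[leRHS]mulrA ler_pM2l // [leRHS]mulrC.
  have h' := lipschitz_of_derive_le df1 f2_le (close _ _ i3 i1).
  exact: transport_le (dge0 51 10)%N n1 m1r h' g1 kw mw2.
have l2 : `|f2 x3| <= 58 / 100 * (m ^+ 2 * r).
  have kw : 12 * k * w <= 12 / 2 ^+ 17 * (m ^+ 2 * r).
    by rewrite -mulrA -[leRHS]mulrA ler_pM2l // [leRHS]mulrC.
  have h' := lipschitz_of_derive_le df2 f3_le (close _ _ i3 i2).
  exact: transport_le (dge0 927 100)%N n2 m2r h' g2 kw mw3.
have l3 : `|f3 x3| <= 1 / 1000 * (m ^+ 3 * r).
  have kw : 8 * k = 8 / 2 ^+ 13 * (m ^+ 3 * r) by rewrite -[RHS]mulrA [_^-1 * _]mulrC.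
  by apply: le_trans g3 _; rewrite kw ler_wpM2r // ltW.
have a1 := f1_approx x3; have a2 := f2_approx x3; have a3 := f3_approx x3.
have S := normc_wave0_sum t c (2 * c) x3; rewrite !sqr_normc in S.
apply: (no_small_jet r0 S l0).
- apply: (approx_jet m0 r0 n4 l1); left.
  by rewrite mulrDr mulrCA [2 * (m * _)]mulrA.
- apply: (approx_jet m2 r0 n5 l2); left.
  by rewrite mulrDr mulrCA [4 * (_ * _)]mulrA.
- apply: (approx_jet m3 r0 n6 l3); right.
  by rewrite mulrDr mulrCA [8 * (_ * _)]mulrA.
Qed.

End TwoWaves.

(** * The spike kernel *)

Section Kernel.
Variable R : realType.

Lemma sin_le_self (x : R) : `|sin x| <= `|x|.
Proof.
have := @lipschitz_of_derive_le R sin cos 1 `|x| x 0 (fun y => is_derive_sin y) (@cos_max R).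
by rewrite subr0 sin0 normr0 add0r mul1r => /(_ (lexx _)).
Qed.

Lemma cos_ge_quadratic (x : R) : 1 - x ^+ 2 / 2 <= cos x.
Proof.
have -> : cos x = 1 - 2 * sin (x / 2) ^+ 2.
  have {1}-> : x = (x / 2) *+ 2 by rewrite -[RHS]mulr_natr; field.
  by rewrite cos_mulr2n cos2sin2; ring.
have := sin_le_self (x / 2).
rewrite -(@ler_pXn2r _ 2) ?nnegrE // !real_normK ?num_real //; lra.
Qed.

Lemma sin_ge_cubic (x : R) : 0 <= x -> x - x ^+ 3 / 6 <= sin x.
Proof.
move=> x0.
pose f : R -> R := sin - (id - 6^-1 \*: (id ^+ 3)).
have df y : is_derive y (1 : R) f (cos y - (1 - y ^+ 2 / 2)).
  apply: is_derive_eq; congr (_ - (_ - _)).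
  by rewrite /GRing.scale /=; field.
have [|c _] := MVT_segment x0 (fun y _ => df y).
  apply: continuous_subspaceT => y; apply: differentiable_continuous.
  by apply/derivable1_diffP; case: (df y).
have fE y : f y = sin y - (y - y ^+ 3 / 6).
  by rewrite /f !fctE /=; congr (_ - (_ - _)); exact: mulrC.
rewrite !fE sin0 => h.
have : 0 <= (cos c - (1 - c ^+ 2 / 2)) * (x - 0).
  by apply: mulr_ge0; [have := cos_ge_quadratic c; lra|lra].
rewrite -h expr0n /=; lra.
Qed.

(** Linearly decreasing weights on the odd frequencies, normalized to sum 1. Odd frequencies keep
    the spikes apart from the cosine sum, whose frequencies are even, and make the kernel change
    sign under [x -> pi - x]. *)
Definition spike_weight (n l : nat) : R := (2 * n%:R - (2 * l + 1)%:R) / n%:R ^+ 2.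

Definition spike (n : nat) (x : R) : R :=
  \sum_(0 <= l < n) spike_weight n l * cos (x *+ (2 * l + 1)).

Lemma spike_weight_bounds n l : (l < n)%N -> 0 <= spike_weight n l <= 2 / n%:R.
Proof.
move=> ln; have n0 : 0 < n%:R :> R by rewrite ltr0n; lia.
have h1 : (2 * l + 1)%:R <= 2 * n%:R :> R by rewrite -natrM ler_nat; lia.
apply/andP; split.
  by rewrite /spike_weight divr_ge0 ?sqr_ge0 // subr_ge0.
rewrite /spike_weight ler_pdivrMr ?exprn_gt0 //.
rewrite (_ : 2 / n%:R * n%:R ^+ 2 = 2 * n%:R); last by field; rewrite gt_eqF.
by rewrite gerBl.
Qed.

Lemma sum_spike_weight n : (0 < n)%N -> \sum_(0 <= l < n) spike_weight n l = 1.
Proof.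
move=> n0; have n0' : n%:R != 0 :> R by rewrite pnatr_eq0 -lt0n.
have key m : \sum_(0 <= l < m) (2 * n%:R - (2 * l + 1)%:R) = 2 * n%:R * m%:R - m%:R ^+ 2 :> R.
  elim: m => [|m IH]; first by rewrite big_geq // expr0n /= mulr0 subrr.
  by rewrite big_nat_recr //= IH -natr1 (natrD _ (2 * m) 1) natrM; ring.
by rewrite -mulr_suml key; field.
Qed.

Lemma spike_le1 n x : (0 < n)%N -> `|spike n x| <= 1.
Proof.
move=> n0; rewrite -(sum_spike_weight n0); apply: le_trans (ler_norm_sum _ _ _) _.
rewrite big_nat [leRHS]big_nat; apply: ler_sum => l /andP[_ ln].
have /andP[w0 _] := spike_weight_bounds ln.
by rewrite normrM ger0_norm // -[leRHS]mulr1 ler_wpM2l // cos_max.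
Qed.

(** The second moment of the weights is [(2 * n ^ 2 + 1) / 3], and [1 - y ^ 2 / 2 <= cos y] is
    applied termwise. *)
Lemma spike_peak n x : (0 < n)%N ->
  1 - (2 * n%:R ^+ 2 + 1) * x ^+ 2 / 6 <= spike n x.
Proof.
move=> n0; have n0' : n%:R != 0 :> R by rewrite pnatr_eq0 -lt0n.
have key m : \sum_(0 <= l < m) (2 * n%:R - (2 * l + 1)%:R) * (2 * l + 1)%:R ^+ 2 =
    2 * n%:R * m%:R * (4 * m%:R ^+ 2 - 1) / 3 - m%:R ^+ 2 * (2 * m%:R ^+ 2 - 1) :> R.
  elim: m => [|m IH]; first by rewrite big_geq // expr0n /=; ring.
  by rewrite big_nat_recr //= IH -natr1 (natrD _ (2 * m) 1) natrM; field.
have -> : 1 - (2 * n%:R ^+ 2 + 1) * x ^+ 2 / 6 =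
    \sum_(0 <= l < n) spike_weight n l * (1 - (x *+ (2 * l + 1)) ^+ 2 / 2).
  rewrite (eq_bigr (fun l => spike_weight n l - x ^+ 2 / (2 * n%:R ^+ 2) *
      ((2 * n%:R - (2 * l + 1)%:R) * (2 * l + 1)%:R ^+ 2))) => [|l _].
    by rewrite sumrB sum_spike_weight // -mulr_sumr key; field.
  by rewrite /spike_weight -mulr_natl; field.
rewrite big_nat [leRHS]big_nat; apply: ler_sum => l /andP[_ ln].
have /andP[w0 _] := spike_weight_bounds ln.
by rewrite ler_wpM2l // cos_ge_quadratic.
Qed.

(** The closed form of the kernel: it yields both nonnegativity where [cos] is nonnegative and the
    quadratic decay. *)
Lemma spike_fejer n x : (0 < n)%N ->
  n%:R ^+ 2 * sin x ^+ 2 * spike n x = cos x * sin (x *+ n) ^+ 2.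
Proof.
move=> n0; have n0' : n%:R != 0 :> R by rewrite pnatr_eq0 -lt0n.
(* Two stages: the weights for [m.+1] exceed those for [m] by 2, so passing from [S m] to [S m.+1]
   adds the plain sum of [D m] and one last term of weight 1. *)
have D m : sin x * \sum_(0 <= l < m) 2 * cos (x *+ (2 * l + 1)) = sin ((x *+ m) *+ 2).
  elim: m => [|m IH]; first by rewrite big_geq // mulr0 !mul0rn sin0.
  rewrite big_nat_recr //= mulrDr IH.
  have -> : x *+ (2 * m + 1) = (x *+ m) *+ 2 + x by rewrite mulrnDr mulnC mulrnA.
  have -> : (x *+ m.+1) *+ 2 = (x *+ m) *+ 2 + x + x.
    by rewrite [x *+ m.+1]mulrSr !mulr2n addrACA addrA.
  move: (_ *+ 2) => y; apply/eqP; rewrite -subr_eq0; apply/eqP.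
  transitivity (sin y * (1 - (cos x ^+ 2 + sin x ^+ 2))).
    by rewrite !(sinD, cosD); ring.
  by rewrite cos2Dsin2 subrr mulr0.
have S m : sin x ^+ 2 * \sum_(0 <= l < m) (2 * m%:R - (2 * l + 1)%:R) * cos (x *+ (2 * l + 1))
    = cos x * sin (x *+ m) ^+ 2.
  elim: m => [|m IH]; first by rewrite big_geq // mulr0 mulr0n sin0 expr0n mulr0.
  rewrite big_nat_recr //= (eq_bigr (fun l => (2 * m%:R - (2 * l + 1)%:R) * cos (x *+ (2 * l + 1))
     + 2 * cos (x *+ (2 * l + 1)))) => [|l _]; last by rewrite -natr1; ring.
  rewrite big_split /= !mulrDr IH expr2 -mulrA D.
  have -> : 2 * m.+1%:R - (2 * m + 1)%:R = 1 :> R by rewrite -natr1 (natrD _ (2 * m) 1) natrM; ring.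
  have -> : x *+ (2 * m + 1) = (x *+ m) *+ 2 + x by rewrite mulrnDr mulnC mulrnA.
  rewrite mul1r [x *+ m.+1]mulrSr; move: (x *+ m) => y.
  apply/eqP; rewrite -subr_eq0; apply/eqP.
  transitivity ((cos x * sin y ^+ 2 + 2 * sin x * cos y * sin y)
      * (1 - (cos x ^+ 2 + sin x ^+ 2))
    + sin x ^+ 2 * cos x * ((cos y ^+ 2 + sin y ^+ 2) - 1)).
    by rewrite (cosD (y *+ 2)) sin_mulr2n cos_mulr2n (sinD y); ring.
  by rewrite !cos2Dsin2 subrr !mulr0 addr0.
rewrite -S [n%:R ^+ 2 * _]mulrC -mulrA; congr (_ * _).
rewrite /spike mulr_sumr; apply: eq_bigr => l _.
by rewrite /spike_weight; field.
Qed.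

End Kernel.

Section Tail.
Variable R : realType.

(** Telescoping, from [1 / (a + 1) ^ 2 <= 1 / a - 1 / (a + 1)]. *)
Lemma sum_inv_sqr_le b M : (0 < b)%N ->
  \sum_(0 <= i < M) ((i + b.+1)%:R : R) ^- 2 <= 1 / b%:R - 1 / (M + b)%:R.
Proof.
move=> b0; elim: M => [|M IH]; first by rewrite big_geq // add0n subrr.
rewrite big_nat_recr //=; apply: le_trans (lerD IH (lexx _)) _.
rewrite addnS addSn -natr1.
have : 0 < (M + b)%:R :> R by rewrite ltr0n addn_gt0 b0 orbT.
have : 0 < b%:R :> R by rewrite ltr0n.
move: (M + b)%:R b%:R => a c c0 a0; rewrite -subr_ge0.
have -> : 1 / c - 1 / (a + 1) - (1 / c - 1 / a + (a + 1) ^- 2) =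
    (a + 1) ^- 2 / a.
  by field; rewrite !gt_eqF //; lra.
by rewrite divr_ge0 ?invr_ge0 ?exprn_ge0 //; lra.
Qed.

(** The distance of [k] and [k0]: at least one of the two truncated differences is 0. *)
Definition gap (k k0 : nat) : nat := ((k - k0) + (k0 - k))%N.

(** Each side of [k0] contributes at most [1 / (B - 3)]. The 3 taken off the distance absorbs the
    offset between a point of cell [k0] and the centre of a spike. *)
Lemma tail_sum B N k0 : (3 < B)%N ->
  \sum_(0 <= k < N | (B < gap k k0)%N) ((gap k k0 - 3)%:R : R) ^- 2 <= 2 / (B - 3)%:R.
Proof.
move=> B3.
have bound M : \sum_(0 <= i < M) ((i + (B - 2))%:R : R) ^- 2 <= 1 / (B - 3)%:R.
  have -> : (B - 2 = (B - 3).+1)%N by lia.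
  apply: le_trans (sum_inv_sqr_le M _) _; first lia.
  by rewrite gerBl divr_ge0.
rewrite (bigID (fun k => k < k0)%N) /=.
have -> : 2 / (B - 3)%:R = 1 / (B - 3)%:R + 1 / (B - 3)%:R :> R by rewrite -mulrDl.
apply: lerD.
  have := bound (k0 - B)%N; apply: le_trans.
  rewrite [leRHS]big_nat_rev /= add0n.
  rewrite [leRHS](@big_nat_widen _ _ _ _ _ (N + k0)%N); last lia.
  apply: le_trans (_ : \sum_(0 <= k < (N + k0)%N | (B < gap k k0)%N && (k < k0)%N)
     ((gap k k0 - 3)%:R : R) ^- 2 <= _).
    rewrite [leRHS](@big_cat_nat _ _ _ N) ?leq_addr //=.
    by rewrite lerDl sumr_ge0 // => i _; rewrite invr_ge0 exprn_ge0.
  rewrite le_eqVlt; apply/orP; left; apply/eqP.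
  apply: eq_big => [k|k /andP[]]; rewrite /gap; first by apply/idP/idP; lia.
  by move=> ? ?; congr (_%:R ^- 2); lia.
have := bound (N - (k0 + B.+1))%N; apply: le_trans.
have [Nk|kN] := leqP N (k0 + B.+1)%N.
  rewrite big_nat_cond big_pred0 => [|k]; first by apply: sumr_ge0 => i _; rewrite invr_ge0 exprn_ge0.
  by apply/negP; rewrite /gap; lia.
rewrite (@big_cat_nat _ _ _ (k0 + B.+1)%N) //=; last lia.
rewrite [X in X + _]big_nat_cond [X in X + _]big_pred0 ?add0r => [|k]; last first.
  by apply/negP; rewrite /gap; lia.
rewrite -{1}[(k0 + B.+1)%N]add0n big_addn.
rewrite le_eqVlt; apply/orP; left; apply/eqP.
rewrite big_nat_cond [RHS]big_nat_cond.
apply: eq_big => [k|k /andP[]]; rewrite /gap; first by apply/idP/idP; lia.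
by move=> ? ?; congr (_%:R ^- 2); lia.
Qed.

End Tail.

Section SpikeTail.
Variable R : realType.

Lemma spikeN n (x : R) : spike n (- x) = spike n x.
Proof. by apply: eq_bigr => l _; rewrite mulNrn cosN. Qed.

Lemma spike_reflect n (x : R) : spike n (pi - x) = - spike n x.
Proof.
rewrite -sumrN; apply: eq_bigr => l _; rewrite -mulrN; congr (_ * _).
rewrite mulrnBl mulrnDr mulrnA addrAC cosDpi addrC (periodicn (@cosD2pi R)) cosN //.
Qed.

Lemma sin_ge_linear (x : R) : 0 <= x <= 2 -> 5 / 12 * x <= sin x.
Proof.
move=> /andP[x0 x2].
have {2}-> : x = (x / 2) *+ 2 by rewrite -[RHS]mulr_natr; field.
rewrite sin_mulr2n; have y0 : 0 <= x / 2 by lra.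
have h1 := sin_ge_cubic y0; have h2 := cos_ge_quadratic (x / 2).
have c2 : 1 / 2 <= cos (x / 2) by apply: le_trans h2; nra.
have s2 : 5 / 6 * (x / 2) <= sin (x / 2) by apply: le_trans h1; nra.
rewrite -[leRHS]mulr_natl; nra.
Qed.

(** For [x <= pi / 2] it follows from the Fejer formula and [5 / 12 * x <= sin x], as
    [(12 / 5) ^ 2 <= 6]; reflection in [pi / 2] covers the other half. *)
Lemma spike_decay n (x y : R) : (0 < n)%N -> 0 < y -> y <= x -> y <= pi - x ->
  `|spike n x| <= 6 * (n%:R * y) ^- 2.
Proof.
move=> n0.
wlog xpi : x / x <= pi / 2.
  move=> H y0 yx yp; have [|xpi] := leP x (pi / 2); first by move=> h; exact: H.
  by rewrite -normrN -spike_reflect; apply: H => //; lra.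
move=> y0 yx _; have nR : 0 < n%:R :> R by rewrite ltr0n.
have sx : 5 / 12 * x <= sin x.
  by apply: sin_ge_linear; have := @pihalf_lt2 R; lra.
have := spike_fejer x n0; set s := spike n x => h.
rewrite -[leRHS]/(6 / _) ler_pdivlMr ?exprn_gt0 ?mulr_gt0 //.
have h1 : `|n%:R ^+ 2 * sin x ^+ 2 * s| <= 1.
  rewrite h normrM -[leRHS]mulr1 ler_pM ?normr_ge0 ?cos_max //.
  by rewrite normrX expr_le1 // sin_max.
rewrite normrM (normrM (n%:R ^+ 2)) !normrX (gtr0_norm nR) real_normK ?num_real // in h1.
have h2 : y ^+ 2 <= 6 * sin x ^+ 2 by nra.
have h3 : 0 <= n%:R ^+ 2 * `|s| by rewrite mulr_ge0 ?sqr_ge0.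
have := ler_wpM2l h3 h2; rewrite exprMn; lra.
Qed.

End SpikeTail.

Lemma gap_addl B k k0 : (3 < B)%N -> (B < gap k k0)%N -> (k <= k0)%N ->
  k0 = (k + (gap k k0 - 3) + 3)%N.
Proof. rewrite /gap; lia. Qed.

Lemma gapC k k0 : gap k k0 = gap k0 k.
Proof. by rewrite /gap addnC. Qed.

Lemma gap_le B k k0 : (gap k k0 <= B)%N = (k <= k0 + B)%N && (k0 <= k + B)%N.
Proof. by rewrite /gap; apply/idP/idP; lia. Qed.

Lemma near_range B k k0 :
  (gap k k0 <= B)%N = (k0 - B <= k <= k0 - B + 2 * B)%N && (gap k k0 <= B)%N.
Proof. by rewrite /gap; apply/idP/idP; lia. Qed.

Section Spikes.
Variables (R : realType) (n N B : nat) (ch : pred nat) (al : nat -> R).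
Hypothesis B_big : 1000 <= B%:R :> R.
Hypothesis n_big : (2 * B < n)%N.

Lemma spike_ge0 (x : R) : `|x| <= pi / 2 -> 0 <= spike n x.
Proof.
move=> xpi; have n0 : (0 < n)%N := leq_ltn_trans (leq0n _) n_big.
have nR : 0 < n%:R :> R by rewrite ltr0n.
have [->|x0] := eqVneq x 0.
  rewrite /spike (eq_bigr (fun l => spike_weight R n l)) ?sum_spike_weight //.
  by move=> l _; rewrite mul0rn cos0 mulr1.
have sx : 0 < sin x ^+ 2.
  rewrite -[sin x ^+ 2]real_normK ?num_real // exprn_gt0 // normr_gt0.
  have [xp|xn] := ltP 0 x.
    by rewrite gt_eqF // sin_gt0_pi // xp /=; move: (ler_norm x) (@pi_gt0 R); lra.
  have xn' : 0 < - x by rewrite oppr_gt0 lt_neqAle x0.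
  rewrite -oppr_eq0 -sinN gt_eqF // sin_gt0_pi // xn' /=.
  by have := ler_norm (- x); rewrite normrN; move: (@pi_gt0 R); lra.
have cx : 0 <= cos x by apply: cos_ge0_pihalf; rewrite -ler_norml.
have := spike_fejer x n0.
have a0 : 0 < n%:R ^+ 2 * sin x ^+ 2 by rewrite mulr_gt0 // exprn_gt0.
rewrite -(pmulr_rge0 _ a0) => ->; by rewrite mulr_ge0 // sqr_ge0.
Qed.

(** The common endpoint of the cells [k] and [k.+1]: the spike of a chosen cell [k] has to be high
    on both. *)
Definition center (k : nat) : R := k.+1%:R / n%:R.

(** Subtracting the mirror image makes the sum odd, hence a sine sum. *)
Definition spikes (x : R) : R :=
  \sum_(0 <= k < N | ch k) al k * (spike n (x - center k) - spike n (x + center k)).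

Hypothesis ch_pihalf : forall k, ch k -> k%:R / n%:R <= pi / 2 :> R.
Hypothesis ch_count : forall a,
  (\sum_(0 <= k < N | ch k && (a <= k <= a + 2 * B)) 1 <= 3)%N.
Hypothesis al1 : forall k, `|al k| = 1.

Variables (x : R) (k0 : nat).
Hypothesis x_range : 0 <= x <= pi / 2.
Hypothesis x_cell : k0%:R / n%:R <= x <= k0.+1%:R / n%:R.

Let nR : 0 < n%:R :> R.
Proof. by rewrite ltr0n; exact: leq_ltn_trans n_big. Qed.

Let B3 : (3 < B)%N.
Proof. by rewrite -(ltr_nat R); apply: lt_le_trans B_big; rewrite ltr_nat. Qed.

Let far_terms k : ch k -> (B < gap k k0)%N ->
  `|spike n (x - center k)| <= 6 * (gap k k0 - 3)%:R ^- 2 /\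
  `|spike n (x + center k)| <= 6 * (gap k k0 - 3)%:R ^- 2.
Proof.
move=> /ch_pihalf kpi kfar; have n0 : (0 < n)%N := leq_ltn_trans (leq0n _) n_big.
set g := (gap k k0 - 3)%N; pose y : R := g%:R / n%:R.
have gE : g%:R = n%:R * y by rewrite /y mulrC divfK // gt_eqF.
have y0 : 0 < y by rewrite divr_gt0 // ltr0n subn_gt0 (ltn_trans B3).
rewrite gE; have cE : center k = k%:R / n%:R + 1 / n%:R by rewrite /center -natr1 mulrDl.
have e0 : 0 < 1 / n%:R :> R by rewrite divr_gt0.
have x1 : k0.+1%:R / n%:R = k0%:R / n%:R + 1 / n%:R :> R by rewrite -natr1 mulrDl.
have nB : 2 * B%:R * (1 / n%:R) <= 1 :> R.
  by rewrite mulrA mulr1 ler_pdivrMr // mul1r -natrM ler_nat ltnW.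
have pi2 := @pi_ge2 R.
have [xr1 xr2] := andP x_range; have [xc1 xc2] := andP x_cell.
rewrite x1 in xc2; have k0n : 0 <= k%:R / n%:R :> R by rewrite divr_ge0.
have [kk0|kk0] := leqP k k0.
  have kE : k0%:R / n%:R = k%:R / n%:R + y + 3%:R * (1 / n%:R) :> R.
    rewrite {1}(gap_addl B3 kfar kk0) -/g.
    by rewrite (natrD _ (k + g)) natrD /y; ring.
  by split; apply: spike_decay => //; rewrite cE; lra.
have kE : k%:R / n%:R = k0%:R / n%:R + y + 3%:R * (1 / n%:R) :> R.
  have kfar' := kfar; rewrite gapC in kfar'.
  rewrite {1}(gap_addl B3 kfar' (ltnW kk0)) gapC -/g.
  by rewrite (natrD _ (k0 + g)) natrD /y; ring.
by split; [rewrite -spikeN|]; apply: spike_decay => //; rewrite cE; lra.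
Qed.

Let far_sum : `|\sum_(0 <= k < N | ch k && (B < gap k k0)%N)
  al k * (spike n (x - center k) - spike n (x + center k))| <= 3 / 100.
Proof.
apply: le_trans (ler_norm_sum _ _ _) _.
apply: le_trans (_ : \sum_(0 <= k < N | (B < gap k k0)%N)
   12 * ((gap k k0 - 3)%:R : R) ^- 2 <= _); last first.
  rewrite -mulr_sumr; apply: le_trans (ler_wpM2l _ (tail_sum R N k0 B3)) _ => //.
  (* The bound [24 / (B - 3) <= 3 / 100] rests on [1000 <= B]. *)
  rewrite mulrA ler_pdivrMr ?ltr0n ?subn_gt0 // natrB ?(ltnW B3) //; move: B_big; lra.
rewrite [leRHS](bigID ch) /= -[leLHS]addr0; apply: lerD; last first.
  by apply: sumr_ge0 => k _; rewrite mulr_ge0 // invr_ge0 exprn_ge0.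
rewrite (eq_bigl (fun k => (B < gap k k0)%N && ch k)); last by move=> k; rewrite andbC.
apply: ler_sum => k /andP[kf kc]; have [h1 h2] := far_terms kc kf.
rewrite normrM al1 mul1r; apply: le_trans (ler_normB _ _) _; lra.
Qed.

Let spikes_split : spikes x =
  \sum_(0 <= k < N | ch k && (gap k k0 <= B)%N)
    al k * (spike n (x - center k) - spike n (x + center k)) +
  \sum_(0 <= k < N | ch k && (B < gap k k0)%N)
    al k * (spike n (x - center k) - spike n (x + center k)).
Proof.
rewrite /spikes (bigID (fun k => gap k k0 <= B)%N) /=; congr (_ + _).
by apply: eq_bigl => k; rewrite -ltnNge.
Qed.

Let near_count : \sum_(0 <= k < N | ch k && (gap k k0 <= B)%N) 1 <= 3%:R :> R.
Proof.
rewrite [leLHS](_ : _ = (\sum_(0 <= k < N | ch k && (gap k k0 <= B)%N) 1)%:R);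
  last by rewrite natr_sum.
rewrite ler_nat; apply: leq_trans (ch_count (k0 - B)).
rewrite [leqRHS](bigID (fun k => gap k k0 <= B)%N) /=.
apply: leq_trans (leq_addr _ _); rewrite leq_eqVlt; apply/orP; left; apply/eqP.
apply: eq_bigl => k; rewrite -andbA; congr (_ && _).
exact: near_range.
Qed.

(** At most three chosen cells are near, each giving a spike and a mirror image of size at most 1;
    the far ones add [3 / 100]. *)
Lemma spikes_le : `|spikes x| <= 7.
Proof.
rewrite spikes_split; apply: le_trans (ler_normD _ _) _.
have n0 : (0 < n)%N := leq_ltn_trans (leq0n _) n_big.
apply: le_trans (_ : 2 * 3%:R + 3 / 100 <= _); last lra.
apply: lerD far_sum; apply: le_trans (ler_norm_sum _ _ _) _.
apply: le_trans (ler_wpM2l _ near_count) => //; rewrite mulr_sumr.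
apply: ler_sum => k _; rewrite normrM al1 mul1r mulr1.
apply: le_trans (ler_normB _ _) _.
by rewrite [leRHS]mulr2n; apply: lerD; exact: spike_le1.
Qed.

Variable k1 : nat.
Hypothesis k1N : (k1 < N)%N.
Hypothesis k1_ch : ch k1.
Hypothesis k1_cell : k1 = k0 \/ k1.+1 = k0.
Hypothesis k0_big : (B <= k0)%N.
Hypothesis al_const : forall k, ch k -> (gap k k0 <= B)%N -> al k = al k1.

(** A near spike is nonnegative, its argument being within [pi / 2] of 0. The mirror image either
    has its argument beyond [pi / 2], where it has the favourable sign, or at least [B / n] away
    from 0 because [B <= k0], and then it is at most [6 / B ^ 2]. *)
Let near_term k : ch k -> (gap k k0 <= B)%N ->
  0 <= spike n (x - center k) /\ - (1 / 1000) <= - spike n (x + center k).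
Proof.
move=> /ch_pihalf kpi knear; have n0 : (0 < n)%N := leq_ltn_trans (leq0n _) n_big.
have cE : center k = k%:R / n%:R + 1 / n%:R by rewrite /center -natr1 mulrDl.
have e0 : 0 < 1 / n%:R :> R by rewrite divr_gt0.
have x1 : k0.+1%:R / n%:R = k0%:R / n%:R + 1 / n%:R :> R by rewrite -natr1 mulrDl.
have nB : 2 * B%:R * (1 / n%:R) <= 1 :> R.
  by rewrite mulrA mulr1 ler_pdivrMr // mul1r -natrM ler_nat ltnW.
have eB := ler_wpM2r (ltW e0) B_big.
have pi2 := @pi_ge2 R.
have [xr1 xr2] := andP x_range; have [xc1 xc2] := andP x_cell.
rewrite x1 in xc2; have k0n : 0 <= k%:R / n%:R :> R by rewrite divr_ge0.
have g1 : k%:R / n%:R <= k0%:R / n%:R + B%:R * (1 / n%:R) :> R.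
  by rewrite mulrA mulr1 -mulrDl -natrD ler_pM2r ?invr_gt0 // ler_nat; move: knear; rewrite gap_le => /andP[].
have g2 : k0%:R / n%:R <= k%:R / n%:R + B%:R * (1 / n%:R) :> R.
  by rewrite mulrA mulr1 -mulrDl -natrD ler_pM2r ?invr_gt0 // ler_nat; move: knear; rewrite gap_le => /andP[].
split; first by apply: spike_ge0; rewrite cE ler_norml; lra.
have [xc|xc] := leP (pi / 2) (x + center k).
  rewrite -spike_reflect; apply: le_trans (_ : 0 <= _); first lra.
  by apply: spike_ge0; rewrite ler_norml; rewrite cE in xc *; lra.
rewrite lerN2; apply: le_trans (ler_norm _) _.
have xk : B%:R / n%:R <= x.
  by apply: le_trans xc1; rewrite ler_pM2r ?invr_gt0 // ler_nat.
have Bgt0 : 0 < B%:R :> R by rewrite ltr0n (ltn_trans _ B3).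
have y0 : 0 < B%:R / n%:R :> R by rewrite divr_gt0.
apply: le_trans (@spike_decay R n _ (B%:R / n%:R) n0 y0 _ _) _.
- by rewrite cE; lra.
- by move: xc xk xr2; rewrite mulrC; lra.
- rewrite [n%:R * _]mulrC divfK ?gt_eqF //.
  have B20 : 1000 * 1000 <= B%:R ^+ 2 :> R.
    by rewrite expr2 ler_pM.
  by rewrite ler_pdivrMr ?exprn_gt0 //; lra.
Qed.

(** The spike of [k1] is at least [66 / 100] within distance [1 / n]. The near terms share the sign
    [al k1], so only their mirror images, at most three, take something away; the far terms cost
    [3 / 100]. *)
Lemma spikes_ge : 6 / 10 <= `|spikes x|.
Proof.
have n0 : (0 < n)%N := leq_ltn_trans (leq0n _) n_big.
set S := \sum_(0 <= k < N | ch k && (gap k k0 <= B)%N)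
    (spike n (x - center k) - spike n (x + center k)).
have e : \sum_(0 <= k < N | ch k && (gap k k0 <= B)%N)
    al k * (spike n (x - center k) - spike n (x + center k)) = al k1 * S.
  by rewrite mulr_sumr; apply: eq_bigr => k /andP[kc kn]; rewrite al_const.
have k1near : (gap k1 k0 <= B)%N by rewrite gap_le; case: k1_cell => [->|<-]; rewrite ?leq_addr // leqW ?leq_addr // -addn1 leq_add2l (ltn_trans _ B3).
have peak : 66 / 100 <= spike n (x - center k1).
  apply: le_trans (spike_peak _ n0).
  have [xc1 xc2] := andP x_cell.
  have xc : `|x - center k1| <= n%:R^-1.
    have c0 : k0.+1%:R / n%:R = k0%:R / n%:R + n%:R^-1 :> R by rewrite -natr1 mulrDl mul1r.
    rewrite ler_norml /center; case: k1_cell => [->|->]; rewrite c0 in xc2 *; first lra.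
    have : 0 < n%:R^-1 :> R by rewrite invr_gt0.
    lra.
  have xc' : (x - center k1) ^+ 2 <= n%:R ^- 2.
    rewrite -[leLHS]real_normK ?num_real // -exprVn.
    by rewrite lerXn2r ?nnegrE ?invr_ge0.
  have n2 : 0 < n%:R ^+ 2 :> R by rewrite exprn_gt0.
  have h : (2 * n%:R ^+ 2 + 1) * (x - center k1) ^+ 2 <= 2 + n%:R ^- 2.
    have {xc'} := ler_wpM2l (_ : 0 <= 2 * n%:R ^+ 2 + 1 :> R) xc'.
    rewrite [X in _ -> _ <= X](_ : _ = (2 * n%:R ^+ 2 + 1) * n%:R ^- 2); last first.
      by rewrite mulrDl mul1r -mulrA divff ?gt_eqF // mulr1.
    by apply; rewrite addr_ge0 // mulr_ge0 // ltW.
  have h' : n%:R ^- 2 <= 1 / 100 :> R.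
    have n10 : 10 <= n%:R :> R.
      apply: le_trans (_ : B%:R <= _); first by move: B_big; lra.
      by rewrite ler_nat; apply: leq_trans (ltnW n_big); rewrite mul2n -addnn leq_addr.
    have : 10 * 10 <= n%:R ^+ 2 :> R by rewrite expr2 ler_pM.
    by move=> ?; rewrite -[leLHS]mul1r ler_pdivrMr //; lra.
  lra.
have Sge : 65 / 100 <= S.
  have h1 : \sum_(0 <= k < N | ch k && (gap k k0 <= B)%N) (1 / 1000 : R) <= 3 / 1000.
    rewrite (_ : \sum_(0 <= k < N | _) _ =
      1 / 1000 * \sum_(0 <= k < N | ch k && (gap k k0 <= B)%N) 1).
      by have := near_count; lra.
    by rewrite mulr_sumr; apply: eq_bigr => k _; rewrite mulr1.
  suff h2 : 66 / 100 <= S + \sum_(0 <= k < N | ch k && (gap k k0 <= B)%N) (1 / 1000 : R) by lra.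
  rewrite -big_split /= big_mkcond (bigD1_seq k1) ?iota_uniq ?mem_index_iota //=.
  rewrite k1_ch k1near /=; apply: ler_wpDr.
    apply: sumr_ge0 => k _; case: ifP => // /andP[kc kn].
    by have [] := near_term kc kn; lra.
  by have [_] := near_term k1_ch k1near; lra.
rewrite spikes_split e.
have h : `|al k1 * S| = S by rewrite normrM al1 mul1r ger0_norm //; lra.
have := lerB_normD (al k1 * S) (\sum_(0 <= k < N | ch k && (B < gap k k0)%N)
    al k * (spike n (x - center k) - spike n (x + center k))).
have := far_sum; rewrite h; lra.
Qed.

End Spikes.

(** * Clusters of bad cells *)

Local Open Scope nat_scope.

Lemma count_le3 (P : pred nat) (a b : nat) :
  (forall k1 k2 k3 k4, (k1 < k2)%N -> (k2 < k3)%N -> (k3 < k4)%N ->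
     (a <= k1)%N -> (k4 < b)%N -> P k1 -> P k2 -> P k3 -> P k4 -> False) ->
  (\sum_(a <= k < b | P k) 1 <= 3)%N.
Proof.
move=> no4; rewrite sum1_count -size_filter leqNgt; apply/negP => s4.
set s := seq.filter P _ in s4.
have ss : sorted ltn s by apply: sorted_filter (iota_ltn_sorted _ _); exact: ltn_trans.
have sP i : (i < size s)%N -> P (nth 0 s i) /\ (a <= nth 0 s i < b)%N.
  by move=> /(mem_nth 0); rewrite mem_filter mem_index_iota => /andP[].
have lt i : (i.+1 < size s)%N -> (nth 0 s i < nth 0 s i.+1)%N.
  move=> h; apply: (sorted_ltn_nth ltn_trans 0 ss) => //.
  by rewrite inE; apply: ltn_trans h.
have [p0 r0] := sP 0 ltac:(lia); have [p1 r1] := sP 1 ltac:(lia).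
have [p2 r2] := sP 2 ltac:(lia); have [p3 r3] := sP 3 ltac:(lia).
have := lt 0 ltac:(lia); have := lt 1 ltac:(lia); have := lt 2 ltac:(lia).
move=> l3 l2 l1; apply: (no4 _ _ _ _ l1 l2 l3 _ _ p0 p1 p2 p3); lia.
Qed.

Section Clusters.
Variables (bad : pred nat) (L B : nat).
Hypothesis no4 : forall k1 k2 k3 k4,
  (k1.+2 <= k2)%N -> (k2.+2 <= k3)%N -> (k3.+2 <= k4)%N -> (k4 < k1 + L)%N ->
  bad k1 -> bad k2 -> bad k3 -> bad k4 -> False.
Hypothesis BL : (3 * B < L)%N.

(** A greedy thinning of the bad cells: no two chosen cells are adjacent, so points in different
    ones are at least one cell length apart, and a bad cell that is left out follows a chosen
    one. *)
Fixpoint chosen (k : nat) : bool :=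
  bad k && (if k is k'.+1 then ~~ chosen k' else true).

Lemma chosen_bad k : chosen k -> bad k.
Proof. by case: k => [|k] /= /andP[]. Qed.

Lemma bad_chosen k : bad k -> exists2 k1, chosen k1 & k1 = k \/ k1.+1 = k.
Proof.
case: k => [|k] bk; first by exists 0; [rewrite /= bk|left].
case: (boolP (chosen k)) => ck; first by exists k => //; right.
by exists k.+1; [rewrite /= bk|left].
Qed.

Lemma chosen_gap k k' : chosen k -> chosen k' -> (k < k')%N -> (k.+2 <= k')%N.
Proof.
move=> ck ck' kk'; rewrite ltn_neqAle kk' andbT; apply/eqP => e.
by move: ck'; rewrite -e /= ck andbF.
Qed.

Lemma chosen_no4 k1 k2 k3 k4 : (k1 < k2)%N -> (k2 < k3)%N -> (k3 < k4)%N ->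
  (k4 < k1 + L)%N -> chosen k1 -> chosen k2 -> chosen k3 -> chosen k4 -> False.
Proof.
move=> h1 h2 h3 h4 c1 c2 c3 c4.
exact: (no4 (chosen_gap c1 c2 h1) (chosen_gap c2 c3 h2) (chosen_gap c3 c4 h3) h4
  (chosen_bad c1) (chosen_bad c2) (chosen_bad c3) (chosen_bad c4)).
Qed.

Lemma chosen_window_count N a W : (W < L)%N ->
  (\sum_(0 <= k < N | chosen k && (a <= k <= a + W)) 1 <= 3)%N.
Proof.
move=> WL; apply: count_le3 => k1 k2 k3 k4 h1 h2 h3 _ _.
move=> /andP[c1 r1] /andP[c2 r2] /andP[c3 r3] /andP[c4 r4].
apply: (chosen_no4 h1 h2 h3 _ c1 c2 c3 c4); lia.
Qed.

Lemma chosen_count N : (\sum_(0 <= k < N | chosen k) 1 <= 3 * (N %/ L).+1)%N.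
Proof.
have L0 : (0 < L)%N by lia.
have key W : (\sum_(0 <= k < W * L | chosen k) 1 <= 3 * W)%N.
  elim: W => [|W IH]; first by rewrite mul0n big_geq.
  rewrite (@big_cat_nat _ _ _ (W * L)) //= ?leq_mul2r ?leqnSn ?orbT //.
  rewrite mulnS addnC leq_add //; apply: count_le3 => k1 k2 k3 k4 h1 h2 h3 h4 h5.
  by apply: chosen_no4 => //; rewrite mulSn in h5; lia.
apply: leq_trans (key _); rewrite [leqRHS](@big_cat_nat _ _ _ N) ?leq_addr //=.
by rewrite ltnW // ltn_ceil.
Qed.

(* lead k, the last cluster start up to k, labels the cluster of a chosen k. *)
Definition cluster_start k := chosen k && ~~ has chosen (index_iota (k - B) k).

Fixpoint lead (k : nat) : nat :=
  if k is k'.+1 then if cluster_start k then k else lead k' else 0.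

Lemma lead_le k : (lead k <= k)%N.
Proof. by elim: k => //= k IH; case: ifP => // _; apply: leq_trans IH _. Qed.

Lemma lead_no_start k j : (lead k < j <= k)%N -> ~~ cluster_start j.
Proof.
elim: k => [|k IH] /=; first lia.
case: ifPn => sk; first lia.
move=> /andP[h1 h2]; have [jk|] := leqP j k; first by apply: IH; rewrite h1.
by move=> kj; have -> : j = k.+1 by lia.
Qed.

(** A cluster starts only where none of the [B] preceding cells is chosen, which fails just after
    [k]. *)
Lemma lead_same k k' : chosen k -> (k <= k' <= k + B)%N -> lead k' = lead k.
Proof.
move=> ck; elim: k' => [|k' IH] h; first by have -> : k = 0 by lia.
have [e|ne] := eqVneq k k'.+1; first by rewrite e.
rewrite /= ifN; first by apply: IH; lia.
apply/negP => /andP[_ /negP]; apply; apply/hasP.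
by exists k; rewrite // mem_index_iota; lia.
Qed.

(** Otherwise three steps back from [k], each of at most [B] and to a chosen cell, would give four
    chosen cells within [3 * B < L]. *)
Lemma lead_cluster k : chosen k -> (k <= lead k + 3 * B)%N.
Proof.
move=> ck; rewrite leqNgt; apply/negP => kB.
have prev j : chosen j -> (lead k < j <= k)%N ->
    exists2 i, chosen i & (i < j <= i + B)%N.
  move=> cj /lead_no_start; rewrite /cluster_start cj negbK => /hasP[k0].
  by rewrite mem_index_iota => ij ci; exists k0 => //; lia.
have [k1 c1 h1] := prev k ck ltac:(lia).
have [k2 c2 h2] := prev k1 c1 ltac:(lia).
have [k3 c3 h3] := prev k2 c2 ltac:(lia).
by apply: (@chosen_no4 k3 k2 k1 k) => //; lia.
Qed.

Lemma lead_count N c : (\sum_(0 <= k < N | chosen k && (lead k == c)) 1 <= 3)%N.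
Proof.
apply: count_le3 => k1 k2 k3 k4 h1 h2 h3 _ _.
move=> /andP[c1 /eqP e1] /andP[c2 _] /andP[c3 _] /andP[c4 /eqP e4].
apply: (chosen_no4 h1 h2 h3 _ c1 c2 c3 c4).
by have := lead_cluster c4; have := lead_le k1; lia.
Qed.

End Clusters.

Local Open Scope ring_scope.

(** * Laurent polynomials from signs *)

Lemma big_even_odd (V : nmodType) (n : nat) (F : nat -> V) :
  \sum_(0 <= k < (2 * n).+1) F k =
  \sum_(0 <= i < n.+1) F (2 * i)%N + \sum_(0 <= l < n) F (2 * l + 1)%N.
Proof.
elim: n => [|n IH]; first by rewrite muln0 !big_nat1 big_geq // addr0 muln0.
rewrite mulnS !addSn add0n big_nat_recr // big_nat_recr //= IH.
rewrite [in RHS]big_nat_recr //= [X in _ = _ + X]big_nat_recr //= addn1 mulnS !addSn add0n.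
by rewrite -[LHS]addrA [X in _ + X = _]addrC addrACA.
Qed.

Section Laurent.
Variables (R : realType) (n : nat) (a : nat -> int) (sym : pred nat).

(** Equal coefficients at exponents [k] and [- k] pair to a cosine, opposite ones to a sine; [sym]
    selects the former. *)
Definition laurent_signs (i : nat) : int :=
  if (i < 2 * n)%N then (if sym (2 * n - i)%N then 1 else -1) * a (2 * n - i)%N
  else if (i == 2 * n)%N then 1 else a (i - 2 * n)%N.

Lemma laurent_signs_sign : (forall k, (0 < k <= 2 * n)%N -> a k = 1 \/ a k = -1) ->
  forall i, (i < 4 * n + 1)%N -> laurent_signs i = 1 \/ laurent_signs i = -1.
Proof.
move=> a1 i i4; rewrite /laurent_signs; case: ltngtP => [i2|i2|_]; last by left.
  have [|->|->] := a1 (2 * n - i)%N; first lia.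
    by case: sym; rewrite mulr1; auto.
  by case: sym; rewrite ?mulN1r ?mul1r ?opprK; auto.
by apply: a1; lia.
Qed.

Lemma laurent_signsE (x : R) :
  laurent_sign_poly n laurent_signs (cis x) =
  ((1 + 2 * \sum_(0 <= k < 2 * n | sym k.+1) (a k.+1)%:~R * cos (x *+ k.+1)) +i*
   (2 * \sum_(0 <= k < 2 * n | ~~ sym k.+1) (a k.+1)%:~R * sin (x *+ k.+1)))%C.
Proof.
pose F i : R[i] := (laurent_signs i)%:~R * cis x ^ (i%:Z - (2 * n)%:Z).
pose G k : R[i] := ((2 * (if sym k.+1 then (a k.+1)%:~R * cos (x *+ k.+1) else 0)) +i*
   (2 * (if ~~ sym k.+1 then (a k.+1)%:~R * sin (x *+ k.+1) else 0)))%C.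
rewrite /laurent_sign_poly -/(F _) (eq_bigr F) //.
have e1 : \sum_(0 <= i < 2 * n) F i = \sum_(0 <= k < 2 * n) F (2 * n - k.+1)%N.
  by rewrite big_nat_rev.
have e2 : \sum_((2 * n).+1 <= i < 4 * n + 1) F i =
    \sum_(0 <= k < 2 * n) F (k + (2 * n).+1)%N.
  rewrite -{1}[(2 * n).+1]add0n big_addn.
  by have -> : (4 * n + 1 - (2 * n).+1 = 2 * n)%N by lia.
have F0 : F (2 * n)%N = 1 by rewrite /F /laurent_signs ltnn eqxx subrr expr0z mulr1.
rewrite (@big_cat_nat _ _ _ (2 * n)) /=; [|lia..].
rewrite [X in _ + X]big_ltn; last lia.
rewrite F0 e1 e2 addrCA -big_split /=.
rewrite (eq_big_nat _ _ (F2 := G)) => [|k /andP[_ kn]].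
  apply/eqP; rewrite eq_complex; apply/andP; split; apply/eqP.
    have -> : complex.Re (1 + \sum_(0 <= k < 2 * n) G k) =
      1 + complex.Re (\sum_(0 <= k < 2 * n) G k) by case: (\sum_(_ <= _ < _) _).
    by rewrite Re_sum /G /= -mulr_sumr -big_mkcond.
  have -> : complex.Im (1 + \sum_(0 <= k < 2 * n) G k) =
    complex.Im (\sum_(0 <= k < 2 * n) G k) by case: (\sum_(_ <= _ < _) _) => ? ? /=; rewrite add0r.
  by rewrite Im_sum /G /= -mulr_sumr -big_mkcond.
have -> : F (2 * n - k.+1)%N = (if sym k.+1 then 1 else -1) * (a k.+1)%:~R * cis (- (x *+ k.+1)).
  rewrite /F /laurent_signs.
  have -> : (2 * n - k.+1 < 2 * n)%N by lia.
  have -> : (2 * n - (2 * n - k.+1) = k.+1)%N by lia.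
  have -> : (2 * n - k.+1)%N%:Z - (2 * n)%:Z = - k.+1%:Z by rewrite -subzn //; lia.
  rewrite -exprz_inv -cisN -exprnP -cisX mulNrn rmorphM.
  by case: sym; rewrite ?rmorphN1 ?rmorph1.
have -> : F (k + (2 * n).+1)%N = (a k.+1)%:~R * cis (x *+ k.+1).
  rewrite /F /laurent_signs.
  have -> : (k + (2 * n).+1 < 2 * n)%N = false by lia.
  have -> : (k + (2 * n).+1 == 2 * n)%N = false by lia.
  have -> : (k + (2 * n).+1 - 2 * n = k.+1)%N by lia.
  have -> : (k + (2 * n).+1)%N%:Z - (2 * n)%:Z = k.+1%:Z.
    by rewrite addnS -addSn PoszD addrK.
  by rewrite -exprnP cisX.
rewrite /G -(rmorph_int (@real_complex R)) /cis cosN sinN.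
by case: sym; apply/eqP; rewrite eq_complex /=; apply/andP; split; apply/eqP; ring.
Qed.

End Laurent.

Lemma big_nat_window (V : nmodType) (m a b : nat) (F : nat -> V) : (b <= m)%N ->
  \sum_(0 <= i < m | (a <= i < b)%N) F i = \sum_(a <= i < b) F i.
Proof.
move=> bm; rewrite (eq_bigl (fun i => (i < b)%N && (a <= i)%N)); last by move=> i; rewrite andbC.
rewrite [RHS](@big_nat_widenl _ _ _ _ 0) //.
rewrite [RHS](@big_nat_widen _ _ _ _ _ m) //.
by apply: eq_bigl => i; rewrite andbC.
Qed.

Section CosineSide.
Variables (R : realType) (t c n : nat).
Hypothesis ct : (2 ^ t <= c)%N.
Hypothesis cn : (2 * c + 2 ^ t <= n.+1)%N.

(** The frequencies are doubled because the waves are taken at [u = 2 x]; being even, they leave all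
    odd frequencies to the spikes. *)
Definition cos_freq (k : nat) : bool := ~~ odd k &&
  ((c <= k./2 < c + 2 ^ t) || (2 * c <= k./2 < 2 * c + 2 ^ t))%N.

Definition cos_coef (k : nat) : int :=
  if (k./2 < c + 2 ^ t)%N then rs t true (k./2 - c) else rs t false (k./2 - 2 * c).

Lemma cos_coef_sign k : cos_coef k = 1 \/ cos_coef k = -1.
Proof. by rewrite /cos_coef; case: ifP => _; exact: rs_sign. Qed.

Lemma cosine_sum (x : R) :
  \sum_(0 <= k < 2 * n | cos_freq k.+1) (cos_coef k.+1)%:~R * cos (x *+ k.+1) =
  two_waves t c (x *+ 2).
Proof.
have T0 := expn_gt0 2 t.
pose F k : R := if cos_freq k then (cos_coef k)%:~R * cos (x *+ k) else 0.
have -> : \sum_(0 <= k < 2 * n | cos_freq k.+1) (cos_coef k.+1)%:~R * cos (x *+ k.+1) =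
    \sum_(0 <= k < (2 * n).+1) F k.
  rewrite big_nat_recl // big_mkcond /= [F 0]ifN ?add0r //.
  by rewrite /cos_freq /=; lia.
rewrite big_even_odd [X in _ + X]big1 ?addr0 => [|l _]; last first.
  by rewrite /F ifN // /cos_freq negb_and negbK oddD oddM.
have h2 i : (2 * i)./2 = i by rewrite mul2n doubleK.
pose H i : R := (if (i < c + 2 ^ t)%N then rs t true (i - c) else rs t false (i - 2 * c))%:~R
  * cos (x *+ 2 *+ i).
rewrite (eq_bigr (fun i => if ((c <= i < c + 2 ^ t) || (2 * c <= i < 2 * c + 2 ^ t))%N
    then H i else 0)) => [|i _]; last first.
  by rewrite /F /H /cos_freq /cos_coef h2 oddM /= -mulrnA.
rewrite -big_mkcond (bigID (fun i => i < c + 2 ^ t)%N) /=.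
rewrite (eq_bigl (fun i => c <= i < c + 2 ^ t)%N); last by move=> i; lia.
rewrite [X in _ + X](eq_bigl (fun i => 2 * c <= i < 2 * c + 2 ^ t)%N); last by move=> i; lia.
rewrite !big_nat_window; [|lia..].
rewrite two_waves_cos; congr (_ + _).
  rewrite -{1}[c]add0n big_addn addKn [LHS]big_nat [RHS]big_nat; apply: eq_bigr => j /andP[_ jT].
  by rewrite /H addnC ltn_add2l jT addKn.
rewrite -{1}[(2 * c)%N]add0n big_addn addKn [LHS]big_nat [RHS]big_nat; apply: eq_bigr => j /andP[_ jT].
rewrite /H addnC addKn ifF //; lia.
Qed.

Lemma two_wavesN (x : R) : two_waves t c (- x) = two_waves t c x.
Proof.
by rewrite !two_waves_cos; congr (_ + _); apply: eq_bigr => j _; rewrite mulNrn cosN.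
Qed.

Lemma two_waves_reflect (x : R) : two_waves t c ((pi - x) *+ 2) = two_waves t c (x *+ 2).
Proof.
have h k : cos ((pi - x) *+ 2 *+ k) = cos (x *+ 2 *+ k).
  by rewrite !mulrnBl addrC (periodicn (@cosD2pi R)) cosN.
by rewrite !two_waves_cos; congr (_ + _); apply: eq_bigr => j _; rewrite h.
Qed.

End CosineSide.

(** * The sine side: coefficients of the spikes, rounding, and signs of the clusters *)

Section SineSide.
Variables (R : realType) (n N : nat) (ch : pred nat) (al : nat -> R).

Lemma spikesN x : spikes n N ch al (- x) = - spikes n N ch al x.
Proof.
rewrite /spikes -sumrN; apply: eq_bigr => k _; rewrite -[RHS]mulrN; congr (_ * _).
set a := center R n k; have -> : - x - a = - (x + a) by rewrite opprD.
have -> : - x + a = - (x - a) by rewrite opprB addrC.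
by rewrite !spikeN opprB.
Qed.

Lemma spikes_reflect x : spikes n N ch al (pi - x) = spikes n N ch al x.
Proof.
apply: eq_bigr => k _; congr (_ * _).
have -> : pi - x - center R n k = pi - (x + center R n k) by rewrite opprD addrA.
have -> : pi - x + center R n k = pi - (x - center R n k) by rewrite opprB addrA addrAC.
by rewrite !spike_reflect opprK addrC.
Qed.

(** From [cos (a - b) - cos (a + b) = 2 * sin a * sin b]. *)
Definition spike_coef (k : nat) : R := if odd k then
  2 * spike_weight R n k./2 * \sum_(0 <= j < N | ch j) al j * sin (center R n j *+ k) else 0.

Lemma spikes_sine_sum x : sine_sum (2 * n) spike_coef x = spikes n N ch al x.
Proof.
rewrite /sine_sum -(big_mkord xpredT (fun k => spike_coef k * sin (x *+ k))).
rewrite big_even_odd big1 ?add0r => [|i _]; last by rewrite /spike_coef oddM mul0r.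
rewrite /spikes.
transitivity (\sum_(0 <= l < n) \sum_(0 <= j < N | ch j) al j * (spike_weight R n l *
   (cos ((x - center R n j) *+ (2 * l + 1)) - cos ((x + center R n j) *+ (2 * l + 1))))).
  apply: eq_bigr => l _; rewrite /spike_coef oddD oddM /=.
  have -> : (2 * l + 1)./2 = l by lia.
  rewrite -mulrA mulr_suml mulr_sumr; apply: eq_bigr => j _.
  by rewrite mulrnBl mulrnDl cosB cosD; ring.
rewrite exchange_big /=; apply: eq_bigr => j _; rewrite -mulr_sumr; congr (_ * _).
by rewrite /spike -sumrB; apply: eq_bigr => l _; rewrite mulrBr.
Qed.

End SineSide.

(** The rounding lemma controls [20 * n] sample points, and [sine_sampling] extends the bound to all
    [y] at the cost of a factor [36 / 32]. The constants fit: [2 ^ 71 * 20 <= (53 / 2) ^ 16] and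
    [36 / 32 * (53 / 2) <= 30]. *)
Lemma sine_rounding (R : realType) (n : nat) (F : pred nat) (e : nat -> R) :
  (0 < n)%N -> ~~ F 0%N -> (forall k, `|e k| <= 1) ->
  exists x : nat -> R, [/\ forall k, (k <= 2 * n)%N -> F k -> x k = 1 \/ x k = -1,
    forall k, ~~ F k -> x k = e k &
    forall y, `|sine_sum (2 * n) x y - sine_sum (2 * n) e y| <= 30 * Num.sqrt n%:R].
Proof.
move=> n0 F0 e1.
have nR : 0 < n%:R :> R by rewrite ltr0n.
set r : R := Num.sqrt n%:R; have r0 : 0 < r by rewrite sqrtr_gt0.
have r2 : r ^+ 2 = n%:R by rewrite sqr_sqrtr // ltW.
pose m := ((2 * n).*2 + 16 * n)%N.
have mE : m = (20 * n)%N by rewrite /m; lia.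
pose t : R := 2 * pi / m%:R.
pose v (j : 'I_m) : 'rV[R]_((2 * n).+1) := \row_k sin (t *+ j *+ k).
pose S := [set k : 'I_(2 * n).+1 | F k].
have S2 : (#|S| <= 2 * n)%N.
  have := cardsC1 (ord0 : 'I_(2 * n).+1); rewrite card_ord /= => cE.
  suff : (#|S| <= #|[set~ (ord0 : 'I_(2 * n).+1)]|)%N by rewrite cE.
  apply: subset_leq_card; apply/fintype.subsetP => k; rewrite !inE => Fk.
  by apply: contraNneq F0 => k0; move: Fk; rewrite k0.
have [|||||x [x1 x2 x3]] := @rounding R _ m v _ _ S (\row_k e k) (53 / 2 * r).
- by move=> i j; rewrite mxE sin_max.
- by rewrite mE; lia.
- by move=> j; rewrite mxE.
- by rewrite mulr_gt0 // divr_gt0.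
- rewrite exprMn -[16%N]/(2 * 8)%N [r ^+ _]exprM r2 mE natrM.
  have S2' : #|S|%:R <= 2 * n%:R :> R by rewrite -natrM ler_nat.
  apply: le_trans (_ : 2 ^+ 64 * (2 * n%:R) ^+ 7 * (20 * n%:R) <= _).
    by rewrite ler_wpM2r ?mulr_ge0 // ler_wpM2l ?exprn_ge0 // lerXn2r ?nnegrE // mulr_ge0.
  have n8 : 0 < n%:R ^+ 8 :> R by rewrite exprn_gt0.
  have -> : 2 ^+ 64 * (2 * n%:R) ^+ 7 * (20 * n%:R) = 2 ^+ 71 * 20 * n%:R ^+ 8 :> R by ring.
  by rewrite ler_pM2r //; lra.
pose X (k : nat) : R := if insub k is Some k' then x 0 (k' : 'I_(2 * n).+1) else e k.
have XE (k : 'I_(2 * n).+1) : X k = x 0 k by rewrite /X valK.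
exists X; split.
- move=> k k2 Fk; have kn : (k < (2 * n).+1)%N by [].
  by rewrite (XE (Ordinal kn)); apply: x1; rewrite inE.
- move=> k Fk; rewrite /X; case: insubP => // k' _ k'k.
  by rewrite x2 ?mxE ?inE k'k.
have dE y : sine_sum (2 * n) X y - sine_sum (2 * n) e y =
    sine_sum (2 * n) (fun k => X k - e k) y.
  by rewrite /sine_sum -sumrB; apply: eq_bigr => k _; rewrite mulrBl.
move=> y; rewrite dE.
have h j : (j < m)%N -> sine_sum (2 * n) (fun k => X k - e k) (t *+ j) <= 53 / 2 * r.
  move=> jm; have := x3 (Ordinal jm); congr (_ <= _); rewrite dotrC /sine_sum.
  by apply: eq_bigr => k _; rewrite !mxE XE.
have d0 : (0 < 2 * n)%N by lia.
have := sine_sampling d0 h y; rewrite -/m mE.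
have -> : (16 * n + 20 * n = 36 * n)%N by lia.
rewrite !natrM; set z := `|_| => hz.
have : n%:R * (32 * z) <= n%:R * (36 * (53 / 2 * r)) by lra.
by rewrite ler_pM2l //; lra.
Qed.

(** One coordinate of the rounding lemma per cluster, starting from 0. The entry for a frequency and
    a cluster is a third of a sum of at most three sines, hence at most 1 in size; each frequency
    enters with both signs to bound the absolute value. *)
Lemma cluster_colouring (R : realType) (n N : nat) (ch : pred nat) (lead : nat -> nat)
    (f : nat -> R) (K B : R) :
  (0 < n)%N -> (forall k, (lead k <= k)%N) ->
  (forall c, (\sum_(0 <= k < N | ch k && (lead k == c)) 1 <= 3)%N) ->
  (\sum_(0 <= k < N | ch k) 1)%:R <= K ->
  0 < B -> 2 ^+ 64 * K ^+ 7 * (2 * n%:R) <= B ^+ 16 ->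
  exists al : nat -> R, [/\ forall k, `|al k| = 1,
    forall k k', lead k = lead k' -> al k = al k' &
    forall l, (l < n)%N -> `|\sum_(0 <= k < N | ch k) al k * sin (f k *+ (2 * l + 1))| <= 3 * B].
Proof.
move=> n0 leadk count3 countK B0 KB.
have leadN (k : 'I_N) : (lead k < N)%N := leq_ltn_trans (leadk k) (ltn_ord k).
pose ld (k : 'I_N) := Ordinal (leadN k).
pose S := [set ld k | k : 'I_N & ch k].
have SK : #|S|%:R <= K.
  apply: le_trans countK; rewrite ler_nat big_mkord sum1dep_card.
  by apply: leq_trans (leq_imset_card _ _) _; rewrite cardsE.
pose g (l : nat) (c : 'I_N) : R := \sum_(k < N | ch k && (ld k == c)) sin (f k *+ (2 * l + 1)).
have g3 l c : `|g l c| <= 3.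
  apply: le_trans (ler_norm_sum _ _ _) _.
  apply: le_trans (_ : \sum_(k < N | ch k && (ld k == c)) 1%:R <= _).
    by apply: ler_sum => k _; exact: sin_max.
  rewrite -natr_sum ler_nat; have := count3 c; rewrite big_mkord; apply: leq_trans.
  by rewrite leq_eqVlt; apply/orP; left; apply/eqP; apply: eq_bigl => k.
pose v (i : 'I_(n + n)) : 'rV[R]_N := \row_c (match fintype.split i with
  | inl l => g l c / 3 | inr l => - (g l c / 3) end).
have [|||||x [x1 _ x3]] := @rounding R N (n + n) v _ _ S 0 B.
- move=> i c; rewrite mxE; case: fintype.split => l; rewrite ?normrN normrM normfV;
    by rewrite [`|3|]ger0_norm // ler_pdivrMr // mul1r.
- by rewrite addn_gt0 n0.
- by move=> j; rewrite mxE normr0.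
- by [].
- apply: le_trans KB; rewrite addnn -mul2n natrM ler_wpM2r ?mulr_ge0 //.
  rewrite ler_wpM2l ?exprn_ge0 // lerXn2r ?nnegrE //.
  by apply: le_trans SK.
pose al k := if insub (lead k) is Some c then (if c \in S then x 0 c else 1) else 1.
have xsign c : c \in S -> `|x 0 c| = 1.
  by move=> /x1[->|->]; rewrite ?normrN normr1.
exists al; split.
- move=> k; rewrite /al; case: insubP => [c _ _|_]; last exact: normr1.
  by case: ifP => [/xsign//|_]; exact: normr1.
- by move=> k k' e; rewrite /al e.
- move=> l ln.
  have e : \sum_(0 <= k < N | ch k) al k * sin (f k *+ (2 * l + 1)) = \sum_c g l c * x 0 c.
    under [RHS]eq_bigr do rewrite mulr_suml.
    rewrite big_mkord (exchange_big_dep (fun k : 'I_N => ch k)) /=; last by move=> c k _ /andP[].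
    apply: eq_bigr => k ck; rewrite (big_pred1 (ld k)) => [|c]; last by rewrite /= ck eq_sym.
    have kS : ld k \in S by apply/imsetP; exists k; rewrite // inE.
    have -> : al k = x 0 (ld k).
      rewrite /al; case: insubP => [c _ cE|]; last by rewrite leadN.
      have -> : c = ld k by apply: val_inj.
      by rewrite kS.
    by rewrite mulrC.
  rewrite e ler_norml; apply/andP; split.
    have := x3 (rshift n (Ordinal ln)); rewrite subr0 /dotr.
    rewrite (eq_bigr (fun c => - (1 / 3) * (g l c * x 0 c))) => [|c _]; last first.
      by rewrite mxE (unsplitK (inr _ : 'I_n + 'I_n)) /=; field.
    by rewrite -mulr_sumr; lra.
  have := x3 (lshift n (Ordinal ln)); rewrite subr0 /dotr.
  rewrite (eq_bigr (fun c => (1 / 3) * (g l c * x 0 c))) => [|c _]; last first.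
    by rewrite mxE (unsplitK (inl _ : 'I_n + 'I_n)) /=; field.
  by rewrite -mulr_sumr; lra.
Qed.

Lemma dyadic_scale (n s : nat) : (2 ^ s <= n)%N ->
  exists t, (2 ^ t * 2 ^ s <= n < 2 ^ t.+1 * 2 ^ s)%N.
Proof.
move=> sn; have s0 := expn_gt0 2 s; rewrite /= in s0.
have q0 : (0 < n %/ 2 ^ s)%N by rewrite divn_gt0.
have /andP[h1 h2] := trunc_log_bounds (isT : 1 < 2)%N q0.
exists (trunc_log 2 (n %/ 2 ^ s)).
by rewrite -leq_divRL // h1 /= -ltn_divLR.
Qed.

Lemma double_div_lt (n c : nat) : (0 < c)%N -> (64 <= n %/ (32 * c))%N ->
  (2 * n %/ (n %/ (32 * c)) < 65 * c)%N.
Proof.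
move=> c0; have c32 : (0 < 32 * c)%N by rewrite muln_gt0.
have := ltn_ceil n c32; set L := (n %/ _)%N => h L64.
rewrite ltn_divLR; last by apply: leq_trans L64.
have : (c * 64 <= c * L)%N by rewrite leq_mul2l L64 orbT.
by move: h; clear; lia.
Qed.

Lemma odd_half_lt n k : odd k -> (k <= 2 * n)%N -> k = (2 * k./2 + 1)%N /\ (k./2 < n)%N.
Proof. by move=> ok kn; split; lia. Qed.

(** With spike height [52 * r], the constants multiply to [52 * 2 * 2 * 3 / 2 ^ 10], which is
    [624 / 1024]. *)
Lemma spike_coef_bound (R : realFieldType) (N r w S : R) :
  0 < N -> 0 < r -> r ^+ 2 = N -> 0 <= w <= 2 / N -> `|S| <= 3 * (r / 2 ^+ 10) ->
  `|52 * r * (2 * w * S)| <= 1.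
Proof.
move=> N0 r0 rN /andP[w0 w1] Sr.
have -> : 52 * r * (2 * w * S) = 104 * r * (w * S) by ring.
rewrite normrM ger0_norm; last by rewrite mulr_ge0 // ltW.
have : `|w * S| <= 2 / N * (3 * (r / 2 ^+ 10)).
  by rewrite normrM (ger0_norm w0) ler_pM.
move=> /(ler_wpM2l (_ : 0 <= 104 * r)) h; apply: le_trans (h _) _.
  by rewrite mulr_ge0 // ltW.
have -> : 104 * r * (2 / N * (3 * (r / 2 ^+ 10))) = 624 / 1024 * (r ^+ 2 / N).
  by field; rewrite gt_eqF.
by rewrite rN divff ?gt_eqF //; lra.
Qed.

(** * Choice of the scales and assembly of the two sides *)

Section Assembly.
Variables (R : realType) (n t B : nat).
Let T : R := 2 ^+ t.
Hypothesis nT1 : T * 2 ^+ 48 <= n%:R.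
Hypothesis nT2 : n%:R <= T * 2 ^+ 49.
Hypothesis n_large : 2 ^+ 320 <= n%:R :> R.
Hypothesis BR : B%:R = 1024 :> R.

Let c := (2 ^ t * 128)%N.
Let r : R := Num.sqrt n%:R.
(** In the variable [u = 2 y], a window of [L] cells has length [2 * L / n], and this choice makes
    it at most [1 / (16 * c)], the width allowed by [no_four_small_values]. *)
Let L := (n %/ (32 * c))%N.

Let T0 : 0 < T. Proof. exact: exprn_gt0. Qed.
Let cT : c%:R = T * 128. Proof. by rewrite natrM natrX. Qed.
Let nR : 0 < n%:R :> R.
Proof. by apply: lt_le_trans n_large; exact: exprn_gt0. Qed.
Let n0 : (0 < n)%N. Proof. by rewrite -(ltr0n R). Qed.
Let r0 : 0 < r. Proof. by rewrite sqrtr_gt0. Qed.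
Let r2 : r ^+ 2 = n%:R. Proof. by rewrite sqr_sqrtr // ltW. Qed.
Let r_large : 2 ^+ 160 <= r.
Proof.
by rewrite -(@ler_pXn2r _ 2) ?nnegrE ?exprn_ge0 ?(ltW r0) // r2 -exprM.
Qed.
Let rho_ge : 2 ^- 24 * r <= rho R t.
Proof.
rewrite -(@ler_pXn2r _ 2) ?nnegrE ?mulr_ge0 ?invr_ge0 ?exprn_ge0 ?(ltW r0) ?(ltW (rho_gt0 R t)) //.
by rewrite exprMn r2 sqr_rho [2 ^+ t.+1]exprS -/T; move: nT2; lra.
Qed.
Let rho_le : rho R t <= r.
Proof.
rewrite -(@ler_pXn2r _ 2) ?nnegrE ?(ltW r0) ?(ltW (rho_gt0 R t)) //.
by rewrite r2 sqr_rho [2 ^+ t.+1]exprS -/T; move: nT1 T0; lra.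
Qed.

Let B0 : (0 < B)%N. Proof. by rewrite -(ltr0n R) BR. Qed.
Let c0 : (0 < c)%N. Proof. by rewrite muln_gt0 expn_gt0. Qed.
Let L0 : (8 * B <= L)%N.
Proof.
have c32 : (0 < 32 * c)%N by rewrite muln_gt0.
rewrite /L leq_divRL // -(ler_nat R) natrM (natrM _ 8) (natrM _ 32) BR cT.
by move: nT1 T0; lra.
Qed.
Let Lc : (L * (32 * c) <= n)%N. Proof. exact: leq_trunc_div. Qed.
Let BL : (3 * B.+1 < L)%N. Proof. by apply: leq_trans L0; move: B0; clear; lia. Qed.

Definition bad_cell (k : nat) : bool := `[< exists y : R,
  [/\ 0 <= y <= pi / 2, k%:R / n%:R <= y <= k.+1%:R / n%:R &
    `|two_waves t c (y *+ 2)| < 2 ^- 160 * r] >].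

Let bad_no4 k1 k2 k3 k4 :
  (k1.+2 <= k2)%N -> (k2.+2 <= k3)%N -> (k3.+2 <= k4)%N -> (k4 < k1 + L)%N ->
  bad_cell k1 -> bad_cell k2 -> bad_cell k3 -> bad_cell k4 -> False.
Proof.
move=> h12 h23 h34 h14 /asboolP[y1 [_ /andP[a1 b1] w1]] /asboolP[y2 [_ /andP[a2 b2] w2]].
move=> /asboolP[y3 [_ /andP[a3 b3] w3]] /asboolP[y4 [_ /andP[a4 b4] w4]].
(* Points of cells that are not adjacent differ by at least [1 / n], so the doubled ones by [2 / n],
   the spacing of the interpolation nodes. *)
have step k k' (y y' : R) : (k.+2 <= k')%N -> y <= k.+1%:R / n%:R -> k'%:R / n%:R <= y' ->
    y *+ 2 + 2 / n%:R <= y' *+ 2.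
  move=> kk' yk ky'.
  have : k.+2%:R / n%:R <= k'%:R / n%:R :> R by rewrite ler_pM2r ?invr_gt0 // ler_nat.
  rewrite -[k.+2%:R]natr1 mulrDl mul1r; lra.
have small y : `|two_waves t c (y *+ 2)| < 2 ^- 160 * r ->
    `|two_waves t c (y *+ 2)| <= (c%:R * (2 / n%:R)) ^+ 3 * rho R t / 2 ^+ 13.
  move=> /ltW /le_trans; apply.
  (* The exponent of the theorem: this bound enters cubed, [rho] is at least [2 ^- 24 * r], and
     there is a factor [2 ^- 13]; in total [3 * 41 + 24 + 13 = 160]. *)
  have ch : 2 ^- 41 <= c%:R * (2 / n%:R) :> R.
    rewrite mulrA ler_pdivlMr // cT; move: nT2; lra.
  have ch3 : (2 ^- 41) ^+ 3 <= (c%:R * (2 / n%:R)) ^+ 3 :> R.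
    by rewrite lerXn2r ?nnegrE ?invr_ge0 ?exprn_ge0 // mulr_ge0 // divr_ge0.
  rewrite ler_pdivlMr ?exprn_gt0 //.
  apply: le_trans (ler_pM _ _ ch3 rho_ge); last 2 first.
  - by rewrite exprn_ge0 // invr_ge0 exprn_ge0.
  - by rewrite mulr_ge0 ?invr_ge0 ?exprn_ge0 // ltW.
  by rewrite le_eqVlt; apply/orP; left; apply/eqP; field.
have h0 : 0 < 2 / n%:R :> R by rewrite divr_gt0.
have ct : (2 ^ t * 128 <= c)%N by [].
have wL : y4 *+ 2 - y1 *+ 2 <= 2 * L%:R / n%:R.
  have : k4.+1%:R / n%:R <= (k1 + L)%:R / n%:R :> R by rewrite ler_pM2r ?invr_gt0 // ler_nat.
  rewrite natrD mulrDl; lra.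
have wc : 2 * L%:R / n%:R * c%:R <= 1 / 16 :> R.
  have : L%:R * (32 * c%:R) <= n%:R :> R by rewrite -!natrM ler_nat.
  by rewrite mulrAC ler_pdivrMr //; lra.
exact: (no_four_small_values ct h0 (step _ _ _ _ h12 b1 a2) (step _ _ _ _ h23 b2 a3)
  (step _ _ _ _ h34 b3 a4) wL wc (small _ w1) (small _ w2) (small _ w3) (small _ w4)).
Qed.

(** Near 0 the two waves are at least [rho / 2], so the first [B] cells are good; this keeps spikes
    and their mirror images apart. *)
Let bad_ge k : bad_cell k -> (B <= k)%N.
Proof.
move=> /asboolP[y [/andP[y0 _] /andP[_ yk] yw]]; rewrite leqNgt; apply/negP => kB.
have ct : (2 ^ t * 128 <= c)%N by [].
have yB : y <= B%:R / n%:R.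
  by apply: le_trans yk _; rewrite ler_pM2r ?invr_gt0 // ler_nat.
have yc : `|y *+ 2| * c%:R <= 1 / 100.
  rewrite ger0_norm ?mulrn_wge0 // -[y *+ 2]mulr_natr cT.
  apply: le_trans (_ : B%:R / n%:R * 2 * (T * 128) <= _).
    by rewrite ler_wpM2r ?mulr_ge0 ?(ltW T0) // ler_wpM2r.
  rewrite (mulrAC B%:R) [leLHS]mulrAC ler_pdivrMr // BR; move: nT1 T0; lra.
have := two_waves_near0 ct yc; move: yw rho_ge r0; lra.
Qed.

Let ch := chosen bad_cell.
(** The radius is [B.+1], not [B]: a cell within [B] of a bad cell can be [B.+1] away from the
    chosen cell that serves it, which may be the preceding one. *)
Let ld := lead bad_cell B.+1.

(** Three chosen cells at most in each window of length [L]; then [3 * 65 * 128 <= 2 ^ 15] and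
    [T * 2 ^ 48 <= n]. *)
Let ch_count : (\sum_(0 <= k < 2 * n | ch k) 1)%:R <= 2 ^- 33 * n%:R :> R.
Proof.
have L64 : (64 <= L)%N.
  apply: leq_trans L0; rewrite -(ler_nat R) natrM BR; lra.
have := double_div_lt c0 L64; rewrite -/L => h1.
apply: le_trans (_ : (3 * (65 * c))%:R <= _).
  rewrite ler_nat; apply: leq_trans (chosen_count bad_no4 BL (2 * n)) _.
  by rewrite leq_mul2l.
rewrite (natrM _ 3) (natrM _ 65) cT; move: nT1 T0; lra.
Qed.

Let ct : (2 ^ t <= c)%N. Proof. exact: leq_pmulr. Qed.
Let cn : (2 * c + 2 ^ t <= n.+1)%N.
Proof.
rewrite ltnW // ltnS -(ler_nat R) natrD (natrM _ 2) cT natrX -/T.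
by move: nT1 T0; lra.
Qed.

Lemma exists_spike_colouring : exists al : nat -> R, [/\ forall k, `|al k| = 1,
  forall k k', ld k = ld k' -> al k = al k' &
  forall k, (k <= 2 * n)%N -> `|52 * r * spike_coef n (2 * n) ch al k| <= 1].
Proof.
have [||al [al1 al_lead al_sin]] := @cluster_colouring R n (2 * n) ch ld (center R n)
  (2 ^- 33 * n%:R) (r / 2 ^+ 10) n0 (lead_le _ _) (lead_count bad_no4 BL (2 * n)) ch_count.
- by rewrite divr_gt0 // exprn_gt0.
- rewrite expr_div_n (exprM r 2 8) r2 ler_pdivlMr ?exprn_gt0 //.
  have n8 : 0 < n%:R ^+ 8 :> R by rewrite exprn_gt0.
  (* The exponents of 2 add up to [65 - 7 * 33 + 160 = - 6]. *)
  rewrite [leLHS](_ : _ = 2 ^+ 65 * 2 ^- 33 ^+ 7 * (2 ^+ 10) ^+ 16 * n%:R ^+ 8); last by field.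
  by rewrite -[leRHS]mul1r ler_pM2r //; lra.
exists al; split => // k kn; rewrite /spike_coef; case: ifP => ok; last by rewrite mulr0 normr0.
have [kl ln] := odd_half_lt ok kn.
have h := al_sin _ ln; rewrite -kl in h.
exact: spike_coef_bound nR r0 r2 (spike_weight_bounds R ln) h.
Qed.

Let ch_pihalf k : ch k -> k%:R / n%:R <= pi / 2 :> R.
Proof.
move=> /chosen_bad/asboolP[y [/andP[_ y2] /andP[ky _] _]]; exact: le_trans ky y2.
Qed.

Let BL2 : (2 * B < L)%N.
Proof.
have h : (2 * B <= 3 * B.+1)%N by apply: leq_mul => //; exact: leqnSn.
exact: leq_ltn_trans h BL.
Qed.

Let ch_window a : (\sum_(0 <= k < 2 * n | ch k && (a <= k <= a + 2 * B)) 1 <= 3)%N.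
Proof. exact: (chosen_window_count bad_no4 BL). Qed.

Let nB : (2 * B < n)%N.
Proof.
have c32 : (0 < 32 * c)%N by rewrite muln_gt0.
exact: leq_trans BL2 (leq_trans (leq_pmulr L c32) Lc).
Qed.

Let B1000 : 1000 <= B%:R :> R. Proof. by rewrite BR; lra. Qed.

(** The cell of [y] has the integer part of [n * y] as index. If the waves are small at [y], that
    cell is bad, and all chosen cells within [B] of it belong to one cluster, so their signs
    agree. *)
Lemma spikes_dichotomy (al : nat -> R) (y : R) : (forall k, `|al k| = 1) ->
  (forall k k', ld k = ld k' -> al k = al k') -> 0 <= y <= pi / 2 ->
  `|spikes n (2 * n) ch al y| <= 7 /\
  (2 ^- 160 * r <= `|two_waves t c (y *+ 2)| \/ 6 / 10 <= `|spikes n (2 * n) ch al y|).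
Proof.
move=> al1 al_lead yr; have [y0 y2] := andP yr.
have ny0 : 0 <= n%:R * y by rewrite mulr_ge0 // ltW.
have /andP[k1 k2] := truncn_itv ny0; set k0 := Num.truncn _ in k1 k2.
have cell : k0%:R / n%:R <= y <= k0.+1%:R / n%:R.
  by rewrite ler_pdivrMr // ler_pdivlMr // [y * _]mulrC k1 ltW.
split; first exact: (spikes_le B1000 nB ch_pihalf ch_window al1 yr cell).
have [w|w] := leP (2 ^- 160 * r) `|two_waves t c (y *+ 2)|; [by left|right].
have bk0 : bad_cell k0 by apply/asboolP; exists y.
have [j cj jk0] := bad_chosen bk0.
have k0n : (k0 < 2 * n)%N.
  rewrite -(ltr_nat R) natrM mulrC; apply: le_lt_trans k1 _.
  by rewrite ltr_pM2l // (le_lt_trans y2) // pihalf_lt2.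
have jk : (j <= k0)%N by case: jk0 => [->|<-].
apply: (spikes_ge B1000 nB ch_pihalf ch_window al1 yr cell _ cj jk0 (bad_ge bk0)).
  exact: leq_ltn_trans jk k0n.
move=> k ck; rewrite gap_le => /andP[g1 g2]; apply: al_lead.
have [kj|/ltnW jk'] := leqP k j.
  apply/esym/(lead_same BL ck); rewrite kj addnS.
  exact: leq_trans jk (leq_trans g2 (leqnSn _)).
apply: (lead_same BL cj); rewrite jk' addnS -addSn.
by apply: leq_trans g1 _; rewrite leq_add2r; case: jk0 => [->|->].
Qed.

(** Both sums keep their absolute value under [y -> - y] and [y -> pi - y], which reduces to
    [[0, pi / 2]]. *)
Lemma spikes_dichotomy_all (al : nat -> R) (y : R) : (forall k, `|al k| = 1) ->
  (forall k k', ld k = ld k' -> al k = al k') -> `|y| <= pi ->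
  `|spikes n (2 * n) ch al y| <= 7 /\
  (2 ^- 160 * r <= `|two_waves t c (y *+ 2)| \/ 6 / 10 <= `|spikes n (2 * n) ch al y|).
Proof.
move=> al1 al_lead; wlog y0 : y / 0 <= y.
  move=> H yp; have [/H|/ltW yn] := leP 0 y; first exact.
  have := H (- y); rewrite oppr_ge0 normrN => /(_ yn yp).
  by rewrite spikesN normrN mulNrn two_wavesN.
rewrite ger0_norm // => yp; have [y2|y2] := leP y (pi / 2).
  by apply: spikes_dichotomy => //; rewrite y0.
rewrite -spikes_reflect -two_waves_reflect.
by apply: spikes_dichotomy => //; move: (@pi_gt0 R) yp y2; lra.
Qed.

Let a (x : nat -> R) (k : nat) : int :=
  if cos_freq t c k then cos_coef t c k else if x k == 1 then 1 else -1.

(** The height 52 beats the rounding error 30: where the spikes reach [6 / 10], the sine sum is at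
    least [(52 * 6 / 10 - 30) * r]. It is at most [(52 * 7 + 30) * r] everywhere, and twice this
    together with the cosine part stays below [2 ^ 12 * r]. *)
Lemma exists_flat_signs : exists (a : nat -> int) (sym : pred nat),
  (forall k, (0 < k <= 2 * n)%N -> a k = 1 \/ a k = -1) /\
  forall y : R, `|y| <= pi ->
    let W := 1 + 2 * \sum_(0 <= k < 2 * n | sym k.+1) (a k.+1)%:~R * cos (y *+ k.+1) in
    let V := 2 * \sum_(0 <= k < 2 * n | ~~ sym k.+1) (a k.+1)%:~R * sin (y *+ k.+1) in
    (2 ^- 160 * r <= `|W| \/ 2 ^- 160 * r <= `|V|) /\ `|W| + `|V| <= 2 ^+ 12 * r.
Proof.
have [al [al1 al_lead al_coef]] := exists_spike_colouring.
pose e k := if (k <= 2 * n)%N then 52 * r * spike_coef n (2 * n) ch al k else 0.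
(* Frequency 0 carries no sine and is excluded; the even frequencies outside [cos_freq] are rounded
   too, starting from 0. *)
pose F k := (0 < k)%N && ~~ cos_freq t c k.
have e1 k : `|e k| <= 1.
  by rewrite /e; case: ifP => [/al_coef//|_]; rewrite normr0.
have [x [x1 x2 x3]] := @sine_rounding R n F e n0 isT e1.
have eE y : sine_sum (2 * n) e y = 52 * r * spikes n (2 * n) ch al y.
  rewrite -spikes_sine_sum mulr_sumr; apply: eq_bigr => k _.
  by rewrite /e -ltnS ltn_ord mulrA.
exists (a x), (cos_freq t c); split.
  move=> k /andP[k0 k2]; rewrite /a; case: ifPn => [_|_]; first exact: cos_coef_sign.
  by case: ifP; auto.
move=> y ypi W V.
have WE : W = 1 + 2 * two_waves t c (y *+ 2).
  rewrite /W -(cosine_sum ct cn); congr (_ + _ * _).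
  by apply: eq_bigr => k kc; rewrite /a kc.
have VE : V = 2 * sine_sum (2 * n) x y.
  rewrite /V /sine_sum -(big_mkord xpredT (fun k => x k * sin (y *+ k))).
  rewrite big_nat_recl //= mulr0n sin0 mulr0 add0r; congr (_ * _).
  rewrite big_mkcond big_nat [RHS]big_nat; apply: eq_bigr => k /andP[_ kn].
  case: ifPn => kc; last first.
    (* The frequencies of the cosine sum are even, so their sine coefficient, which is not rounded,
       is 0. *)
    move: kc; rewrite negbK => kc; rewrite x2; last by rewrite /F kc.
    have ok : odd k.+1 = false by move: kc => /andP[/negbTE].
    by rewrite /e kn /spike_coef ok mulr0 mul0r.
  have Fk : F k.+1 by rewrite /F kc.
  rewrite /a (negbTE kc); case: (x1 _ kn Fk) => ->; first by rewrite eqxx.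
  by rewrite (_ : _ == _ = false) ?rmorphN1 //; apply/eqP; lra.
have [s7 sW] := spikes_dichotomy_all al1 al_lead ypi.
have := x3 y; rewrite eE; set s := sine_sum _ _ _ in VE *; set sp := spikes _ _ _ _ _ in s7 sW *.
move=> ssp.
have wle := @two_waves_le R t c (y *+ 2).
set w := two_waves _ _ _ in WE wle sW.
(* The constant coefficient 1 is absorbed by one of the two copies of [2 ^- 160 * r] that [2 * w]
   provides; this needs [2 ^ 320 <= n]. *)
have rl : 1 <= 2 ^- 160 * r by rewrite mulrC ler_pdivlMr ?exprn_gt0 // mul1r.
have r1 : 1 <= r by apply: le_trans r_large; rewrite exprn_ege1 // ler1n.
have ks : `|52 * r * sp| = 52 * r * `|sp| by rewrite normrM ger0_norm // mulr_ge0 // ltW.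
have b1 : `|s| <= 52 * r * `|sp| + 30 * r.
  by rewrite -ks -[s](subrK (52 * r * sp)) addrC; apply: le_trans (ler_normD _ _) _; rewrite lerD2l.
have b2 : 52 * r * `|sp| - 30 * r <= `|s|.
  have := lerB_dist (52 * r * sp) s; rewrite ks distrC; move: ssp; rewrite -/r; lra.
split.
  case: sW => sW.
    left; rewrite WE [1 + _]addrC; have := lerB_normD (2 * w) 1.
    rewrite normr1 normrM [`|2|]ger0_norm //; move: sW rl; lra.
  right; rewrite VE normrM [`|2|]ger0_norm //.
  have := ler_wpM2l (_ : 0 <= 52 * r) sW => /(_ ltac:(lra)).
  have : 2 ^- 160 * r <= 1 * r.
    by rewrite ler_pM2r // invf_le1 ?exprn_gt0 // exprn_ege1 // ler1n.
  lra.
rewrite WE VE; apply: le_trans (lerD (ler_normD _ _) (lexx _)) _.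
rewrite normr1 !normrM [`|2|]ger0_norm //.
have := ler_wpM2l (_ : 0 <= 52 * r) s7 => /(_ ltac:(lra)).
move: wle rho_le r1 b1; rewrite /c; lra.
Qed.

End Assembly.

Lemma complex_norm_bounds (R : realType) (W V : R) (d u : R) :
  (d <= `|W| \/ d <= `|V|) -> `|W| + `|V| <= u ->
  (d%:C)%C <= `|(W +i* V)%C| /\ `|(W +i* V)%C| <= (u%:C)%C.
Proof.
move=> dWV WVu; rewrite normc_def !lecR /=; split.
  case: dWV => /le_trans; apply; rewrite -sqrtr_sqr; apply: ler_wsqrtr.
    by rewrite lerDl sqr_ge0.
  by rewrite lerDr sqr_ge0.
apply: le_trans WVu; rewrite -[leRHS]ger0_norm ?addr_ge0 // -sqrtr_sqr.
apply: ler_wsqrtr; rewrite sqrrD !real_normK ?num_real //.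
have : 0 <= `|W| * `|V| by rewrite mulr_ge0.
lra.
Qed.

Unset Implicit Arguments.

Theorem theorem2p1 (R : realType) :
  exists N : nat, forall n : nat, (N <= n)%N ->
    exists eps : nat -> int,
      (forall i : nat, (i < 4 * n + 1)%N -> eps i = 1 \/ eps i = -1) /\
      (forall z : R[i], `|z| = 1 ->
         (((2 ^- 160 * Num.sqrt (n%:R : R))%:C)%C <= `|laurent_sign_poly n eps z|) /\
         (`|laurent_sign_poly n eps z| <= ((2 ^+ 12 * Num.sqrt (n%:R : R))%:C)%C)).
Proof.
exists (2 ^ 320)%N => n nN.
have [|t /andP[t1 t2]] := @dyadic_scale n 48.
  by apply: leq_trans nN; rewrite leq_exp2l.
have nT1 : 2 ^+ t * 2 ^+ 48 <= n%:R :> R by rewrite -!natrX -natrM ler_nat.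
have nT2 : n%:R <= 2 ^+ t * 2 ^+ 49 :> R.
  rewrite [2 ^+ 49]exprS mulrCA mulrA -exprS -!natrX -natrM ler_nat.
  exact: ltnW.
have nL : 2 ^+ 320 <= n%:R :> R by rewrite -natrX ler_nat.
have BR : (2 ^ 10)%:R = 1024 :> R by rewrite natrX; ring.
have [a [sym [a1 flat]]] := exists_flat_signs nT1 nT2 nL BR.
exists (laurent_signs n a sym); split; first exact: laurent_signs_sign.
move=> z /unit_circle_cis[y ypi ->]; rewrite laurent_signsE.
by have [h1 h2] := flat y ypi; exact: complex_norm_bounds.
Qed.
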